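(* Let $X$ be a finite-dimensional CAT(0) cube complex and let $\Gamma \leq \mathrm{Aut}(X)$ be a group acting essentially without a fixed point at infinity. Then for any half-space $\mathfrak{h}$ of $X$, there is some $\gamma \in \Gamma$ such that $\mathfrak{h}^* \subsetneq \gamma.\mathfrak{h}$.
   Context: A CAT(0) cube complex is a simply connected cell complex all of whose cells are Euclidean cubes with edge length one and such that the link of each vertex is a flag complex; it is endowed with the induced length metric, which is CAT(0). It is finite-dimensional if the supremum of the dimensions of its cubes is finite. $\mathrm{Aut}(X)$ is the group of automorphisms of the cube complex $X$. A fixed point at infinity is a fixed point in the visual boundary $\partial_\infty X$. The midpoint of each edge of $X$ belongs to a unique hyperplane; a hyperplane is a closed convex subspace (a union of midcubes) whose complement has exactly two connected components, both convex. The closures of these two components are called half-spaces; $\mathfrak{h}^*$ denotes the half-space complementary to $\mathfrak{h}$ (the other half-space bounded by the same hyperplane). A group $\Gamma \leq \mathrm{Aut}(X)$ acts essentially on $X$ if no $\Gamma$-orbit remains in a bounded neighbourhood of a half-space of $X$. *)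

(* Defs.v *)
From HB Require Import structures.
From Stdlib Require Import Relations.
From mathcomp Require Import all_boot all_order all_algebra.
From mathcomp Require Import all_classical all_reals all_analysis.
Import Order.TTheory GRing.Theory Num.Theory.

Set Implicit Arguments.
Unset Strict Implicit.
Unset Printing Implicit Defensive.

Local Open Scope classical_set_scope.
Local Open Scope ring_scope.

Section EuclideanCubes.
Context {R : realType}.

(* The norm of 'rV[R]_n in the library is the sup norm, hence this definition *)
Definition euclid_dist n (x y : 'rV[R]_n) : R :=
  Num.sqrt (\sum_(i < n) (x 0 i - y 0 i) ^+ 2).

Definition unit_cube n : set 'rV[R]_n :=
  [set x | forall i, 0 <= x 0 i <= 1].

(* A face fixes the coordinates in the domain of s to 0 or 1; the cube itself
   is a face, and faces are nonempty. *)
Definition cube_face n (s : 'I_n -> option bool) : set 'rV[R]_n :=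
  [set x | unit_cube x /\ forall i b, s i = Some b -> x 0 i = b%:R].

Definition isometry_onto m n (A : set 'rV[R]_m) (B : set 'rV[R]_n)
    (h : 'rV[R]_m -> 'rV[R]_n) : Prop :=
  set_bij A B h /\
  forall x y, A x -> A y -> euclid_dist (h x) (h y) = euclid_dist x y.

End EuclideanCubes.

(* Cubical complexes, as in Bridson--Haefliger, Definition I.7.32: each cell
   is an injective image of a unit cube, and two cells that meet are glued
   along an isometry between a face of one and a face of the other.  Moreover
   the cells are the faces of all dimensions, each indexed once.
   The values of [chart i] outside of the unit cube are irrelevant. *)
Unset Implicit Arguments.
Record cubeComplex (R : realType) := CubeComplex {
  point :> Type;
  cell_index : Type;
  dim : cell_index -> nat;
  chart : forall i : cell_index, 'rV[R]_(dim i) -> point;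
  chart_cover : forall p, exists i, exists2 x, unit_cube x & chart i x = p;
  chart_inj : forall i, set_inj (@unit_cube R (dim i)) (chart i);
  cell_inj : forall i j,
    chart i @` @unit_cube R (dim i) = chart j @` @unit_cube R (dim j) -> i = j;
  face_closed : forall i (s : 'I_(dim i) -> option bool),
    exists j, chart j @` @unit_cube R (dim j) = chart i @` cube_face s;
  cell_gluing : forall i j,
    chart i @` @unit_cube R (dim i) `&` chart j @` @unit_cube R (dim j) !=set0 ->
    exists (s : 'I_(dim i) -> option bool) (t : 'I_(dim j) -> option bool)
      (h : 'rV[R]_(dim i) -> 'rV[R]_(dim j)),
      isometry_onto (cube_face s) (cube_face t) h /\
      forall x y, unit_cube x -> unit_cube y ->
        (chart i x = chart j y <-> [/\ cube_face s x, cube_face t y & y = h x])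
}.
Set Implicit Arguments.
Arguments point {R} X : rename.
Arguments cell_index {R} X : rename.
Arguments dim {R X} i : rename.
Arguments chart {R X} i x : rename.

Section LengthMetric.
Context {R : realType} (X : cubeComplex R).

Definition cell (i : cell_index X) : set X :=
  chart i @` @unit_cube R (dim i).

(* A step of length l is a Euclidean segment of length l in some cell *)
Definition step (p q : X) (l : R) : Prop :=
  exists i x y, [/\ @unit_cube R (dim i) x, unit_cube y,
    chart i x = p, chart i y = q & l = euclid_dist x y].

(* Strings (piecewise linear paths) and their lengths *)
Inductive string : X -> X -> R -> Prop :=
| string_nil p : string p p 0
| string_cons p q r l m : step p q l -> string q r m -> string p r (l + m).

(* The length metric: the infimum of the lengths of the strings from p to q.
   It is only meaningful when there is such a string (inf set0 = 0), that is
   when p and q are in the same component of X. *)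
Definition dist (p q : X) : R := inf [set l | string p q l].

(* The open ball of the length metric, without junk when X is disconnected *)
Definition string_ball (p : X) (e : R) (q : X) : Prop :=
  exists2 l, string p q l & l < e.

Lemma step_sym p q l : step p q l -> step q p l.
Proof.
move=> [i [x [y [cx cy xp yq ->]]]]; exists i, y, x; split=> //.
by congr Num.sqrt; apply: eq_bigr => k _; rewrite -sqrrN opprB.
Qed.

Lemma string_cat p q r l m :
  string p q l -> string q r m -> string p r (l + m).
Proof.
move=> pql; elim: pql m => {p q l} [p m pr|p q q' l l' pq _ IH m q'r].
  by rewrite add0r.
by rewrite -addrA; apply: string_cons pq _; exact: IH.
Qed.

Lemma string_sym p q l : string p q l -> string q p l.
Proof.
elim=> {p q l} [p|p q r l m pq _ rq]; first exact: string_nil.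
rewrite addrC; apply: string_cat rq _.
by rewrite -[l]addr0; apply: string_cons (string_nil _); exact: step_sym.
Qed.

Lemma string_ball_center p e : 0 < e -> string_ball p e p.
Proof. by move=> e0; exists 0 => //; exact: string_nil. Qed.

Lemma string_ball_sym p q e : string_ball p e q -> string_ball q e p.
Proof. by move=> [l /string_sym]; exists l. Qed.

Lemma string_ball_triangle p q r e1 e2 :
  string_ball p e1 q -> string_ball q e2 r -> string_ball p (e1 + e2) r.
Proof.
move=> [l pq le1] [m qr me2]; exists (l + m); first exact: string_cat qr.
exact: ltrD.
Qed.

HB.instance Definition _ := gen_eqMixin (point X).
HB.instance Definition _ := gen_choiceMixin (point X).
HB.instance Definition _ :=
  hasNbhs.Build (point X) (nbhs_ (entourage_ string_ball)).
HB.instance Definition _ := @Nbhs_isPseudoMetric.Build R (point X)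
  (entourage_ string_ball) erefl string_ball
  string_ball_center string_ball_sym string_ball_triangle erefl.

End LengthMetric.

Definition path_connected (R : realType) (T : topologicalType) : Prop :=
  forall x y : T, exists f : R -> T,
    [/\ {within `[0, 1], continuous f}, f 0 = x & f 1 = y].

(* every loop is null-homotopic relative to its base point *)
Definition loops_contractible (R : realType) (T : topologicalType) : Prop :=
  forall f : R -> T, {within `[0, 1], continuous f} -> f 0 = f 1 ->
  exists H : R * R -> T,
    [/\ {within `[0, 1] `*` `[0, 1], continuous H},
        forall s : R, 0 <= s <= 1 -> H (s, 0) = f s /\ H (s, 1) = f 0 &
        forall t : R, 0 <= t <= 1 -> H (0, t) = f 0 /\ H (1, t) = f 0].

Definition simply_connected (R : realType) (T : topologicalType) : Prop :=
  path_connected R T /\ loops_contractible R T.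

(* An abstract simplicial complex, given by its set of simplices, is flag when
   every finite set of pairwise adjacent vertices is a simplex. *)
Definition flag (V : Type) (simplex : set (set V)) : Prop :=
  forall S, finite_set S ->
    (forall a b, S a -> S b -> simplex [set a; b]) -> simplex S.

Section CubeComplexes.
Context {R : realType} (X : cubeComplex R).
Implicit Types (i c e : cell_index X) (v : X).

Definition is_vertex v : Prop := exists2 i, dim i = 0%N & cell i v.

Definition is_edge e : Prop := dim e = 1%N.

(* The link of v: its vertices are the edges at v, and its simplices are the
   sets of edges at v of some cube containing v.  (The empty simplex is given
   by the 0-cube v.) *)
Definition link v : set (set (cell_index X)) :=
  [set S | exists2 c, cell c v &
     S = [set e | [/\ is_edge e, cell e v & cell e `<=` cell c]]].

Definition CAT0_cube_complex : Prop :=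
  simply_connected R X /\ forall v, is_vertex v -> flag (link v).

Definition finite_dimensional : Prop :=
  exists N : nat, forall i, (dim i <= N)%N.

Definition cellular (f : X -> X) : Prop :=
  forall i, exists j, exists2 h : 'rV[R]_(dim i) -> 'rV[R]_(dim j),
    isometry_onto (@unit_cube R (dim i)) (@unit_cube R (dim j)) h &
    forall x, unit_cube x -> f (chart i x) = chart j (h x).

Definition Aut : set (X -> X) :=
  [set f | exists g, [/\ cancel f g, cancel g f, cellular f & cellular g]].

Definition subgroup_of_Aut (Gamma : set (X -> X)) : Prop :=
  [/\ Gamma `<=` Aut, Gamma id,
      forall f g, Gamma f -> Gamma g -> Gamma (f \o g) &
      forall f, Gamma f -> exists g, [/\ Gamma g, cancel f g & cancel g f]].

Definition geodesic_ray (c : R -> X) : Prop :=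
  forall s t, 0 <= s -> 0 <= t -> dist (c s) (c t) = `|s - t|.

Definition asymptotic (c c' : R -> X) : Prop :=
  exists K, forall t, 0 <= t -> dist (c t) (c' t) <= K.

(* Rays are parametrized by [0, +oo[; the values of c on negative reals are
   irrelevant, as they do not matter in [geodesic_ray] and [asymptotic]. *)
Definition visual_boundary : set (set (R -> X)) :=
  [set xi | exists2 c, geodesic_ray c &
     xi = [set c' | geodesic_ray c' /\ asymptotic c c']].

Definition boundary_act (f : X -> X) (xi : set (R -> X)) : set (R -> X) :=
  [set f \o c | c in xi].

Definition has_fixed_point_at_infinity (Gamma : set (X -> X)) : Prop :=
  exists2 xi, visual_boundary xi &
    forall f, Gamma f -> boundary_act f xi = xi.

Definition midpoint e : X := chart e (const_mx 2^-1).

Definition midcube i (k : 'I_(dim i)) : set X :=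
  chart i @` [set x | @unit_cube R (dim i) x /\ x 0 k = 2^-1].

Definition opposite_in_square e e' : Prop :=
  [/\ is_edge e, is_edge e' & exists c,
    [/\ dim c = 2%N, cell e `<=` cell c, cell e' `<=` cell c &
        cell e `&` cell e' = set0]].

Definition parallel : relation (cell_index X) :=
  clos_refl_sym_trans _ opposite_in_square.

(* The hyperplane dual to the edge e: the union of the midcubes that contain
   the midpoint of some edge parallel to e. *)
Definition dual_hyperplane e : set X :=
  [set p | exists i (k : 'I_(dim i)) e',
     [/\ parallel e e', midcube k (midpoint e') & midcube k p]].

Definition is_hyperplane (H : set X) : Prop :=
  exists2 e, is_edge e & H = dual_hyperplane e.

Definition half_space_of (H h : set X) : Prop :=
  is_hyperplane H /\
  exists2 x, ~ H x & h = closure (connected_component (~` H) x).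

Definition half_space (h : set X) : Prop := exists H, half_space_of H h.

(* h' is the other half-space bounded by the same hyperplane as h *)
Definition complementary (h h' : set X) : Prop :=
  h <> h' /\ exists H, half_space_of H h /\ half_space_of H h'.

Definition bounded_neighbourhood (h : set X) (r : R) : set X :=
  [set p | exists2 q, h q & dist p q <= r].

Definition orbit_of (Gamma : set (X -> X)) (x : X) : set X :=
  [set f x | f in Gamma].

Definition acts_essentially (Gamma : set (X -> X)) : Prop :=
  forall h x, half_space h ->
    ~ exists r, orbit_of Gamma x `<=` bounded_neighbourhood h r.

End CubeComplexes.

Arguments CAT0_cube_complex {R} X.
Arguments finite_dimensional {R} X.

(* Main.v *)
(** Simple connectedness makes edge paths with the same ends equivalent under moves
across squares; with the flag condition this yields the quadrangle condition for the
vertex graph.  Half-spaces then correspond to the convex bipartitions of this graph, and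
a half-space [B] of the graph induces a 1-Lipschitz coordinate of the complex with
values in [[0, 1]] whose level set 1/2 is the hyperplane.

Suppose that the half-space complementary to [h] is a half-space [A] (of vertices)
no translate of which is disjoint from [A], except possibly for the complement of
[A].  Essentiality provides infinitely many translates of [A] missing a given vertex,
hence, as dimension bounds the antichains of intersecting half-spaces, an element that
skewers one of them.  Let [K] be the filter of the half-spaces that contain a member
of a terminal skewered chain.  As any two translates of half-spaces of [K] meet, there
are finitely many translates of the filter [K], say by [f_0], ..., [f_(r-1)], and
Gamma permutes them.  Far along the chain their half-spaces are distinct, and the
points whose coordinates at [f_i b] do not depend on [i] form a diagonal subcomplex.
Replacing all the coordinates of a point by those at one of the [f_i] maps the complex
to the diagonal, and by Cauchy-Schwarz one of these [r] maps does not lengthen a given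
path; thus distances between diagonal points are realized within the diagonal.  The
latter is unbounded and its bounded parts are covered by finitely many cells, so
that an ultralimit of segments is a geodesic ray.  Since the members of a skewered
chain are linearly ordered up to a bounded error, each element of Gamma displaces the
diagonal points by a bounded distance.  So the endpoint of this ray is fixed at
infinity, against the hypothesis. *)

From Stdlib Require Import Relations.
From mathcomp Require Import finmap.
From mathcomp Require Import all_boot all_order all_algebra.
From mathcomp Require Import all_classical all_reals all_analysis.
From mathcomp Require Import lra zify.
Require Import Defs.

Set Implicit Arguments.
Unset Strict Implicit.
Unset Printing Implicit Defensive.

Local Open Scope classical_set_scope.

(** * Paths in square complexes *)

(** The obstacle is that Gamma permutes the translated filters instead of fixing one of them, so a
    ray going down a single chain may be moved to another end. A ray that goes equally deep into all
    of them is treated alike by all elements, whence the diagonal. This ray has to be geodesic for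
    the length metric, and the projections to the diagonal serve this purpose: copying the part of a
    step seen by one of the r factors into all of them multiplies the square of that part by r,
    while the squares of the r parts add up to at most the square of the step. So the r copies of a
    string have total length at most r times its length. The exception allowed for A comes from the
    strictness in the conclusion: if f A misses A, then A lies in f h, with equality exactly when f
    A is the complement of A. The exception disappears once A is skewered. Finally, A has to be
    chosen in a maximal class of chains: maximality makes all but finitely many members of K that
    miss a given vertex lie deep in the chain of A, and the finiteness statements about K rest on
    this. *)

Section SquareComplex.
Variables (V : Type) (sq : V -> V -> V -> V -> Prop).
Hypothesis sq_rot : forall u a w b, sq u a w b -> sq a w b u.
Hypothesis sq_flip : forall u a w b, sq u a w b -> sq u b w a.
Hypothesis sq_neq : forall u a w b, sq u a w b -> a <> b.
Hypothesis sq_inj : forall u a w w' b, sq u a w b -> sq u a w' b -> w = w'.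
Hypothesis sq_cube : forall u a b c ab bc ac,
  sq u a ab b -> sq u b bc c -> sq u a ac c ->
  exists z, [/\ sq a ab z ac, sq b ab z bc & sq c ac z bc].

Ltac sqs := match goal with H : sq _ _ _ _ |- sq _ _ _ _ => first
  [ exact H | exact (sq_rot H) | exact (sq_rot (sq_rot H))
  | exact (sq_rot (sq_rot (sq_rot H))) | exact (sq_flip H)
  | exact (sq_rot (sq_flip H)) | exact (sq_rot (sq_rot (sq_flip H)))
  | exact (sq_rot (sq_rot (sq_rot (sq_flip H)))) ] end.

(* Paths are lists of vertices, listed from the last to the first. *)
Inductive sstep : seq V -> seq V -> Prop :=
| sstep_flip u a w b s : sq u a w b -> sstep (w :: a :: u :: s) (w :: b :: u :: s)
| sstep_cons x s t : sstep s t -> sstep (x :: s) (x :: t).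

Inductive seqv : seq V -> seq V -> Prop :=
| seqv_refl s : seqv s s
| seqv_step s t r : sstep s t -> seqv t r -> seqv s r.

Inductive bt : seq V -> Prop :=
| bt_here v w s : bt (v :: w :: v :: s)
| bt_cons x s : bt s -> bt (x :: s).

(** Reducedness as for words in a Coxeter group: flips across squares act as braid moves, backtracks
    as squares of generators. What follows is modelled on Tits' solution of the word problem. *)
Definition red (s : seq V) := forall t, seqv s t -> ~ bt t.

Lemma sstep_sym s t : sstep s t -> sstep t s.
Proof. by elim=> [u a w b r /sq_flip h|x r r' _ h]; constructor. Qed.

Lemma sstep_head s t x : sstep s t -> head x s = head x t.
Proof. by case. Qed.

Lemma sstep_size s t : sstep s t -> size s = size t.
Proof. by elim=> //= x r r' _ ->. Qed.

Lemma seqv_trans s t r : seqv s t -> seqv t r -> seqv s r.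
Proof. by elim=> // s' t' r' h _ IH /IH; apply: seqv_step. Qed.

Lemma seqv1 s t : sstep s t -> seqv s t.
Proof. by move=> h; apply: seqv_step h (seqv_refl _). Qed.

Lemma seqv_sym s t : seqv s t -> seqv t s.
Proof.
elim=> [s'|s' t' r h _ IH]; first exact: seqv_refl.
exact: seqv_trans IH (seqv1 (sstep_sym h)).
Qed.

Lemma seqv_cons x s t : seqv s t -> seqv (x :: s) (x :: t).
Proof.
elim=> [s'|s' t' r h _]; first exact: seqv_refl.
by apply: seqv_step; apply: sstep_cons.
Qed.

Lemma seqv_flip u a w b s : sq u a w b -> seqv (w :: a :: u :: s) (w :: b :: u :: s).
Proof. by move=> h; apply: seqv1; constructor. Qed.

Lemma seqv_size s t : seqv s t -> size s = size t.
Proof. by elim=> // s' t' r /sstep_size ->. Qed.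

Lemma seqv_head x s t : seqv s t -> head x s = head x t.
Proof. by elim=> // s' t' r /(sstep_head x) ->. Qed.

Lemma seqv_consE x s t : seqv (x :: s) t -> exists t', t = x :: t'.
Proof.
move=> h; have := seqv_size h; have := seqv_head x h.
by case: t {h} => //= y t -> _; exists t.
Qed.

(** An exchange property, by induction on the length and then on the number of flips. If the vertex
    before w changes twice, the two squares share the edge from f to w, and induction applied to the
    shorter path ending in f either identifies them or supplies a third square at f. *)
Lemma seqv_last2 (n : nat) w w' a b s t : (size s <= n)%N ->
  seqv (w :: a :: s) (w' :: b :: t) ->
  w = w' /\ ((a = b /\ seqv (a :: s) (b :: t)) \/
   exists u d, [/\ sq u a w b, seqv (a :: s) (a :: u :: d)
                 & seqv (b :: t) (b :: u :: d)]).
Proof.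
elim: n w w' a b s t => [|n IHn] w w' a b s t.
  case: s => // _ h; have := seqv_size h; case: t h => // h _.
  have key p q : seqv p q -> size p = 2 -> p = q.
    elim=> // p1 q1 r1 h1 _ IH e; move: e (IH).
    case: h1 => [//|x p2 q2 h2] /= [e2]; case: h2 e2 => //= y p3 q3 [] //.
  by case: (key _ _ h erefl) => <- <-; split => //; left; split => //; apply: seqv_refl.
move=> ls h.
have hd : w = w' by have := seqv_head w h.
split => //; subst w'.
remember (w :: b :: t) as q eqn:eq; remember (w :: a :: s) as p eqn:ep.
elim: h a b s t ls ep eq => {p q} [p|p p1 q st h IH] a b s t ls ep eq.
  by move: ep; rewrite eq => -[-> ->]; left; split => //; exact: seqv_refl.
have [f [s1 e1]] : exists f s1, p1 = w :: f :: s1.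
  have := sstep_size st; have := sstep_head w st; rewrite ep /=.
  by case: p1 {st h IH} => // x [//|f s1] /= -> _; exists f, s1.
have ls1 : (size s1 <= n.+1)%N.
  by have := sstep_size st; rewrite ep e1 /= => -[<-].
have P2 := IH _ _ _ _ ls1 e1 eq.
have {IH}P1 : (a = f /\ seqv (a :: s) (f :: s1)) \/
   exists u d, [/\ sq u a w f, seqv (a :: s) (a :: u :: d)
                 & seqv (f :: s1) (f :: u :: d)].
  move: st; rewrite ep e1 => st; inversion st; subst.
    by right; exists u, s0; split => //; exact: seqv_refl.
  left; split; last exact: seqv1.
  by have := sstep_head a H0.
case: P1 => [[ef h1]|[u1 [d1 [sq1 h1 h1']]]].
  subst f.
  case: P2 => [[<-] h2|[u [d [sq2 h2 h2']]]].
    by left; split => //; exact: seqv_trans h2.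
  by right; exists u, d; split => //; exact: seqv_trans h2.
case: P2 => [[<-] h2|[u2 [d2 [sq2 h2 h2']]]].
  right; exists u1, d1; split => //.
  exact: seqv_trans (seqv_sym h2) h1'.
have h3 : seqv (f :: u1 :: d1) (f :: u2 :: d2).
  exact: seqv_trans (seqv_sym h1') h2.
have ld1 : (size d1 <= n)%N.
  by have := seqv_size h1'; rewrite /= => -[e]; rewrite e ltnS in ls1.
have [_ [[e4 h4]|[z [d [sq4 h4 h4']]]]] := IHn _ _ _ _ _ _ ld1 h3.
  subst u2; left.
  have eab : a = b by apply: (@sq_inj f u1 _ _ w); sqs.
  split=> //; rewrite -eab in h2' *.
  apply: seqv_trans h1 _; apply: seqv_trans (seqv_cons _ h4) (seqv_sym h2').
(* The three squares meet at f and span a cube; its corner y opposite to f completes a, w and b to a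
   square. *)
have s1' : sq f w a u1 by sqs.
have s2' : sq f u1 z u2 by sqs.
have s3' : sq f w b u2 by sqs.
have [y [y1 y2 y3]] := sq_cube s1' s2' s3'.
right; exists y, (z :: d); split.
- by sqs.
- apply: seqv_trans h1 _; apply: seqv_trans (seqv_cons _ h4) _.
  by apply: seqv_flip; sqs.
- apply: seqv_trans h2' _; apply: seqv_trans (seqv_cons _ h4') _.
  by apply: seqv_flip; sqs.
Qed.

Lemma red_tail x s : red (x :: s) -> red s.
Proof. by move=> h t /(seqv_cons x) /h nb bt_t; apply: nb; constructor. Qed.

Lemma red_eqv s t : seqv s t -> red s -> red t.
Proof. by move=> st h r tr; apply: h; apply: seqv_trans tr. Qed.

(** By the exchange property, an equivalent path with a backtrack either still arrives through v,
    where the backtrack contradicts one of the hypotheses, or has its last step carried across a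
    square to a shorter path, where induction applies. *)
Lemma red_extend (n : nat) w v s : (size s <= n)%N -> red (v :: s) ->
  ~ (exists g, seqv (v :: s) (v :: w :: g)) -> red (w :: v :: s).
Proof.
elim: n w v s => [|n IH] w v s ls rs ng t h bt_t.
  case: s ls {rs ng} h => // _ h; have := seqv_size h.
  by inversion bt_t; subst; rewrite //; inversion H; subst => //; inversion H0.
have [t0 et] := seqv_consE h; subst t.
have [f [t1 et]] : exists f t1, t0 = f :: t1.
  by have := seqv_size h; case: t0 {h bt_t} => // f t1 _; exists f, t1.
subst t0.
have [_ [[e h1]|[u [d [sq1 h1 h1']]]]] := seqv_last2 (leqnn _) h.
  subst f; inversion bt_t; subst; last exact: rs _ h1 H0.
  by apply: ng; exists s0.
inversion bt_t; subst.
  have [_ [[e h2]|[z [d2 [sq2 h2 h2']]]]] := seqv_last2 (leqnn _) h1'.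
    by subst u; case: (sq_neq (sq_rot (sq_rot (sq_rot sq1)))).
  have ezv : z = v by apply: (@sq_inj f w _ _ u); sqs.
  subst z; apply: (rs (v :: u :: v :: d2)); last by constructor.
  by apply: seqv_trans h1 _; apply: seqv_cons.
have ru : red (u :: d) by apply: (@red_tail v); apply: red_eqv rs.
have ld : (size d <= n)%N.
  by have := seqv_size h1; rewrite /= => -[e]; rewrite e ltnS in ls.
have [[g hg]|nx] := pselect (exists g, seqv (u :: d) (u :: f :: g)).
  apply: ng; exists (f :: g).
  apply: seqv_trans h1 _; apply: seqv_trans (seqv_cons _ hg) _.
  by apply: seqv_flip; sqs.
exact: (IH f u d ld ru nx _ (seqv_sym h1')).
Qed.

(** The action of an edge on classes of reduced paths, like multiplication by a generator: the edge
    cancels when some equivalent path ends with it. It is meaningful up to flips only; the lemmas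
    below check that it respects flips, backtracks and squares. *)
Definition mul (s : seq V) (w : V) : seq V :=
  if s is v :: _ then
    if pselect (exists g, seqv s (v :: w :: g)) is left e then w :: sval (cid e)
    else w :: s
  else [:: w].

Lemma mulP w v s : red (v :: s) ->
  (exists2 g, seqv (v :: s) (v :: w :: g) & mul (v :: s) w = w :: g) \/
  (mul (v :: s) w = w :: v :: s /\ red (w :: v :: s)).
Proof.
rewrite /mul; case: pselect => [e|ne] rs.
  by left; case: (cid e) => g /= hg; exists g.
by right; split => //; apply: red_extend rs ne.
Qed.

Lemma mul_head w s : exists t, mul s w = w :: t.
Proof.
case: s => [|v s]; first by exists [::].
by rewrite /mul; case: pselect => [e|ne]; eexists.
Qed.

Lemma mul_red w v s : red (v :: s) -> red (mul (v :: s) w).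
Proof.
move=> rs; case: (mulP w rs) => [[g h ->]|[->]] //.
by apply: (@red_tail v); apply: red_eqv rs.
Qed.

Lemma seqv_tail w s t : seqv (w :: s) (w :: t) -> forall x, head x s = head x t ->
  seqv s t.
Proof.
case: s t => [|a s] [|b t] h x /=; first by move=> _; exact: seqv_refl.
- by have := seqv_size h.
- by have := seqv_size h.
move=> e; subst b.
by have [_ [[_ //]|[u [d [/sq_neq]]]]] := seqv_last2 (leqnn _) h.
Qed.

Lemma mul_eqv w v s t : red (v :: s) -> seqv (v :: s) (v :: t) ->
  seqv (mul (v :: s) w) (mul (v :: t) w).
Proof.
move=> rs st; have rt := red_eqv st rs.
case: (mulP w rs) => [[g hg ->]|[-> r1]];
  case: (mulP w rt) => [[g' hg' ->]|[-> r2]].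
- apply: (seqv_tail (w := v) _ (x := w)) => //.
  exact: seqv_trans (seqv_sym hg) (seqv_trans st hg').
- case: (r2 (w :: v :: w :: g)); last by constructor.
  by apply: seqv_cons; apply: seqv_trans (seqv_sym st) hg.
- case: (r1 (w :: v :: w :: g')); last by constructor.
  by apply: seqv_cons; apply: seqv_trans st hg'.
- exact: seqv_cons.
Qed.

Lemma red_mulE w v s : red (w :: v :: s) -> mul (v :: s) w = w :: v :: s.
Proof.
move=> r; case: (mulP w (red_tail r)) => [[g hg _]|[]//].
by case: (r (w :: v :: w :: g)); [exact: seqv_cons|constructor].
Qed.

Lemma mul_back w v s : red (v :: s) -> seqv (mul (mul (v :: s) w) v) (v :: s).
Proof.
move=> rs; case: (mulP w rs) => [[g hg ->]|[-> r1]].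
  rewrite red_mulE; first exact: seqv_sym.
  exact: red_eqv rs.
case: (mulP v r1) => [[g hg ->]|[_ r2]].
  by apply: seqv_sym; apply: (seqv_tail hg (x := v)).
by case: (r2 _ (seqv_refl _)); constructor.
Qed.

(** If the step to b cancels as well, the exchange property gives a common remainder d and both
    sides become [w :: d]. If not, the edge from b to w cancels after a flip, and both sides become
    [w :: a :: g]. *)
Lemma mul_sq_half u a w b s : sq u a w b -> red (u :: s) ->
  (exists g, seqv (u :: s) (u :: a :: g)) ->
  seqv (mul (mul (u :: s) a) w) (mul (mul (u :: s) b) w).
Proof.
move=> sq1 rs ha.
case: (mulP a rs) => [[g hg ->]|[ea r1]]; last first.
  case: ha => g hg; case: (r1 (a :: u :: a :: g)); last by constructor.
  exact: seqv_cons.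
have rg : red (a :: g) by apply: (@red_tail u); apply: red_eqv rs.
case: (mulP b rs) => [[g' hg' ->]|[-> r2]].
  have rg' : red (b :: g') by apply: (@red_tail u); apply: red_eqv rs.
  have h : seqv (u :: a :: g) (u :: b :: g') by exact: seqv_trans (seqv_sym hg) hg'.
  have [_ [[e _]|[z [d [sq2 h1 h2]]]]] := seqv_last2 (leqnn _) h.
    by case: (sq_neq sq1).
  have ez : z = w by apply: (@sq_inj u a _ _ b); sqs.
  subst z.
  case: (mulP w rg) => [[g1 hg1 ->]|[_ r3]]; last first.
    case: (r3 (w :: a :: w :: d)); last by constructor.
    exact: seqv_cons.
  case: (mulP w rg') => [[g2 hg2 ->]|[_ r3]]; last first.
    case: (r3 (w :: b :: w :: d)); last by constructor.
    exact: seqv_cons.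
  apply: (@seqv_trans _ (w :: d)).
    by apply: (seqv_tail (w := a) _ (x := w)) => //; exact: seqv_trans (seqv_sym hg1) h1.
  apply: (seqv_tail (w := b) _ (x := w)) => //.
  exact: seqv_trans (seqv_sym h2) hg2.
have nw : ~ exists g', seqv (a :: g) (a :: w :: g').
  move=> [g' hg']; case: (r2 (b :: u :: b :: w :: g')); last by constructor.
  apply: seqv_cons; apply: seqv_trans hg _; apply: seqv_trans (seqv_cons _ hg') _.
  by apply: seqv_flip; sqs.
case: (mulP w rg) => [[g' hg' _]|[-> r3]]; first by case: nw; exists g'.
case: (mulP w r2) => [[g' hg' ->]|[_ r4]]; last first.
  case: (r4 (w :: b :: w :: a :: g)); last by constructor.
  apply: seqv_cons; apply: seqv_trans (seqv_cons _ hg) _.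
  by apply: seqv_flip; sqs.
apply: (seqv_tail (w := b) _ (x := w)) => //.
apply: seqv_trans hg'; apply: seqv_sym; apply: seqv_trans (seqv_cons _ hg) _.
by apply: seqv_flip; sqs.
Qed.

Lemma mul_sq u a w b s : sq u a w b -> red (u :: s) ->
  seqv (mul (mul (u :: s) a) w) (mul (mul (u :: s) b) w).
Proof.
move=> sq1 rs.
have [ha|na] := pselect (exists g, seqv (u :: s) (u :: a :: g)).
  exact: mul_sq_half sq1 rs ha.
have [hb|nb] := pselect (exists g, seqv (u :: s) (u :: b :: g)).
  by apply: seqv_sym; apply: mul_sq_half rs hb; sqs.
case: (mulP a rs) => [[g hg _]|[-> ra]]; first by case: na; exists g.
case: (mulP b rs) => [[g hg _]|[-> rb]]; first by case: nb; exists g.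
have key a' b' : sq u a' w b' -> red (a' :: u :: s) ->
    (~ exists g, seqv (u :: s) (u :: b' :: g)) ->
    mul (a' :: u :: s) w = w :: a' :: u :: s.
  move=> sq2 ra' nb'; case: (mulP w ra') => [[g hg _]|[]//].
  have [_ [[e _]|[z [d [sq3 h1 h2]]]]] := seqv_last2 (leqnn _) hg.
    by case: (sq_neq (sq_rot sq2)); rewrite e.
  have ez : z = b' by apply: (@sq_inj a' u _ _ w); sqs.
  by subst z; case: nb'; exists d.
rewrite (key a b) // (key b a) //; last by sqs.
exact: seqv_flip.
Qed.

(** The edges of a path act in turn on a trivial path, which yields a reduced representative of its
    homotopy class. *)
Fixpoint nf (s : seq V) : seq V :=
  if s is w :: t then (if t is [::] then [:: w] else mul (nf t) w) else [::].

Lemma red1 x : red [:: x].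
Proof.
move=> t h b; have := seqv_size h; inversion b; subst => //.
by inversion H; subst => //; inversion H0.
Qed.

Lemma nf_cons w x s : nf (w :: x :: s) = mul (nf (x :: s)) w. Proof. by []. Qed.

Lemma nf_head w s : exists t, nf (w :: s) = w :: t.
Proof. by case: s => [|x s]; [exists [::]|rewrite nf_cons; apply: mul_head]. Qed.

Lemma nf_red w s : red (nf (w :: s)).
Proof.
elim: s w => [|x s IH] w; first exact: red1.
by rewrite nf_cons; case: (nf_head x s) (IH x) => t ->; apply: mul_red.
Qed.

Inductive hstep : seq V -> seq V -> Prop :=
| hstep_flip u a w b s : sq u a w b -> hstep (w :: a :: u :: s) (w :: b :: u :: s)
| hstep_bt v w s : hstep (v :: w :: v :: s) (v :: s)
| hstep_cons x s t : hstep s t -> hstep (x :: s) (x :: t).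

Inductive htp : seq V -> seq V -> Prop :=
| htp_refl s : htp s s
| htp_step s t r : hstep s t -> htp t r -> htp s r
| htp_step' s t r : hstep t s -> htp t r -> htp s r.

Lemma htp_trans s t r : htp s t -> htp t r -> htp s r.
Proof.
elim=> // s' t' r' h _ IH /IH; first exact: htp_step.
exact: htp_step'.
Qed.

Lemma htp_sym s t : htp s t -> htp t s.
Proof.
elim=> [r|s' t' r h _ IH|s' t' r h _ IH]; first exact: htp_refl.
  apply: htp_trans IH _; apply: htp_step' h (htp_refl _).
apply: htp_trans IH _; apply: htp_step h (htp_refl _).
Qed.

Lemma htp_cons x s t : htp s t -> htp (x :: s) (x :: t).
Proof.
elim=> [r|s' t' r h _ IH|s' t' r h _ IH]; first exact: htp_refl.
  by apply: htp_step IH; constructor.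
by apply: htp_step' IH; constructor.
Qed.

Lemma nf_hstep s t : hstep s t -> seqv (nf s) (nf t).
Proof.
elim=> [u a w b r h|v w r|x r r' h IH].
- by rewrite !nf_cons; case: (nf_head u r) (@nf_red u r) => t' ->; apply: mul_sq.
- by rewrite !nf_cons; case: (nf_head v r) (@nf_red v r) => t' ->; apply: mul_back.
- have [y [r1 [r1' [e e']]]] : exists y r1 r1', r = y :: r1 /\ r' = y :: r1'.
    by case: h => [????? _|???|????]; do 3 eexists.
  subst r r'; rewrite !nf_cons; move: IH (@nf_red y r1).
  by case: (nf_head y r1) => ? ->; case: (nf_head y r1') => ? -> ? ?; apply: mul_eqv.
Qed.

Lemma nf_htp s t : htp s t -> seqv (nf s) (nf t).
Proof.
elim=> [r|s' t' r /nf_hstep h _ IH|s' t' r /nf_hstep h _ IH].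
- exact: seqv_refl.
- exact: seqv_trans IH.
- exact: seqv_trans (seqv_sym h) IH.
Qed.

Lemma nf_id w s : red (w :: s) -> seqv (nf (w :: s)) (w :: s).
Proof.
elim: s w => [|x s IH] w r; first exact: seqv_refl.
rewrite nf_cons -(red_mulE r); have rx := red_tail r.
case: (nf_head x s) (IH x rx) (@nf_red x s) => t -> h1 h2.
exact: mul_eqv.
Qed.

(** The analogue of Tits' theorem: backtracks can be dispensed with, because [nf] is invariant under
    all moves and changes a reduced path by flips only. *)
Lemma red_htp w w' s t : red (w :: s) -> red (w' :: t) -> htp (w :: s) (w' :: t) ->
  seqv (w :: s) (w' :: t).
Proof.
move=> rs rt /nf_htp h.
exact: seqv_trans (seqv_sym (nf_id rs)) (seqv_trans h (nf_id rt)).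
Qed.

Lemma bt_split s : bt s -> exists p v w t, s = p ++ v :: w :: v :: t.
Proof.
elim=> [v w t|x t _ [p [v [w [r ->]]]]]; first by exists [::], v, w, t.
by exists (x :: p), v, w, r.
Qed.

Variable adj : V -> V -> Prop.
Hypothesis adj_sym : forall u v, adj u v -> adj v u.
Hypothesis sq_adj : forall u a w b, sq u a w b -> adj u a.

Fixpoint gpath (s : seq V) : Prop :=
  if s is x :: t then (if t is y :: _ then adj y x /\ gpath t else True) else True.

Definition walk u v (s : seq V) := gpath (v :: s) /\ last v s = u.

Hypothesis walk_ex : forall u v, exists s, walk u v s.
Hypothesis walk_htp : forall u v s t, walk u v s -> walk u v t -> htp (v :: s) (v :: t).

Lemma gdist_subproof u v : exists n, `[< exists2 s, walk u v s & size s = n >].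
Proof. by have [s h] := walk_ex u v; exists (size s); apply/asboolP; exists s. Qed.

Definition gdist u v := ex_minn (gdist_subproof u v).

Lemma gdist_walk u v : exists2 s, walk u v s & size s = gdist u v.
Proof. by rewrite /gdist; case: ex_minnP => n /asboolP. Qed.

Lemma gdist_min u v s : walk u v s -> (gdist u v <= size s)%N.
Proof.
by move=> h; rewrite /gdist; case: ex_minnP => n _; apply; apply/asboolP; exists s.
Qed.

Lemma gpath_tail x s : gpath (x :: s) -> gpath s.
Proof. by case: s => //= y s []. Qed.

Lemma sstep_gpath s t : sstep s t -> gpath s -> gpath t.
Proof.
elim=> [u a w b r h|x r r' h IH].
  move=> [_ [_ gr]]; split; first by apply: (@sq_adj b w a u); sqs.
  by split => //; apply: (@sq_adj u b w a); sqs.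
by case: h IH => [u a w b r'' h|y p q h] IH [h1 h2]; split => //; exact: IH.
Qed.

Lemma walk_seqv u v s t : walk u v s -> seqv (v :: s) (v :: t) -> walk u v t.
Proof.
move=> [gs ls] h.
have gp p q : seqv p q -> gpath p -> gpath q.
  by elim=> // p' q' r' st _ IH /(sstep_gpath st)/IH.
have lp p q : seqv p q -> forall x, last x p = last x q.
  elim=> // p' q' r' st _ IH x; rewrite -IH.
  by elim: st x => //= x' p1 q1 _ IH1 x; rewrite IH1.
by split; [exact: gp gs|have /= <- := lp _ _ h v].
Qed.

Lemma walk_bt u v s : walk u v s -> bt (v :: s) -> (gdist u v + 2 <= size s)%N.
Proof.
move=> [gs ls] /bt_split [p [w [z [t e]]]].
have gcat q r x : gpath (q ++ x :: r) -> gpath (x :: r).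
  by elim: q => //= y q IH; case: q IH => [|y' q] IH [].
case: p e => [[e1 e2]|y p [e1 e2]].
  subst w s; have -> : size [:: z, v & t] = (size t + 2)%N by rewrite addn2.
  rewrite leq_add2r; apply: gdist_min; split; last exact: ls.
  by move/gpath_tail/gpath_tail: gs.
subst y; have -> : size s = (size (p ++ w :: t) + 2)%N.
  by rewrite e2 !size_cat /= addn2 !addnS.
rewrite leq_add2r; apply: gdist_min; split; last first.
  by rewrite -ls e2 !last_cat.
rewrite e2 in gs; elim: p v gs {ls e2} => [|x p IH] v /=.
  by move=> [h [_ [_]]].
by move=> [h1 h2]; split => //; exact: (IH x h2).
Qed.

(** A backtrack in an equivalent walk could be cut out, leaving a walk shorter by two. *)
Lemma walk_red u v s : walk u v s -> size s = gdist u v -> red (v :: s).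
Proof.
move=> h e t st bt_t; have [t' et] := seqv_consE st; subst t.
have ht := walk_seqv h st; have := walk_bt ht bt_t.
by have /= [<-] := seqv_size st; rewrite e addn2 ltnNge leqnSn.
Qed.

(** All reduced walks with the same ends have the same length, so it is enough to let the edge act
    on a shortest walk to v. *)
Lemma gdist_bip x v w : adj v w ->
  gdist x w = (gdist x v).+1 \/ gdist x v = (gdist x w).+1.
Proof.
move=> vw; have [s hs es] := gdist_walk x v.
have rs := walk_red hs es.
have sz t : walk x w t -> red (w :: t) -> size t = gdist x w.
  move=> wt rt; have [t' wt' et'] := gdist_walk x w; rewrite -et'.
  have := seqv_size (red_htp rt (walk_red wt' et') (walk_htp wt wt')).
  by case.
case: (mulP w rs) => [[g hg _]|[_ r]].
  right; have [[_ g1] l1] := walk_seqv hs hg.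
  have := seqv_size hg; rewrite /= es => -[->]; rewrite -(sz g) //.
  by apply: red_tail (red_eqv hg rs).
by left; rewrite -(sz (v :: s)) ?es //= ?es //; case: hs => g1 l1; split.
Qed.

(** The shortest walks to b through a and through c are reduced and homotopic, hence equivalent, and
    the exchange property provides the square. *)
Lemma gdist_quad x a b c : adj a b -> adj c b -> a <> c ->
  gdist x b = (gdist x a).+1 -> gdist x b = (gdist x c).+1 ->
  exists2 u, sq b a u c & gdist x a = (gdist x u).+1.
Proof.
move=> ab cb ac e1 e2.
have [s [gs ls] es] := gdist_walk x a; have [t [gt lt] et] := gdist_walk x c.
have ws : walk x b (a :: s) by split.
have wt : walk x b (c :: t) by split.
have rs : red (b :: a :: s) by apply: (walk_red ws); rewrite /= es.
have rt : red (b :: c :: t) by apply: (walk_red wt); rewrite /= et.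
have h := red_htp rs rt (walk_htp ws wt).
have [_ [[]//|[u [d [sq1 h1 h2]]]]] := seqv_last2 (leqnn _) h.
exists u; first by sqs.
have [/gpath_tail g1 l1] := walk_seqv (conj gs ls) h1.
have le : (gdist x u <= size d)%N by apply: gdist_min.
have := seqv_size h1; rewrite /= es => -[e3].
case: (@gdist_bip x u a); first by apply: (@sq_adj u a b c).
  by [].
by move=> e4; move: le; rewrite e4 ltnNge e3 leqnSn.
Qed.

Lemma gdist_xx x : gdist x x = 0.
Proof. by apply/eqP; rewrite -leqn0; apply: (@gdist_min x x [::]). Qed.

Lemma gdist_eq0 x y : gdist x y = 0 -> x = y.
Proof. by have [[|z s] [_ /= l]] := gdist_walk x y; [rewrite l|move=> <-]. Qed.

Lemma gdist_step x y n : gdist x y = n.+1 -> exists2 z, adj z y & gdist x z = n.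
Proof.
have [[|z s] [gs ls] es] := gdist_walk x y => e; first by rewrite -es in e.
have zy : adj z y by case: gs.
exists z => //; have le : (gdist x z <= size s)%N.
  by apply: gdist_min; split => //; case: gs.
case: (gdist_bip x zy) => h; first by move: e; rewrite h => -[].
by move: le; rewrite h -es /= ltnNge leqnSn.
Qed.
End SquareComplex.

(** * Half-spaces of the vertex graph *)

Section HalfSpaces.
Variables (V : Type) (adj : V -> V -> Prop) (sq : V -> V -> V -> V -> Prop).
Hypothesis adj_sym : forall u v, adj u v -> adj v u.
Hypothesis sq_rot : forall u a w b, sq u a w b -> sq a w b u.
Hypothesis sq_flip : forall u a w b, sq u a w b -> sq u b w a.
Hypothesis sq_adj : forall u a w b, sq u a w b -> adj u a.
Hypothesis sq_neq : forall u a w b, sq u a w b -> a <> b.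
Hypothesis sq_inj : forall u a w w' b, sq u a w b -> sq u a w' b -> w = w'.
Variable d : V -> V -> nat.
Hypothesis d_xx : forall x, d x x = 0.
Hypothesis d_eq0 : forall x y, d x y = 0 -> x = y.
Hypothesis d_step : forall x y n, d x y = n.+1 -> exists2 z, adj z y & d x z = n.
Hypothesis d_bip : forall x v w, adj v w -> d x w = (d x v).+1 \/ d x v = (d x w).+1.
Hypothesis d_quad : forall x a b c, adj a b -> adj c b -> a <> c ->
  d x b = (d x a).+1 -> d x b = (d x c).+1 ->
  exists2 u, sq b a u c & d x a = (d x u).+1.

Lemma d_tri x y z : d x z <= d x y + d y z.
Proof.
move e : (d y z) => n; elim: n z e => [|n IH] z e.
  by rewrite (d_eq0 e) addn0.
have [t tz et] := d_step e; have := IH _ et.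
by case: (d_bip x tz); lia.
Qed.

Lemma d_adj x y : adj x y -> d x y = 1.
Proof. by move=> /(d_bip x) []; rewrite d_xx // => ->. Qed.

Lemma d_sym x y : d x y = d y x.
Proof.
suff h a b : d b a <= d a b by apply/eqP; rewrite eqn_leq !h.
move e : (d a b) => n; elim: n b e => [|n IH] b e.
  by rewrite (d_eq0 e) d_xx.
have [t tb et] := d_step e; have := IH _ et.
by have := d_tri b t a; rewrite (d_adj (adj_sym tb)); lia.
Qed.

Definition W a b : set V := [set v | d v b < d v a].

Definition hs (B : set V) := exists a b, adj a b /\ B = W a b.

Lemma W_compl a b : adj a b -> ~` W a b = W b a.
Proof.
move=> ab; apply/seteqP; split => v; rewrite /W /=;
  by case: (d_bip v ab); lia.
Qed.

Lemma hs_compl B : hs B -> hs (~` B).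
Proof.
by move=> [a [b [ab ->]]]; exists b, a; split; [exact: adj_sym|rewrite W_compl].
Qed.

Lemma W_r a b : adj a b -> W a b b.
Proof. by move=> ab; rewrite /W /= d_xx d_sym d_adj. Qed.

Lemma W_l a b : ~ W a b a.
Proof. by rewrite /W /= d_xx. Qed.

Lemma hs_W a b : adj a b -> hs (W a b). Proof. by exists a, b. Qed.

Lemma hs_ex B : hs B -> exists x, B x.
Proof. by move=> [a [b [ab ->]]]; exists b; apply: W_r. Qed.

(** For v on the wrong side, parity forces c and e' to be farther from v than c' and e. The
    quadrangle condition at c then gives a square with fourth corner closer still, but this corner
    must be e'. *)
Lemma W_sq_sub c c' e' e : sq c c' e' e -> W c e `<=` W c' e'.
Proof.
move=> s v; rewrite /W /= => h.
have cc' := sq_adj s; have c'e' := sq_adj (sq_rot s).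
have e'e := sq_adj (sq_rot (sq_rot s)); have ec := sq_adj (sq_rot (sq_rot (sq_rot s))).
case: (d_bip v c'e') => // h2; last by lia.
case: (d_bip v ec) => h1; last by lia.
case: (d_bip v cc') => h3; case: (d_bip v e'e) => h4; try lia.
have ne := sq_neq s.
have [||u su eu] := @d_quad v c' c e (adj_sym cc') ec ne; [lia|lia|].
by have ue := sq_inj su s; subst u; lia.
Qed.

Lemma W_sq c c' e' e : sq c c' e' e -> W c e = W c' e'.
Proof.
move=> s; apply/seteqP; split; apply: W_sq_sub => //.
exact: sq_flip (sq_rot s).
Qed.

Inductive par a b : V -> V -> Prop :=
| par_refl : par a b a b
| par_step c e c' e' : par a b c e -> sq c c' e' e -> par a b c' e'.

(** Induction on the distance from a to c: with c' a step closer to a, the quadrangle condition seen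
    from b pushes the edge from c to e across a square to an edge at c', which still crosses. *)
Lemma cross_par a b c e : adj a b -> adj c e -> ~ W a b c -> W a b e -> par a b c e.
Proof.
move=> ab; move n : (d a c) => k; elim: k c e n => [|k IH] c e n ce nc we.
  move/d_eq0: n nc we ce => <- _ we ae; move: we; rewrite /W /= (d_sym e a) (d_adj ae).
  rewrite ltnS leqn0 => /eqP /d_eq0 ->; exact: par_refl.
move: nc we; rewrite /W /= => nc we.
have e1 := d_bip a ce; have e2 := d_bip b ce; have e3 := d_bip c ab; have e4 := d_bip e ab.
rewrite !(d_sym c) !(d_sym e) in nc we e3 e4.
have [c' c'c ec'] := d_step n.
have e5 := d_bip b c'c; have e6 := d_bip c' ab; rewrite !(d_sym c') in e6.
have ne : c' <> e by move=> ?; subst; lia.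
have [||u su eu] := @d_quad b c' c e c'c (adj_sym ce) ne; [lia|lia|].
have c'u : adj c' u by apply: sq_adj (sq_rot su).
have ue : adj u e by apply: sq_adj (sq_rot (sq_rot su)).
have e7 := d_bip a ue; have e8 := d_bip a c'u; have e9 := d_bip b c'u.
have e10 := d_bip u ab; rewrite !(d_sym u) in e10.
have h : par a b c' u.
  by apply: (IH c' u) => //; rewrite /W /= ?(d_sym c') ?(d_sym u); lia.
exact: par_step h (sq_flip (sq_rot su)).
Qed.

Lemma par_W a b c e : par a b c e -> W a b = W c e.
Proof. by elim=> // c1 e1 c' e' _ -> /W_sq. Qed.

Lemma hs_edge B c e : hs B -> adj c e -> ~ B c -> B e -> B = W c e.
Proof.
by move=> [a [b [ab ->]]] ce nc Be; apply: par_W; apply: cross_par.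
Qed.

(** This is convexity. If the edge left B, the complement of B would be [W y y'], which contains
    z. *)
Lemma hs_geod B y y' z : hs B -> adj y y' -> d z y = (d z y').+1 ->
  B y -> B z -> B y'.
Proof.
move=> hB yy' e By Bz; apply: contrapT => n.
have := hs_edge (hs_compl hB) yy' (fun h => h By) n.
move=> /(congr1 (fun C => C z)) /=; rewrite /setC /W /= e ltnSn => h.
by have : ~ B z by rewrite h.
Qed.

Lemma W_inj x a b : adj x a -> adj x b -> W x a = W x b -> a = b.
Proof.
move=> xa xb /(congr1 (fun C => C b)); rewrite (propT (W_r xb)) => h.
have : W x a b by rewrite h.
rewrite /W /= (d_sym b x) (d_adj xb) ltnS leqn0 => /eqP /d_eq0 -> //.
Qed.

Lemma W_corner x a b z : adj x a -> adj x b -> a <> b -> W x a z -> W x b z ->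
  exists u, sq x a u b.
Proof.
move=> xa xb ab; rewrite /W /= => h1 h2.
have e1 := d_bip z xa; have e2 := d_bip z xb.
by have [||u su _] := @d_quad z a x b (adj_sym xa) (adj_sym xb) ab; [lia|lia|exists u].
Qed.

(** Along a shortest path from x to y, each edge crosses one new half-space and none is crossed
    back, by convexity. *)
Lemma sep_ex x y : exists s : seq (set V), [/\ uniq s, size s = d x y &
  forall B, B \in s <-> [/\ hs B, ~ B x & B y]].
Proof.
move n : (d x y) => k; elim: k y n => [|k IH] y n.
  by exists [::]; split => // B; split => // -[_]; rewrite (d_eq0 n).
have [z zy ez] := d_step n; have [s [us ss hss]] := IH z ez.
have xz : ~ W z y x by rewrite /W /= n ez; lia.
exists (W z y :: s); split => /=; [|by rewrite ss|].
  rewrite us andbT; apply/negP => /hss [_ _]; exact: W_l.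
move=> B; rewrite in_cons; split.
  move=> /orP[/eqP ->|/hss [hB nx Bz]].
    by split => //; [exact: hs_W|exact: W_r].
  split => //; apply: contrapT => nBy.
  have e := hs_edge (hs_compl hB) zy (fun h => h Bz) nBy.
  by apply: xz; rewrite -e.
move=> [hB nx By]; have [Bz|nz] := pselect (B z).
  by apply/orP; right; apply/hss.
by rewrite (hs_edge hB zy nz By) eqxx.
Qed.

Definition sep x y : seq (set V) := sval (cid (sep_ex x y)).

Lemma mem_sep x y B : B \in sep x y <-> [/\ hs B, ~ B x & B y].
Proof. by rewrite /sep; case: cid => s []. Qed.

Lemma size_sep x y : size (sep x y) = d x y.
Proof. by rewrite /sep; case: cid => s []. Qed.

Lemma sep_uniq x y : uniq (sep x y).
Proof. by rewrite /sep; case: cid => s []. Qed.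

(** A nearest point z is a gate, by strong induction on the distance from z to b. If the last step
    towards b came back closer to y, the quadrangle condition would give a vertex u adjacent to both
    b and b''; u lies in B, since opposite edges of a square cross the same half-space, and the
    induction hypothesis at u contradicts its distance to y. *)
Lemma gate y B : hs B -> exists2 z, B z & forall b, B b -> d y b = d y z + d z b.
Proof.
move=> hB.
have ex : exists n, `[< exists2 z, B z & d y z = n >].
  by have [z Bz] := hs_ex hB; exists (d y z); apply/asboolP; exists z.
case: (ex_minnP ex) => k /asboolP [z Bz ez] zmin.
have {}zmin b : B b -> k <= d y b.
  by move=> Bb; apply: zmin; apply/asboolP; exists b.
exists z => // b; rewrite ez; move n : (d z b) => j.
elim/ltn_ind: j b n => -[|j] IH b n Bb; first by rewrite -(d_eq0 n) ez addn0.
have [b' b'b eb'] := d_step n.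
have Bb' : B b'.
  by apply: (@hs_geod B b b' z) => //; [exact: adj_sym|rewrite n eb'].
have e1 := IH _ (ltnSn _) _ eb' Bb'; have e0 := zmin _ Bb.
case: (d_bip y b'b) => h; first by lia.
case: j => [|j] in IH n eb' e1 *; first by move: e1 h; lia.
have [b'' b''b' eb''] := d_step eb'.
have Bb'' : B b''.
  by apply: (@hs_geod B b' b'' z) => //; [exact: adj_sym|rewrite eb' eb''].
have e2 := IH _ (ltnW (ltnSn _)) _ eb'' Bb''.
have ne : b'' <> b by move=> ?; subst; lia.
have [||u su eu] := @d_quad y b'' b' b b''b' (adj_sym b'b) ne; [lia|lia|].
have Bu : B u.
  apply: contrapT => nu.
  have b''u := sq_adj (sq_rot su).
  have e := hs_edge (hs_compl hB) b''u (fun h => h Bb'') nu.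
  have h1 : (~` B) b by rewrite e -(W_sq su); apply: W_r.
  exact: h1.
have ub := sq_adj (sq_rot (sq_rot su)).
have e3 := d_bip z ub; have e4 := d_bip z (sq_adj (sq_rot su)).
have eu' : d z u = j.+1 by lia.
by have := IH _ (ltnSn _) _ eu' Bu; lia.
Qed.

(** Let y1 be the first vertex on a path from y to the gate z of B. Distances from y to B pass
    through z, so B lies in [W y y1], and no larger half-space misses y. *)
Lemma adjacent_of_minimal y B : hs B -> ~ B y ->
  (forall C, hs C -> ~ C y -> B `<=` C -> C = B) -> exists2 z, adj y z & B = W y z.
Proof.
move=> hB ny mB; have [z Bz hz] := gate y hB.
case e : (d z y) => [|n]; first by case: ny; rewrite -(d_eq0 e).
have [y1 y1y e1] := d_step e; have yy1 := adj_sym y1y.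
exists y1 => //; apply/esym; apply: mB; [exact: hs_W|exact: W_l|].
move=> b Bb; rewrite /W /= [d b y1]d_sym [d b y]d_sym.
have := d_tri y1 z b; have := hz b Bb; rewrite (d_sym y z) (d_sym y1 z); lia.
Qed.

Definition meets (s : set V) (t : set V) := exists2 z, s z & t z.

Lemma minimal_ex (s : seq (set V)) : s != [::] ->
  exists2 B, B \in s & forall C, C \in s -> C `<=` B -> C = B.
Proof.
elim: s => // A [|A' s'] IH _.
  by exists A; rewrite ?mem_head // => C; rewrite mem_seq1 => /eqP.
have [B Bs mB] := IH isT.
have [AB|nAB] := pselect (A `<=` B); last first.
  exists B; first by rewrite in_cons Bs orbT.
  by move=> C; rewrite in_cons => /orP[/eqP ->|/mB //] /nAB.
exists A; first exact: mem_head.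
move=> C; rewrite in_cons => /orP[/eqP //|Cs] CA.
have e := mB C Cs (fun x h => AB x (CA x h)); subst C.
by apply/seteqP.
Qed.

(** Sageev's duality for finite families. Remove a minimal member B and realize the others at y.
    Consistency and upward closure leave no half-space between y and B, so B is crossed by an edge
    at y, and crossing this edge changes nothing else. *)
Lemma realize x (s : seq (set V)) : uniq s ->
  (forall B, B \in s -> hs B /\ ~ B x) ->
  (forall B C, B \in s -> C \in s -> meets B C) ->
  (forall B C, B \in s -> hs C -> ~ C x -> B `<=` C -> C \in s) ->
  exists y, forall B, hs B -> ~ B x -> (B y <-> B \in s).
Proof.
move n : (size s) => k; elim: k s n => [|k IH] s n us h1 h2 h3.
  by exists x => B hB nB; case: s n {us h1 h2 h3} => // _; split.
have [|B Bs mB] := @minimal_ex s; first by case: s n {us h1 h2 h3}.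
have sub C : C \in rem B s -> C \in s by apply: mem_rem.
have nB C : C \in s -> C <> B -> C \in rem B s.
  by move=> Cs /eqP ne; rewrite mem_rem_uniq // inE ne.
have remB : B \notin rem B s by rewrite mem_rem_uniq // inE eqxx.
have [|||||y hy] := IH (rem B s).
- by rewrite size_rem // n.
- exact: rem_uniq.
- by move=> C /sub/h1.
- by move=> C D /sub Cs /sub; apply: h2.
- move=> C D Cr hD nD CD; apply: nB; first exact: h3 (sub _ Cr) hD nD CD.
  move=> e; subst D; have e := mB _ (sub _ Cr) CD; subst C.
  by rewrite Cr in remB.
have [hB Bx] := h1 _ Bs.
have By : ~ B y by move/(hy _ hB Bx) => h; rewrite h in remB.
have [C hC Cy BC|z yz eB] := adjacent_of_minimal hB By.
  apply: contrapT => ne.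
  have Cx : ~ C x.
    move=> Cx; have : (~` C) \in rem B s by apply: (proj1 (hy _ (hs_compl hC) _)) Cy => /(_ Cx).
    by move=> /sub /h2 /(_ Bs) [t nt /BC].
  by apply: Cy; apply/hy => //; apply: nB => //; exact: h3 Bs hC Cx BC.
exists z => C hC Cx; have [->|/eqP ne] := eqVneq C B.
  by split=> // _; rewrite eB; apply: W_r.
have -> : C z <-> C y.
  split=> h; apply: contrapT => nh.
    by apply: ne; rewrite eB; apply: hs_edge.
  have e := hs_edge (hs_compl hC) yz (fun h' => h' h) nh.
  by case: Bx; rewrite eB -e.
rewrite (hy C hC Cx); split; [exact: sub|by move=> h; apply: nB].
Qed.

Variable N : nat.
Hypothesis clique_bound : forall x (l : seq V), uniq [seq W x a | a <- l] ->
  (forall a, List.In a l -> adj x a) ->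
  (forall a b, List.In a l -> List.In b l -> a <> b -> exists u, sq x a u b) ->
  size l <= N.

(** The half-spaces properly containing a member of L and missing x can be realized at a vertex y.
    There every member of L is crossed by an edge at y, and these edges pairwise span squares
    because members meet; so they form a clique of the link. *)
Lemma antichain_bound x (L : seq (set V)) : uniq L ->
  (forall B, B \in L -> hs B /\ ~ B x) ->
  (forall B C, B \in L -> C \in L -> meets B C) ->
  (forall B C, B \in L -> C \in L -> B `<=` C -> B = C) ->
  size L <= N.
Proof.
move=> uL h1 h2 h3.
have pt B : exists b, B \in L -> B b.
  have [BL|] := boolP (B \in L); last by exists x.
  by have [b Bb] := hs_ex (h1 _ BL).1; exists b.
pose p B := sval (cid (pt B)).
have pB B : B \in L -> B (p B) by exact: (svalP (cid (pt B))).
pose P C := `[< exists2 B, B \in L & B `<=` C /\ C <> B >].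
pose s := undup [seq C <- flatten [seq sep x (p B) | B <- L] | P C].
have ms C : C \in s <-> [/\ hs C, ~ C x & exists2 B, B \in L & B `<=` C /\ C <> B].
  rewrite mem_undup mem_filter; split.
    move=> /andP[/asboolP h /flattenP [q /mapP [B BL ->] /mem_sep []]] //.
  move=> [hC Cx hB]; apply/andP; split; first exact/asboolP.
  have [B BL [BC _]] := hB; apply/flattenP; exists (sep x (p B)); first exact: map_f.
  by apply/mem_sep; split => //; apply: BC; apply: pB.
have [||||y hy] := @realize x s.
- exact: undup_uniq.
- by move=> B /ms [].
- move=> B C /ms [_ _ [B' BL [BB _]]] /ms [_ _ [C' CL [CC _]]].
  by have [z /BB ? /CC ?] := h2 _ _ BL CL; exists z.
- move=> B C /ms [hB Bx [B' BL [BB nB]]] hC Cx BC; apply/ms; split => //.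
  exists B' => //; split; first exact: subset_trans BC.
  by move=> e; subst B'; apply: nB; apply/seteqP.
have key B : B \in L -> exists2 z, adj y z & B = W y z.
  move=> BL; have [hB Bx] := h1 _ BL.
  apply: adjacent_of_minimal => //.
    move=> /(hy _ hB Bx) /ms [_ _ [B' BL' [BB nB]]].
    by apply: nB; rewrite (h3 _ _ BL' BL BB).
  move=> C hC Cy BC; apply: contrapT => ne.
  have [Cx|Cx] := pselect (C x); last first.
    by apply: Cy; apply/(hy _ hC Cx); apply/ms; split => //; exists B.
  have /ms [_ _ [B' BL' [BB _]]] : (~` C) \in s.
    by apply: (proj1 (hy _ (hs_compl hC) _)) Cy => /(_ Cx).
  by have [z /BC ? /BB] := h2 _ _ BL BL'.
have key' B : exists z, B \in L -> adj y z /\ B = W y z.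
  have [/key [z ? ?]|] := boolP (B \in L); first by exists z.
  by exists y.
pose q B := sval (cid (key' B)).
have qB B : B \in L -> adj y (q B) /\ B = W y (q B) by exact: (svalP (cid (key' B))).
have inq a : List.In a [seq q B | B <- L] -> exists2 B, B \in L & a = q B.
  elim: (L) => //= B l IH [<-|/IH [C Cl ->]]; first by exists B; rewrite ?mem_head.
  by exists C; rewrite // in_cons Cl orbT.
rewrite -(size_map q); apply: (clique_bound (x := y)).
- rewrite -map_comp (_ : [seq _ | B <- L] = L) //=.
  by rewrite -[RHS]map_id; apply/eq_in_map => B /qB [].
- by move=> a /inq [B /qB [? _] ->].
- move=> a b /inq [B BL ->] /inq [C CL ->] ne.
  have [a1 e1] := qB _ BL; have [a2 e2] := qB _ CL.
  have [z Bz Cz] := h2 _ _ BL CL; rewrite e1 in Bz; rewrite e2 in Cz.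
  exact: W_corner ne Bz Cz.
Qed.
End HalfSpaces.

(** * Skewering *)

Lemma seq_maximal (T : eqType) (R : T -> T -> Prop) (s : seq T) :
  (forall a b c, R a b -> R b c -> R a c) -> (forall a, R a a) -> s != [::] ->
  exists2 m, m \in s & forall b, b \in s -> R m b -> R b m.
Proof.
move=> Rt Rr; elim: s => // a [|a' s'] IH _.
  by exists a; rewrite ?mem_head // => b; rewrite mem_seq1 => /eqP ->.
have [m ms mm] := IH isT.
have [ma|nma] := pselect (R m a); last first.
  exists m; first by rewrite in_cons ms orbT.
  by move=> b; rewrite in_cons => /orP[/eqP -> /nma|/mm].
exists a; first exact: mem_head.
move=> b; rewrite in_cons => /orP[/eqP ->//|bs] ab.
exact: (Rt _ _ _ (mm b bs (Rt _ _ _ ma ab)) ma).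
Qed.

Lemma seq_bound (T : eqType) (P : T -> nat -> Prop) (s : seq T) :
  (forall b n m, n <= m -> P b n -> P b m) ->
  (forall b, b \in s -> exists n, P b n) -> exists n, forall b, b \in s -> P b n.
Proof.
move=> Pm; elim: s => [|a s IH] h; first by exists 0.
have [n hn] := IH (fun b bs => h b (mem_behead (s := a :: s) bs)).
have [m hm] := h a (mem_head _ _); exists (maxn n m) => b.
rewrite in_cons => /orP[/eqP ->|/hn h']; first exact: (Pm _ _ _ (leq_maxr _ _) hm).
exact: (Pm _ _ _ (leq_maxl _ _) h').
Qed.

Lemma no_injection (T : eqType) (s : seq T) (f : nat -> T) :
  injective f -> ~ (forall n, f n \in s).
Proof.
move=> fi fs.
have u : uniq [seq f i | i <- iota 0 (size s).+1] by rewrite map_inj_uniq ?iota_uniq.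
have := uniq_leq_size (s2 := s) u; rewrite size_map size_iota ltnn.
by move=> h; apply: notF; apply: h => x /mapP [i _ ->].
Qed.

(** Upward closed finite parts of U: what a vertex can look like within U, by the duality of
    [realize]. *)
Definition ideal V (U : set (set V)) (u : seq (set V)) :=
  [/\ uniq u, forall b, b \in u -> U b &
      forall b c, b \in u -> U c -> b `<=` c -> c \in u].

Definition translates V (K : set (set V)) (f : V -> V) : set (set V) :=
  [set B | exists2 b, K b & B = f @` b].

(* Whether the translate by f i of a member of K contains x does not depend on i < r; those
   that do not contain x form U, and the families f i U span the factors of a product of
   quasi-lines based at x, whose set of ends is invariant under Gam. *)
Record spread V (hs : set V -> Prop) (Gam : set (V -> V)) (K U : set (set V)) (x : V)
    (r : nat) (f : nat -> V -> V) : Prop := Spread {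
  sp_r : 0 < r;
  sp_Gam : forall i, i < r -> Gam (f i);
  sp_hs : forall b, K b -> hs b;
  sp_up : forall B C, K B -> hs C -> B `<=` C -> K C;
  sp_meets : forall g h B C, Gam g -> Gam h -> K B -> K C -> meets (g @` B) (h @` C);
  sp_UK : forall b, U b -> K b;
  sp_U : forall i b, i < r -> K b -> (U b <-> ~ (f i @` b) x);
  sp_disj : forall i j b, i < r -> j < r -> i <> j -> U b -> ~ translates K (f j) (f i @` b);
  sp_img : forall g i, Gam g -> i < r ->
    exists2 j, j < r & translates K (g \o f i) = translates K (f j);
  sp_preim : forall g j, Gam g -> j < r ->
    exists2 i, i < r & translates K (g \o f i) = translates K (f j);
  sp_qc : exists K0, forall u v, ideal U u -> ideal U v ->
    size [seq b <- u | b \notin v] <= K0 \/ size [seq b <- v | b \notin u] <= K0;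
  sp_fin : forall L, exists s : seq (set V), forall u, ideal U u -> size u <= L ->
    {subset u <= s};
  sp_inf : forall L, exists2 u, ideal U u & L <= size u }.

Section Skewering.
Variables (V : Type) (hs : set V -> Prop) (sep : V -> V -> seq (set V)) (N : nat).
Hypothesis hs_compl : forall B, hs B -> hs (~` B).
Hypothesis hs_ex : forall B, hs B -> exists x, B x.
Hypothesis mem_sep : forall x y B, B \in sep x y <-> [/\ hs B, ~ B x & B y].
Hypothesis realize : forall x (s : seq (set V)), uniq s ->
  (forall B, B \in s -> hs B /\ ~ B x) ->
  (forall B C, B \in s -> C \in s -> meets B C) ->
  (forall B C, B \in s -> hs C -> ~ C x -> B `<=` C -> C \in s) ->
  exists y, forall B, hs B -> ~ B x -> (B y <-> B \in s).
Hypothesis antichain_bound : forall x (L : seq (set V)), uniq L ->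
  (forall B, B \in L -> hs B /\ ~ B x) ->
  (forall B C, B \in L -> C \in L -> meets B C) ->
  (forall B C, B \in L -> C \in L -> B `<=` C -> B = C) ->
  size L <= N.

Variable Gam : set (V -> V).
Hypothesis Gam_id : Gam id.
Hypothesis Gam_comp : forall f g, Gam f -> Gam g -> Gam (f \o g).
Hypothesis Gam_inv : forall f, Gam f -> exists g, [/\ Gam g, cancel f g & cancel g f].
Hypothesis Gam_hs : forall g B, Gam g -> hs B -> hs (g @` B).

Implicit Types (g h : V -> V) (B C b c : set V).

Lemma imE g h B v : cancel g h -> cancel h g -> (g @` B) v <-> B (h v).
Proof.
move=> gh hg; split => [[w Bw <-]|Bv]; first by rewrite gh.
by exists (h v) => //; rewrite hg.
Qed.

Lemma im_can g h B : cancel g h -> h @` (g @` B) = B.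
Proof.
by move=> gh; rewrite image_comp (_ : h \o g = id) ?image_id //; apply/funext => x /=.
Qed.

Lemma im_subE g h B C : cancel g h -> g @` B `<=` g @` C <-> B `<=` C.
Proof.
move=> gh; split=> [|BC]; last exact: image_subset.
by move=> /(@image_subset _ _ h); rewrite !(im_can _ gh).
Qed.

Lemma im_inj g h B C : cancel g h -> g @` B = g @` C -> B = C.
Proof. by move=> gh /(congr1 (fun D => h @` D)); rewrite !(im_can _ gh). Qed.

Lemma im_meets g B C : meets B C -> meets (g @` B) (g @` C).
Proof. by move=> [x Bx Cx]; exists (g x); exists x. Qed.

Lemma im_compl g h B : cancel g h -> cancel h g -> g @` (~` B) = ~` (g @` B).
Proof.
move=> gh hg; apply/seteqP; split=> v.
  by move=> /(imE _ _ gh hg) nB /(imE _ _ gh hg).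
by move=> nB; apply/(imE _ _ gh hg) => Bv; apply: nB; apply/(imE _ _ gh hg).
Qed.

Lemma Gam_iter g n : Gam g -> Gam (iter n g).
Proof.
move=> Gg; elim: n => [|n IH]; first exact: Gam_id.
exact: (Gam_comp Gg IH).
Qed.

Lemma iter_can g h n : cancel g h -> cancel (iter n g) (iter n h).
Proof. by move=> gh; elim: n => // n IH x; rewrite iterSr /= gh. Qed.

Lemma im_iterD g m n B : iter (m + n) g @` B = iter m g @` (iter n g @` B).
Proof. by rewrite image_comp; congr (_ @` _); apply/funext => x /=; rewrite iterD. Qed.

Lemma comparable_ex x (L : seq (set V)) : uniq L -> N < size L ->
  (forall B, B \in L -> hs B /\ ~ B x) ->
  (forall B C, B \in L -> C \in L -> meets B C) ->
  exists B C, [/\ B \in L, C \in L, B `<=` C & B <> C].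
Proof.
move=> uL sL h1 h2; apply: contrapT => n.
have : size L <= N.
  apply: (antichain_bound uL h1 h2) => B C BL CL BC.
  by apply: contrapT => ne; apply: n; exists B, C.
by rewrite leqNgt sL.
Qed.

Lemma comparable_fam x (f : nat -> set V) :
  (forall k, k <= N -> hs (f k) /\ ~ f k x) ->
  (forall k l, k <= N -> l <= N -> meets (f k) (f l)) ->
  exists k l, [/\ k < l, l <= N & f k `<=` f l \/ f l `<=` f k].
Proof.
move=> h1 h2; pose L := [seq f k | k <- iota 0 N.+1].
have inL B : B \in L -> exists2 k, k <= N & B = f k.
  by move=> /mapP [k]; rewrite mem_iota add0n ltnS => /= kN ->; exists k.
have lt k l : k <= N -> l <= N -> k <> l -> f k `<=` f l ->
    exists k l, [/\ k < l, l <= N & f k `<=` f l \/ f l `<=` f k].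
  move=> kN lN ne kl; case: (ltngtP k l) => // h; first by exists k, l; split => //; left.
  by exists l, k; split => //; right.
have [uL|] := boolP (uniq L).
  have [|||B [C [/inL [k kN ->] /inL [l lN ->] kl ne]]] := @comparable_ex x L uL.
  - by rewrite size_map size_iota.
  - by move=> B /inL [k kN ->]; apply: h1.
  - by move=> B C /inL [k kN ->] /inL [l lN ->]; apply: h2.
  - by apply: (lt k l) => // e; apply: ne; rewrite e.
move=> nu; apply: contrapT => no; move/negP: nu; apply.
rewrite map_inj_in_uniq ?iota_uniq // => k l.
rewrite !mem_iota !add0n !ltnS => /= kN lN e; apply: contrapT => ne.
by apply: no; apply: (lt k l) => //; rewrite e.
Qed.

(** Among N + 1 translates of A missing x two are nested; conjugating the larger one back to A turns
    this into an element that maps A properly into itself. *)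
Lemma skewer_ex A x : hs A ->
  (forall g, Gam g -> meets A (g @` A) \/ g @` A = ~` A) ->
  ~ finite_set [set B | (exists2 g, Gam g & B = g @` A) /\ ~ B x] ->
  exists2 g, Gam g & g @` A `<=` A /\ g @` A <> A.
Proof.
move=> hA unf /(infinite_set_fset N.+1) [F sF cF].
have key B C : B \in F -> C \in F -> exists g h k, [/\ Gam g, Gam h, Gam k,
   cancel h k /\ cancel k h & [/\ B = g @` A, C = h @` A, ~ B x & ~ C x]].
  move=> BF CF; have [[g Gg eB] nB] := sF B BF; have [[h Gh eC] nC] := sF C CF.
  by have [k [Gk hk kh]] := Gam_inv Gh; exists g, h, k.
have [|||B [C [BL CL BC ne]]] := @comparable_ex x (enum_fset F) (fset_uniq F).
- exact: cF.
- by move=> B BF; have [[g Gg ->] nB] := sF B BF; split=> //; apply: Gam_hs.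
- move=> B C BF CF.
  have [g [h [k [Gg Gh Gk [hk kh] [eB eC nB nC]]]]] := key B C BF CF.
  have [m|e] := unf _ (Gam_comp Gk Gg).
    have := im_meets h m; rewrite -image_comp (im_can _ kh) -eB -eC.
    by move=> [z ? ?]; exists z.
  (* Two of these translates cannot be complementary, since x lies in neither. *)
  case: nB; move: e => /(congr1 (fun D => h @` D)).
  by rewrite -image_comp (im_can _ kh) -eB (im_compl _ hk kh) -eC => ->.
- have [g [h [k [Gg Gh Gk [hk kh] [eB eC nB nC]]]]] := key B C BL CL.
  exists (k \o g); first exact: Gam_comp.
  rewrite -image_comp -eB; split.
    by rewrite -[X in _ `<=` X](im_can A hk) -eC; apply: image_subset.
  by move=> /(congr1 (fun D => h @` D)); rewrite (im_can _ kh) -eC.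
Qed.

(** If g A were the complement of A, then [g (g0 A)] would be properly contained in it, hence
    disjoint from A without being its complement. *)
Lemma all_meet A g0 : Gam g0 -> g0 @` A `<=` A -> g0 @` A <> A ->
  (forall g, Gam g -> meets A (g @` A) \/ g @` A = ~` A) ->
  forall g h, Gam g -> Gam h -> meets (g @` A) (h @` A).
Proof.
move=> G0 s0 n0 unf.
have mA g : Gam g -> meets A (g @` A).
  move=> Gg; case: (unf g Gg) => // e; have [h [Gh gh hg]] := Gam_inv Gg.
  case: (unf _ (Gam_comp Gg G0)); rewrite -image_comp.
    by move=> [z Az /(@image_subset _ _ g _ _ s0)]; rewrite e => /(_ Az).
  by rewrite -e => h1; case: n0; exact: (im_inj gh h1).
move=> g h Gg Gh; have [k [Gk gk kg]] := Gam_inv Gg.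
have := im_meets g (mA _ (Gam_comp Gk Gh)).
by rewrite -image_comp (im_can _ kg).
Qed.

Definition skewered tau B := [/\ hs B, tau @` B `<=` B & tau @` B <> B].

Section OneElement.
Variables (tau taui : V -> V).
Hypotheses (Gtau : Gam tau) (Gtaui : Gam taui).
Hypotheses (tK : cancel tau taui) (tiK : cancel taui tau).

Notation "B ^^ n" := (iter n tau @` B) (at level 20).

Lemma pow_anti B m n : tau @` B `<=` B -> m <= n -> B ^^ n `<=` B ^^ m.
Proof.
move=> sB; move/subnKC <-; rewrite im_iterD; apply: image_subset.
elim: (n - m) => [|k IH]; first by rewrite image_id.
by rewrite -addn1 im_iterD; apply: subset_trans IH; apply: image_subset.
Qed.

Lemma pow0 B : B ^^ 0 = B. Proof. exact: image_id. Qed.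

Lemma pow1 B : B ^^ 1 = tau @` B. Proof. by []. Qed.

Lemma pow_inj B : skewered tau B -> injective (fun n => B ^^ n).
Proof.
move=> [hB sB nB].
have key m n : m < n -> B ^^ m <> B ^^ n.
  move=> mn e; apply: nB; apply/seteqP; split => //.
  rewrite -(im_subE _ _ (iter_can m tK)) -[tau @` B]pow1 -im_iterD addn1 e.
  exact: pow_anti.
by move=> m n e; case: (ltngtP m n) => // h; [case: (key _ _ h)|case: (key _ _ h)].
Qed.

Lemma pow_hs B n : hs B -> hs (B ^^ n).
Proof. by move=> hB; apply: Gam_hs => //; apply: Gam_iter. Qed.

Lemma pow_skew B n : skewered tau B -> skewered tau (B ^^ n).
Proof.
move=> kB; have [hB sB nB] := kB; split; first exact: pow_hs.
  by rewrite -pow1 -im_iterD add1n -addn1 im_iterD; apply: image_subset.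
rewrite -pow1 -im_iterD add1n => /(@pow_inj B kB) /eqP; lia.
Qed.

(** Otherwise x lies in all the powers, which are distinct and all miss a vertex y outside B; but
    only finitely many half-spaces separate y from x. *)
Lemma pow_leaves B x : skewered tau B -> exists n, forall m, n <= m -> ~ (B ^^ m) x.
Proof.
move=> kB; have [hB sB nB] := kB; have [y ny] := hs_ex (hs_compl hB).
apply: contrapT => no; apply: (@no_injection _ (sep y x) _ (pow_inj kB)) => n.
apply/mem_sep; split; first exact: pow_hs.
  by move=> h; apply: ny; rewrite -[B]pow0; apply: (pow_anti sB (leq0n n)).
apply: contrapT => nx; apply: no; exists n => m nm h; apply: nx.
exact: (pow_anti sB nm).
Qed.
End OneElement.

Lemma skewered_compl tau taui B : cancel tau taui -> cancel taui tau ->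
  skewered tau B -> skewered taui (~` B).
Proof.
move=> tK tiK [hB sB nB]; split; first exact: hs_compl.
  rewrite (im_compl _ tiK tK); apply: subsetC.
  by rewrite -[X in X `<=` _](im_can B tK); apply: image_subset.
rewrite (im_compl _ tiK tK) => /(congr1 setC); rewrite !setCK => e.
by apply: nB; rewrite -[RHS](im_can B tiK) e.
Qed.

(** * Maximal chains and the filter [K] *)

Section Terminal.
Variables (gam gami : V -> V).
Hypotheses (Ggam : Gam gam) (Ggami : Gam gami).
Hypotheses (gK : cancel gam gami) (giK : cancel gami gam).
(** Nested pairs found among the N + 1 half-spaces [gam^k B] give a power q of gam with q between 1
    and N that depends on B. The factorial is a multiple of every such q, so a single tau serves all
    B. *)
Let tau := iter N`! gam.
Let taui := iter N`! gami.
Variable A0 : set V.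
Hypothesis skA0 : skewered gam A0.
Hypothesis meetA0 : forall g h, Gam g -> Gam h -> meets (g @` A0) (h @` A0).

Let Gtau : Gam tau. Proof. exact: Gam_iter. Qed.
Let Gtaui : Gam taui. Proof. exact: Gam_iter. Qed.
Let tK : cancel tau taui. Proof. exact: iter_can. Qed.
Let tiK : cancel taui tau. Proof. exact: iter_can. Qed.

Notation "B ^^ n" := (iter n tau @` B) (at level 20).
Notation Sk := (skewered tau).

Lemma pow_enters B y : Sk B -> exists n, forall m, n <= m -> B (iter m tau y).
Proof.
move=> /(skewered_compl tK tiK) kB.
have [n hn] := pow_leaves Gtaui tiK y kB; exists n => m /hn nm.
apply: contrapT => nB; apply: nm.
by apply/(imE _ _ (iter_can m tiK) (iter_can m tK)).
Qed.

(** A preorder comparing the chains of tau-translates. *)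
Definition eventually_in B C := exists n, B ^^ n `<=` C.

Lemma ev_refl B : eventually_in B B. Proof. by exists 0; rewrite pow0. Qed.

Lemma ev_sub B C : B `<=` C -> eventually_in B C. Proof. by exists 0; rewrite pow0. Qed.

Lemma ev_pow B n : eventually_in B (B ^^ n). Proof. by exists n. Qed.

Lemma ev_trans B C D : eventually_in B C -> eventually_in C D -> eventually_in B D.
Proof.
move=> [n h1] [m h2]; exists (m + n); rewrite im_iterD.
by apply: subset_trans h2; apply: image_subset.
Qed.

Lemma skew_tau B : skewered gam B -> Sk B.
Proof.
move=> kB; have [hB sB nB] := kB; split => //.
  by rewrite -[X in _ `<=` X](pow0 gam); apply: pow_anti.
rewrite -[RHS](pow0 gam) => /(pow_inj gK kB) /eqP; have := fact_gt0 N; lia.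
Qed.

(* Every orbit of <tau> on skewered half-spaces has exactly one member separating x from tau x. *)
Definition entry x B := [/\ Sk B, ~ B x & B (tau x)].

Lemma normalize x B : Sk B -> ~ B x -> exists j b, entry x b /\ B = b ^^ j.
Proof.
move=> kB nx; have [n hn] := pow_enters x kB.
have ex : exists m, `[< B (iter m tau x) >].
  by exists n; apply/asboolP; apply: hn.
case: (ex_minnP ex) => -[/asboolP //|m] /asboolP hm mm.
exists m, (iter m taui @` B); split; last first.
  by rewrite (im_can _ (iter_can m tiK)).
have [hB sB nB] := kB.
have mE y : (iter m taui @` B) y <-> B (iter m tau y).
  exact: (imE _ _ (iter_can m tiK) (iter_can m tK)).
split; last by apply/mE; rewrite -iterSr.
  have e : tau @` (iter m taui @` B) = iter m taui @` (tau @` B).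
    rewrite !image_comp; congr (_ @` _); apply/funext => y /=.
    rewrite -[y in LHS]tK -iterSr iterS tiK //.
  split; first by apply: Gam_hs => //; apply: Gam_iter.
    by rewrite e; apply: image_subset.
  by rewrite e => h1; apply: nB; exact: (im_inj (iter_can m tiK) h1).
by move=> /mE h; have := mm m; rewrite ltnn => /(_ (introT (asboolP _) h)).
Qed.

(** By [normalize] each class of skewered half-spaces has a representative separating x from tau x.
    There are finitely many of these, so a maximal class above that of A0 exists. *)
Lemma terminal_ex (x : V) : exists A, [/\ Sk A, eventually_in A0 A &
  forall B, Sk B -> eventually_in A B -> eventually_in B A].
Proof.
have norm B : Sk B -> exists b, [/\ entry x b, eventually_in b B & eventually_in B b].
  move=> kB; have [n hn] := pow_leaves Gtau tK x kB.
  have kBn := pow_skew Gtau tK n kB.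
  have [j [b [eb e]]] := normalize kBn (hn n (leqnn n)).
  have [[_ sb _] _ _] := eb; have [_ sB _] := kB.
  exists b; split=> //.
    exists j; rewrite -e -[X in _ `<=` X](pow0 tau); exact: pow_anti.
  exists n; rewrite e -[X in _ `<=` X](pow0 tau); exact: pow_anti.
pose E := [seq b <- sep x (tau x) | `[< Sk b /\ eventually_in A0 b >]].
have mE b : b \in E <-> entry x b /\ eventually_in A0 b.
  rewrite mem_filter; split=> [/andP[/asboolP [kb eb] /mem_sep []] //|].
  move=> [[kb bx btx] eb]; apply/andP; split; first exact/asboolP.
  by apply/mem_sep; split => //; case: kb.
have [b0 [eb0 b0A Ab0]] := norm _ (skew_tau skA0).
have /(seq_maximal ev_trans ev_refl) [A AE mA] : E != [::].
  by apply/eqP => e; have /mE := conj eb0 Ab0; rewrite e.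
have [[kA _ _] A0A] := proj1 (mE A) AE.
exists A; split=> // B kB AB; have [b [eb bB Bb]] := norm _ kB.
apply: (ev_trans Bb); apply: mA; last exact: (ev_trans AB Bb).
by apply/mE; split => //; exact: (ev_trans A0A (ev_trans AB Bb)).
Qed.

Variable A : set V.
Hypothesis skA : Sk A.
Hypothesis A0A : eventually_in A0 A.
Hypothesis A_terminal : forall B, Sk B -> eventually_in A B -> eventually_in B A.

Let hA : hs A. Proof. by case: skA. Qed.
Let sA : tau @` A `<=` A. Proof. by case: skA. Qed.

Definition K B := hs B /\ eventually_in A B.

Lemma K_up B C : K B -> hs C -> B `<=` C -> K C.
Proof. by move=> [_ e] hC BC; split => //; apply: ev_trans e (ev_sub BC). Qed.

Lemma K_pow n : K (A ^^ n).
Proof. by split; [exact: pow_hs|exact: ev_pow]. Qed.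

(** Both sides contain translates of A0, as A0 lies eventually in A. *)
Lemma K_meets g h B C : Gam g -> Gam h -> K B -> K C -> meets (g @` B) (h @` C).
Proof.
move=> Gg Gh [_ eB] [_ eC].
have [n hn] := ev_trans A0A eB; have [m hm] := ev_trans A0A eC.
have [z z1 z2] := meetA0 (Gam_comp Gg (Gam_iter n Gtau)) (Gam_comp Gh (Gam_iter m Gtau)).
rewrite -image_comp in z1; rewrite -image_comp in z2.
by exists z; [exact: image_subset z1|exact: image_subset z2].
Qed.

(** The half-spaces [gam^k B] with k at most N all miss y, so two of them are nested. Hence B is
    comparable with [gam^q B] for some q between 1 and N, and so with tau B. *)
Lemma K_skew_or B y : K B -> ~ B y ->
  (forall k, 0 < k <= N -> ~ (iter k gam @` B) y) -> Sk B.
Proof.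
move=> [hB [n0 hn0]] nB h.
have [||k [l [kl lN hkl]]] := @comparable_fam y (fun k => iter k gam @` B).
- move=> k kN; split; first by apply: Gam_hs => //; apply: Gam_iter.
  by case: k kN => [|k] kN; [rewrite pow0|apply: h].
- by move=> k l _ _; apply: K_meets; [exact: Gam_iter|exact: Gam_iter|split => //; exists n0|
    split => //; exists n0].
pose q := l - k; have q0 : 0 < q <= N by lia.
have eq1 : iter l gam @` B = iter k gam @` (iter q gam @` B).
  by rewrite -im_iterD subnKC // ltnW.
rewrite eq1 in hkl.
have [m em] : exists m, N`! = m * q.
  by have /dvdnP [m ->] := dvdn_fact q0; exists m.
have itq i : iter (i * q) gam = iter i (iter q gam).
  by elim: i => // i IH; apply/funext => z; rewrite mulSn iterD IH.
have grow g i : B `<=` g @` B -> B `<=` iter i g @` B.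
  move=> Bg; elim: i => [|i IH]; first by rewrite pow0.
  by apply: (subset_trans IH); rewrite -addn1 im_iterD; apply: image_subset.
(* The tau-orbit of y enters A, hence B after n0 more steps; if B lay in tau B, pulling back would
   put y in B. *)
have noup : ~ (B `<=` tau @` B).
  move=> /grow BtB; have [i hi] := pow_enters y skA; apply: nB.
  rewrite -[y](iter_can (n0 + i) tK).
  apply/(imE _ _ (iter_can (n0 + i) tK) (iter_can (n0 + i) tiK)).
  apply: BtB; apply: hn0; rewrite iterD; exists (iter i tau y) => //; exact: hi.
have et : tau = iter m (iter q gam) by rewrite /tau em itq.
have tB : tau @` B `<=` B.
  case: hkl => /(im_subE _ _ (iter_can k gK)) h1.
    by case: noup; rewrite et; apply: grow.
  by rewrite et -[X in _ `<=` X](pow0 (iter q gam)); apply: pow_anti.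
split => // e; by apply: noup; rewrite e.
Qed.

Lemma entries_ex y :
  exists E : seq (set V), forall b, b \in E <-> entry y b /\ eventually_in A b.
Proof.
exists [seq b <- sep y (tau y) | `[< Sk b /\ eventually_in A b >]] => b.
rewrite mem_filter; split=> [/andP[/asboolP [kb eb] /mem_sep []] //|].
move=> [[kb bx btx] eb]; apply/andP; split; first exact/asboolP.
by apply/mem_sep; split => //; case: kb.
Qed.

Lemma K_normalize y B : Sk B -> K B -> ~ B y ->
  exists j b, [/\ entry y b, eventually_in A b & B = b ^^ j].
Proof.
move=> kB [hB AB] /(normalize kB) [j [b [eb e]]]; exists j, b; split => //.
apply: (ev_trans AB); apply: ev_sub; rewrite e -[X in _ `<=` X](pow0 tau).
by apply: pow_anti => //; case: eb => -[].
Qed.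

(** By [K_skew_or], each of these half-spaces separates y from one of the N preimages of y under
    powers of gam. *)
Lemma K_junk y : finite_set [set B | [/\ K B, ~ B y & ~ Sk B]].
Proof.
pose s := flatten [seq sep y (iter k gami y) | k <- iota 0 N.+1].
apply: sub_finite_set (finite_seq s).
move=> B [kB nB nS]; apply: contrapT => n; apply: nS; apply: (K_skew_or kB nB) => k kN.
move=> /(imE _ _ (iter_can k gK) (iter_can k giK)) h; apply: n; change (B \in s); apply/flattenP.
exists (sep y (iter k gami y)); last by apply/mem_sep; split => //; case: kB.
by apply: map_f; rewrite mem_iota; lia.
Qed.

Lemma pow_sub_mono B C n m : tau @` B `<=` B -> n <= m -> B ^^ n `<=` C -> B ^^ m `<=` C.
Proof. by move=> sB nm; apply: subset_trans; apply: pow_anti. Qed.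

(** The skewered ones are powers of finitely many entries. As A is terminal, a high enough power of
    each entry lies in [A ^^ m], and only the lower powers remain. *)
Lemma K_deep y m : finite_set [set B | [/\ K B, ~ B y & ~ (B `<=` A ^^ m)]].
Proof.
have [E hE] := entries_ex y.
have [k hk] : exists k, forall b, b \in E -> tau @` b `<=` b -> b ^^ k `<=` A ^^ m.
  apply: (@seq_bound _ (fun b k => tau @` b `<=` b -> b ^^ k `<=` A ^^ m)).
    by move=> b n n' nn' h sb; apply: (pow_sub_mono sb nn'); exact: h.
  move=> b /hE [[kb _ _] Ab]; have [n hn] := A_terminal kb Ab.
  by exists (m + n) => _; rewrite im_iterD; apply: image_subset.
pose L := [seq b ^^ j | b <- E, j <- iota 0 k].
apply: (sub_finite_set _ (_ : finite_set ([set B | [/\ K B, ~ B y & ~ Sk B]] `|` [set` L]))).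
  move=> B /= [kB nB nBA]; have [kSB|nSB] := pselect (Sk B); [right|by left].
  have [j [b [eb Ab e]]] := K_normalize kSB kB nB.
  have bE : b \in E by apply/hE.
  have sb : tau @` b `<=` b by case: eb => -[].
  rewrite e; apply: allpairs_f => //; rewrite mem_iota add0n /= ltnNge.
  by apply/negP => kj; apply: nBA; rewrite e; apply: (pow_sub_mono sb kj); exact: hk.
by rewrite finite_setU; split; [exact: K_junk|exact: finite_seq].
Qed.

(** By terminality the M-th power of any entry lies in any other entry, so skewered members whose
    heights differ by at least M are nested. Take a skewered member of least height in the symmetric
    difference, say B in u but not in v. A member of v outside u that is M higher would lie in B and
    force B into v; so v without u lies in a slab of M heights together with the junk. *)
Lemma K_quasi_chain y (U : set (set V)) : (forall B, U B -> K B /\ ~ B y) ->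
  exists K0, forall u v, ideal U u -> ideal U v ->
    size [seq b <- u | b \notin v] <= K0 \/ size [seq b <- v | b \notin u] <= K0.
Proof.
move=> UK; have [E hE] := entries_ex y.
have [M hM] : exists M, forall b, b \in E -> forall b', b' \in E -> b' ^^ M `<=` b.
  apply: (@seq_bound _ (fun b M => forall b', b' \in E -> b' ^^ M `<=` b)).
    move=> b n m nm h b' b'E; apply: (pow_sub_mono _ nm); last exact: h.
    by move/hE: b'E => [[[]]].
  move=> b /hE [_ [n hn]].
  have [k hk] : exists k, forall b', b' \in E -> tau @` b' `<=` b' -> b' ^^ k `<=` A.
    apply: (@seq_bound _ (fun b k => tau @` b `<=` b -> b ^^ k `<=` A)).
      by move=> b' p q pq h sb; apply: (pow_sub_mono sb pq); exact: h.
    by move=> b' /hE [[kb _ _] Ab]; have [p hp] := A_terminal kb Ab; exists p.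
  exists (n + k) => b' b'E; rewrite im_iterD; apply: (subset_trans _ hn).
  by apply: image_subset; apply: hk => //; move/hE: b'E => [[[]]].
have [Z hZ] : exists Z : seq (set V), forall B, [/\ K B, ~ B y & ~ Sk B] -> B \in Z.
  by have /finite_seqP [Z e] := K_junk y; exists Z => B h; have : [set` Z] B by rewrite -e.
exists (size Z + size E * M).
pose slab j := Z ++ [seq b ^^ (j + i) | b <- E, i <- iota 0 M].
have sslab j : size (slab j) = size Z + size E * M.
  by rewrite size_cat size_allpairs size_iota.
pose at_height B j := exists2 b, b \in E & B = b ^^ j.
have key u v : ideal U u -> ideal U v -> forall j B, B \in u -> B \notin v ->
    at_height B j -> (forall i C, C \in v -> C \notin u -> at_height C i -> j <= i) ->
    size [seq b <- v | b \notin u] <= size Z + size E * M.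
  move=> [uu hu1 hu2] [uv hv1 hv2] j B Bu Bv [b bE eB] hj.
  rewrite -(sslab j); apply: uniq_leq_size; first exact: filter_uniq.
  move=> C; rewrite mem_filter => /andP[Cu Cv]; rewrite mem_cat.
  have [kC nCy] := UK _ (hv1 _ Cv).
  have [kSC|nSC] := pselect (Sk C); last by rewrite hZ.
  have [i [c [ec Ac eC]]] := K_normalize kSC kC nCy.
  have cE : c \in E by apply/hE.
  have ji : j <= i by apply: (hj i C) => //; exists c.
  apply/orP; right; rewrite eC -(subnKC ji); apply: allpairs_f => //.
  rewrite mem_iota add0n /= ltnNge; apply/negP => Mij; move/negP: Bv; apply.
  apply: (hv2 C B Cv (hu1 _ Bu)); rewrite eB eC -(subnKC ji) im_iterD.
  apply: image_subset; apply: (pow_sub_mono _ Mij); last exact: hM.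
  by case: ec => -[].
move=> u v iu iv.
have junk w w' : ideal U w ->
    (forall j B, B \in w -> B \notin w' -> ~ at_height B j) ->
    size [seq b <- w | b \notin w'] <= size Z + size E * M.
  move=> [uw hw1 hw2] h; apply: (leq_trans _ (leq_addr _ _)); apply: uniq_leq_size.
    exact: filter_uniq.
  move=> B; rewrite mem_filter => /andP[Bw' Bw]; have [kB nB] := UK _ (hw1 _ Bw).
  apply: hZ; split => // kSB; have [j [b [eb Ab e]]] := K_normalize kSB kB nB.
  by apply: (h j B Bw Bw'); exists b => //; apply/hE.
have least w w' : (exists j B, [/\ B \in w, B \notin w' & at_height B j]) ->
    exists j B, [/\ B \in w, B \notin w', at_height B j &
      forall i C, C \in w -> C \notin w' -> at_height C i -> j <= i].
  move=> [j0 [B0 h0]].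
  have ex : exists j, `[< exists B, [/\ B \in w, B \notin w' & at_height B j] >].
    by exists j0; apply/asboolP; exists B0.
  case: (ex_minnP ex) => j /asboolP [B [B1 B2 B3]] mj.
  by exists j, B; split => // i C C1 C2 C3; apply: mj; apply/asboolP; exists C.
have [/least [j [B [Bu Bv Bj mj]]]|n1] :=
    pselect (exists j B, [/\ B \in u, B \notin v & at_height B j]); last first.
  by left; apply: junk => // j B Bu Bv Bj; apply: n1; exists j, B.
have [/least [i [C [Cv Cu Ci mi]]]|n2] :=
    pselect (exists j B, [/\ B \in v, B \notin u & at_height B j]); last first.
  by right; apply: junk => // j' B' Bu' Bv' Bj'; apply: n2; exists j', B'.
have [ji|ij] := leqP j i.
  right; apply: (key u v iu iv j B) => // i' C' h1 h2 h3.
  exact: leq_trans ji (mi _ _ h1 h2 h3).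
left; apply: (key v u iv iu i C) => // i' C' h1 h2 h3.
exact: leq_trans (ltnW ij) (mj _ _ h1 h2 h3).
Qed.

(** Let b contain [A ^^ m]. The half-spaces [f (A ^^ k)] are infinitely many members of K that
    finally miss y, so by [K_deep] one of them lies in [A ^^ m]; applying fi puts [A ^^ k] inside fi
    b. *)
Lemma K_sym f fi : Gam f -> Gam fi -> cancel f fi -> cancel fi f ->
  (forall n, K (f @` (A ^^ n))) -> forall b, K b -> K (fi @` b).
Proof.
move=> Gf Gfi fK fiK h b [hb [m hm]]; split; first exact: Gam_hs.
have [y _] := hs_ex hb.
have kfA n : K (f @` (A ^^ n)) by [].
have [n hn] : exists n, forall k, n <= k -> ~ (f @` (A ^^ k)) y.
  have [n hn] := pow_leaves Gtau tK (fi y) skA.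
  by exists n => k /hn nk /(imE _ _ fK fiK).
have /finite_seqP [Z eZ] := K_deep y m.
have [k [nk kZ]] : exists k, n <= k /\ f @` (A ^^ k) \notin Z.
  apply: contrapT => no; apply: (@no_injection _ Z (fun k => f @` (A ^^ (n + k)))).
    by move=> p q /(im_inj fK) /(pow_inj tK skA) /eqP; rewrite eqn_add2l => /eqP.
  move=> k; apply: contrapT => /negP nk; apply: no.
  by exists (n + k); split => //; exact: leq_addr.
exists k; rewrite -(im_can (A ^^ k) fK); apply: image_subset.
apply: (subset_trans _ hm); apply: contrapT => nsub; move/negP: kZ; apply.
by have : [set` Z] (f @` (A ^^ k)) by rewrite -eZ; split => //; exact: hn.
Qed.

Notation imK := (translates K).

Lemma imK_can f g b : cancel f g -> imK f (f @` b) -> K b.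
Proof. by move=> fK [c kc /(im_inj fK) ->]. Qed.

Lemma imK_up f B C : Gam f -> imK f B -> hs C -> B `<=` C -> imK f C.
Proof.
move=> Gf [b kb eB] hC BC; have [g [Gg fK gfK]] := Gam_inv Gf.
exists (g @` C); last by rewrite (im_can _ gfK).
apply: K_up kb (Gam_hs Gg hC) _; rewrite -(im_can b fK) -eB; exact: image_subset.
Qed.

Lemma imK_pow f n : imK f (f @` (A ^^ n)).
Proof. by exists (A ^^ n) => //; exact: K_pow. Qed.

(* Cofinality of the chains f A^n and g A^n is a symmetric relation. *)
Lemma imK_eq f g : Gam f -> Gam g -> (forall n, imK f (g @` (A ^^ n))) ->
  imK f = imK g.
Proof.
move=> Gf Gg h; have [fi [Gfi fK fiK]] := Gam_inv Gf.
have [gi [Ggi gK' giK']] := Gam_inv Gg.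
have h1 n : K ((fi \o g) @` (A ^^ n)).
  by have [b kb e] := h n; rewrite -image_comp e (im_can _ fK).
have fgK : cancel (fi \o g) (gi \o f) by move=> z /=; rewrite fiK gK'.
have gfK : cancel (gi \o f) (fi \o g) by move=> z /=; rewrite giK' fK.
have h2 := K_sym (Gam_comp Gfi Gg) (Gam_comp Ggi Gf) fgK gfK h1.
apply/seteqP; split=> B [b kb ->].
  exists ((gi \o f) @` b); first exact: h2.
  by rewrite -image_comp (im_can _ giK').
have [n hn] := kb.2; apply: (imK_up Gf (h n)); last exact: image_subset.
by apply: Gam_hs => //; case: kb.
Qed.

Lemma imK_incomparable f g : Gam f -> Gam g -> imK f <> imK g ->
  exists m0, forall m, m0 <= m -> ~ (f @` (A ^^ m) `<=` g @` (A ^^ m)).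
Proof.
move=> Gf Gg ne; apply: contrapT => no; apply: ne; apply: imK_eq => // n.
apply: contrapT => nk; apply: no; exists n => m nm fg; apply: nk.
apply: (imK_up Gf (imK_pow f m)); first by apply: Gam_hs => //; exact: pow_hs.
by apply: (subset_trans fg); apply: image_subset; apply: pow_anti.
Qed.

Definition inequivalent r (f : nat -> V -> V) :=
  (forall i, i < r -> Gam (f i)) /\
  forall i j, i < r -> j < r -> i <> j -> imK (f i) <> imK (f j).

(** Far along the chains the [f i (A ^^ k)] miss y, pairwise meet and are pairwise incomparable, so
    the dimension bounds their number. *)
Lemma inequivalent_bound r f (y : V) : inequivalent r f -> r <= N.
Proof.
move=> [h1 h2]; rewrite leqNgt; apply/negP => Nr.
have [m hm] : exists m, forall i, i \in iota 0 r -> forall k, m <= k ->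
    ~ (f i @` (A ^^ k)) y.
  apply: (@seq_bound _ (fun i m => forall k, m <= k -> ~ (f i @` (A ^^ k)) y)).
    by move=> i n n' nn' h k nk; apply: h; exact: leq_trans nk.
  move=> i; rewrite mem_iota add0n => /= ir.
  have [g [Gg gK1 gK2]] := Gam_inv (h1 i ir).
  have [n hn] := pow_leaves Gtau tK (g y) skA.
  by exists n => k /hn nk /(imE _ _ gK1 gK2).
have [m' hm'] : exists m, forall i, i \in iota 0 r -> forall j, j \in iota 0 r ->
    i <> j -> forall k, m <= k -> ~ (f i @` (A ^^ k) `<=` f j @` (A ^^ k)).
  apply: (@seq_bound _ (fun i m => forall j, j \in iota 0 r -> i <> j ->
     forall k, m <= k -> ~ (f i @` (A ^^ k) `<=` f j @` (A ^^ k)))).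
    by move=> i n n' nn' h j jr ij k nk; apply: h => //; exact: leq_trans nk.
  move=> i; rewrite mem_iota add0n => /= ir.
  apply: (@seq_bound _ (fun j m => i <> j -> forall k, m <= k -> _)).
    by move=> j n n' nn' h ij k nk; apply: h => //; exact: leq_trans nk.
  move=> j; rewrite mem_iota add0n => /= jr; have [<-|ij] := eqVneq i j; first by exists 0.
  have [n hn] := imK_incomparable (h1 i ir) (h1 j jr) (h2 i j ir jr (elimN eqP ij)).
  by exists n.
pose k := maxn m m'.
have ltr i : i <= N -> i \in iota 0 r by rewrite mem_iota; lia.
have [||p [q [pq qN hpq]]] := @comparable_fam y (fun i => f i @` (A ^^ k)).
- move=> i iN; split; first by apply: Gam_hs; [apply: h1; lia|exact: pow_hs].
  by apply: hm; [exact: ltr|exact: leq_maxl].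
- by move=> i j iN jN; apply: K_meets; [apply: h1; lia|apply: h1; lia|exact: K_pow|exact: K_pow].
have pN : p <= N by lia.
by case: hpq; apply: hm'; rewrite ?leq_maxr ?ltr //; lia.
Qed.

Lemma representatives (y : V) : exists r f, [/\ 0 < r, inequivalent r f &
  forall g, Gam g -> exists2 i, i < r & imK g = imK (f i)].
Proof.
pose P r := `[< exists f, inequivalent r f >].
have P1 : P 1.
  apply/asboolP; exists (fun=> id); split => // i j.
  by rewrite !ltnS !leqn0 => /eqP -> /eqP ->.
have bP r : P r -> r <= N by move=> /asboolP [f /(inequivalent_bound y)].
have := ex_maxnP (ex_intro _ 1 P1) bP.
case=> r /asboolP [f hf] mr; exists r, f; split => //; first exact: mr.
move=> g Gg; apply: contrapT => no.
suff : r.+1 <= r by rewrite ltnn.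
apply: mr; apply/asboolP; exists (fun i => if i < r then f i else g).
have [hf1 hf2] := hf; split=> [i _|i j]; first by case: ifP => // /hf1.
rewrite !ltnS (leq_eqVlt i) (leq_eqVlt j) => /orP[/eqP ->|ir] /orP[/eqP ->|jr] ij; rewrite ?ltnn ?ir ?jr //.
- by move=> e; apply: no; exists j.
- by move=> e; apply: no; exists i.
- exact: hf2.
Qed.

Lemma finite_list (P : set (set V)) : finite_set P ->
  exists s : seq (set V), uniq s /\ forall B, B \in s <-> P B.
Proof.
move=> /finite_seqP [s ->]; exists (undup s); split; first exact: undup_uniq.
by move=> B; rewrite mem_undup.
Qed.

(** * A base vertex adapted to all the translates of [K] *)

Section Rebase.
Variables (y : V) (r : nat) (f : nat -> V -> V).
Hypotheses (r0 : 0 < r) (inq : inequivalent r f).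
Hypothesis reps : forall g, Gam g -> exists2 i, i < r & imK g = imK (f i).

Let Gf i : i < r -> Gam (f i). Proof. by case: inq => h _ /h. Qed.

(** The members of K missing y at which [sp_U] or [sp_disj] would fail with base vertex y. *)
Definition bad b := [/\ K b, ~ b y & exists2 i, i < r &
  (f i @` b) y \/ exists j, [/\ j < r, j <> i & imK (f j) (f i @` b)]].

Lemma bad_finite : finite_set bad.
Proof.
pose P1 i := [set b | [/\ K b, ~ b y & (f i @` b) y]].
pose P2 i j := [set b | [/\ K b, ~ b y, i <> j & imK (f j) (f i @` b)]].
apply: (@sub_finite_set _ _
   (\bigcup_(i in `I_r) (P1 i `|` \bigcup_(j in `I_r) P2 i j))).
  move=> b [kb nb [i ir [h|[j [jr ji h]]]]]; exists i => //; first by left.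
  by right; exists j => //; split => // e; apply: ji.
apply: bigcup_finite => // i /= ir.
rewrite finite_setU; split.
  have [g [Gg fg gf]] := Gam_inv (Gf ir).
  apply: (sub_finite_set _ (finite_seq (sep y (g y)))) => b [[hb _] nb /(imE _ _ fg gf) h].
  by apply/mem_sep.
apply: bigcup_finite => // j /= jr.
have [<-|ne] := eqVneq i j; first by apply: (sub_finite_set _ (@finite_set0 _)) => b [].
have [n nn] : exists n, ~ imK (f j) (f i @` (A ^^ n)).
  apply: contrapT => no; case: (inq.2 j i jr ir); first by move=> e; rewrite e eqxx in ne.
  apply: imK_eq => //; [exact: Gf|exact: Gf|move=> n].
  by apply: contrapT => nn; apply: no; exists n.
apply: (sub_finite_set _ (K_deep y n)) => b [kb nb _ h]; split => // bA; apply: nn.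
apply: (imK_up (Gf jr) h); last exact: image_subset.
by apply: Gam_hs; [exact: Gf|exact: pow_hs].
Qed.

Definition good b := [/\ K b, ~ b y & ~ bad b].

(** What has to be crossed on the way from y to the new base vertex, in order that the latter lie in
    [f i b] for every b in K that is not good. *)
Definition flipped B := ~ B y /\ exists2 i, i < r & exists2 b, K b /\ ~ good b & B = f i @` b.

Lemma flipped_finite : finite_set flipped.
Proof.
pose P i g := [set b | [/\ hs b, ~ b (g y) & b y]].
have [gs hgs] : exists gs : nat -> V -> V, forall i, i < r ->
    [/\ Gam (gs i), cancel (f i) (gs i) & cancel (gs i) (f i)].
  have h i : exists g, i < r -> [/\ Gam g, cancel (f i) g & cancel g (f i)].
    have [ir|] := boolP (i < r); last by exists id.
    by have [g hg] := Gam_inv (Gf ir); exists g.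
  by exists (fun i => sval (cid (h i))) => i ir; exact: (svalP (cid (h i)) ir).
apply: (@sub_finite_set _ _
  (\bigcup_(i in `I_r) ((fun b => f i @` b) @` ([set` sep (gs i y) y] `|` bad)))).
  move=> B [nB [i ir [b [kb ng] eB]]]; exists i => //; exists b => //.
  have [Gg fg gf] := hgs i ir.
  have [yb|nyb] := pselect (b y); [left|right].
    apply/mem_sep; split => //; first by case: kb.
    by move=> h; apply: nB; rewrite eB; apply/(imE _ _ fg gf).
  by apply: contrapT => nb; apply: ng.
apply: bigcup_finite => // i /= ir; apply: finite_image.
by rewrite finite_setU; split; [exact: finite_seq|exact: bad_finite].
Qed.

Lemma good_pow : exists n0, forall k, n0 <= k -> good (A ^^ k).
Proof.
have [n hn] := pow_leaves Gtau tK y skA.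
have [Z [uZ hZ]] := finite_list bad_finite.
have [m hm] : exists m, forall z, z \in Z -> forall k, m <= k -> A ^^ k <> z.
  apply: (@seq_bound _ (fun z m => forall k, m <= k -> A ^^ k <> z)).
    by move=> z p q pq h k qk; apply: h; exact: leq_trans qk.
  move=> z _; have [[k0 <-]|no] := pselect (exists k, A ^^ k = z).
    exists k0.+1 => k kk /(pow_inj tK skA) e; move: kk; rewrite e ltnn //.
  by exists 0 => k _ e; apply: no; exists k.
exists (maxn n m) => k; rewrite geq_max => /andP[nk mk].
split; [exact: K_pow|exact: hn|move=> /hZ /hm /(_ k mk)//].
Qed.

(** An ideal containing some b inside [A ^^ (n0 + L)] contains all the powers of A with exponents
    from n0 to n0 + L, too many for its size. So [K_deep] applies to its members. *)
Lemma good_fin L : exists s : seq (set V), forall u, ideal good u -> size u <= L ->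
  {subset u <= s}.
Proof.
have [n0 hn0] := good_pow; pose m := n0 + L.
have [Z [uZ hZ]] := finite_list (K_deep y m).
exists Z => u [uu hu1 hu2] su b bu; apply/hZ; have [kb nb _] := hu1 b bu.
split => // bA; have := @uniq_leq_size _ [seq A ^^ k | k <- iota n0 L.+1] u.
rewrite size_map size_iota map_inj_uniq ?iota_uniq; last exact: (pow_inj tK skA).
move=> /(_ isT) h; suff : L < size u by rewrite ltnNge su.
apply: h => B /mapP [k]; rewrite mem_iota => hk ->.
apply: (hu2 b) => //; first by apply: hn0; lia.
by apply: (subset_trans bA); apply: pow_anti => //; rewrite /m; lia.
Qed.

Lemma good_inf L : exists2 u, ideal good u & L <= size u.
Proof.
have [n0 hn0] := good_pow; pose m := n0 + L.
have [z zA] : exists z, (A ^^ m) z by apply: hs_ex; exact: pow_hs.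
pose P := [set b | good b /\ A ^^ m `<=` b].
have fP : finite_set P.
  apply: (sub_finite_set _ (finite_seq (sep y z))) => b [[[hb _] nb _] Ab].
  by apply/mem_sep; split => //; exact: Ab.
have [u [uu hu]] := finite_list fP; exists u.
  split => // [b /hu []//|b c /hu [gb Ab] gc bc]; apply/hu; split => //.
  exact: subset_trans bc.
have := @uniq_leq_size _ [seq A ^^ k | k <- iota n0 L] u.
rewrite size_map size_iota map_inj_uniq ?iota_uniq; last exact: (pow_inj tK skA).
move=> /(_ isT); apply => B /mapP [k]; rewrite mem_iota => hk ->.
apply/hu; split; first by apply: hn0; lia.
by apply: pow_anti => //; rewrite /m; lia.
Qed.

Lemma translates_comp f1 g1 : translates K (g1 \o f1) = (fun B => g1 @` B) @` imK f1.
Proof.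
apply/seteqP; split=> B.
  by move=> [b kb ->]; exists (f1 @` b); [exists b|rewrite image_comp].
by move=> [_ [b kb ->] <-]; exists b; rewrite // image_comp.
Qed.

(** Failing to be good passes to larger members of K, so [flipped] is upward closed among the
    half-spaces missing y. It is also finite and pairwise meeting, and the vertex that realizes it
    is the new base. *)
Lemma rebase : exists x, spread hs Gam K good x r f.
Proof.
have [s [us hs']] := finite_list flipped_finite.
have [|||x hx] := @realize y s us.
- move=> B /hs' [nB [i ir [b [kb _] eB]]]; split => //; rewrite eB.
  by apply: Gam_hs; [exact: Gf|case: kb].
- move=> B C /hs' [_ [i ir [b [kb _] ->]]] /hs' [_ [j jr [c [kc _] ->]]].
  by apply: K_meets => //; exact: Gf.
- move=> B C /hs' [nB [i ir [b [kb ngb] eB]]] hC nC BC; apply/hs'; split => //; exists i => //.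
  have [g [Gg fg gf]] := Gam_inv (Gf ir).
  have kc : K (g @` C).
    apply: (imK_can fg); rewrite (im_can _ gf); apply: (imK_up (Gf ir) _ hC BC).
    by exists b.
  have bc : b `<=` g @` C by rewrite -(im_can b fg) -eB; exact: image_subset.
  exists (g @` C); last by rewrite (im_can _ gf).
  split => // -[_ ngc nbad]; apply: ngb; split => //; first by move/bc.
  move=> [_ _ [k kr h]]; apply: nbad; split => //; exists k => //.
  case: h => [h|[j [jr jk h]]]; [left|right].
    by case: h => w bw <-; exists w => //; exact: bc.
  exists j; split => //; apply: (imK_up (Gf jr) h); last exact: image_subset.
  by apply: Gam_hs; [exact: Gf|case: kc].
exists x.
have disj i j b : i < r -> j < r -> i <> j -> good b -> ~ translates K (f j) (f i @` b).
  move=> ir jr ij [kb nb nbad] h; apply: nbad; split => //; exists i => //; right.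
  by exists j; split => // e; apply: ij.
split => //.
- by move=> b [].
- exact: K_up.
- exact: K_meets.
- by move=> b [].
- move=> i b ir kb; have hB : hs (f i @` b) by apply: Gam_hs; [exact: Gf|case: kb].
  have [g [Gg fg gf]] := Gam_inv (Gf ir).
  split=> [gb Bx|nBx].
    have nBy : ~ (f i @` b) y.
      by move=> By; have [_ nb nbad] := gb; apply: nbad; split => //; exists i => //; left.
    have /hs' [_ [j jr [c [kc ngc] e]]] := proj1 (hx _ hB nBy) Bx.
    have [eij|/eqP ij] := eqVneq i j.
      by subst j; have := im_inj fg e => e'; subst c.
    by apply: (disj i j b) => //; exists c.
  have nBy : ~ (f i @` b) y.
    move=> By; have /hs' [_ [j jr [c [kc _] e]]] : ~` (f i @` b) \in s.
      by apply: (proj1 (hx _ (hs_compl hB) _)) nBx => /(_ By).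
    have [z h1] := K_meets (Gf ir) (Gf jr) kb kc; rewrite -e; exact.
  apply: contrapT => ng; apply: nBx; apply/(hx _ hB nBy); apply/hs'.
  by split => //; exists i => //; exists b.
- by move=> g i Gg ir; apply: reps; apply: Gam_comp => //; exact: Gf.
- move=> g j Gg jr; have [h [Gh gh hg]] := Gam_inv Gg.
  have [i ir e] := reps (Gam_comp Gh (Gf jr)); exists i => //.
  have gh1 b : g @` ((h \o f j) @` b) = f j @` b by rewrite -image_comp (im_can _ hg).
  rewrite translates_comp -e; apply/seteqP; split=> B.
    by move=> [_ [b kb ->] <-]; rewrite gh1; exists b.
  by move=> [b kb ->]; exists ((h \o f j) @` b); [exists b|rewrite gh1].
- by apply: (@K_quasi_chain y) => b [kb nb _].
- exact: good_fin.
- exact: good_inf.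
Qed.
End Rebase.
End Terminal.

Theorem spread_ex A (y : V) : hs A ->
  (forall g, Gam g -> meets A (g @` A) \/ g @` A = ~` A) ->
  ~ finite_set [set B | (exists2 g, Gam g & B = g @` A) /\ ~ B y] ->
  exists K U x r f, spread hs Gam K U x r f.
Proof.
move=> hA unf inf; have [g Gg [sg ng]] := skewer_ex hA unf inf.
have mt := all_meet Gg sg ng unf; have [h [Gh gh hg]] := Gam_inv Gg.
have kA : skewered g A by [].
have [A' [kA' AA' tA']] := terminal_ex Gg Gh gh hg kA y.
have [r [f [r0 inq reps]]] := representatives Gg Gh gh hg mt kA' AA' tA' y.
have [x sp] := rebase Gg Gh gh hg mt kA' AA' tA' y r0 inq reps.
by exists (K g A'), (good g A' y r f), x, r, f.
Qed.
End Skewering.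

Import Order.TTheory GRing.Theory Num.Theory.
Import numFieldNormedType.Exports.
Local Open Scope ring_scope.

(** * Cubes and vertices *)

Section CubeGeometry.
Context {R : realType}.
Implicit Types n : nat.

Lemma ord_eq1 n (k m : 'I_n) : n = 1%N -> m = k.
Proof. by move=> e; subst n; rewrite !ord1. Qed.

Lemma ord_two n (k m m' : 'I_n) : n = 2%N -> m <> k -> m' <> k -> m = m'.
Proof.
move=> e; subst n => h1 h2; apply: val_inj => /=.
have n1 : nat_of_ord m <> k by move=> e; apply: h1; exact: val_inj.
have n2 : nat_of_ord m' <> k by move=> e; apply: h2; exact: val_inj.
by have := ltn_ord m; have := ltn_ord m'; have := ltn_ord k; lia.
Qed.

Definition flip n (b : 'I_n -> bool) (k : 'I_n) : 'I_n -> bool :=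
  fun j => if j == k then ~~ b j else b j.

Lemma flipK n (b : 'I_n -> bool) k : flip (flip b k) k = b.
Proof. by apply/funext => j; rewrite /flip; case: eqP => // _; rewrite negbK. Qed.

Lemma flipC n (b : 'I_n -> bool) k l : flip (flip b k) l = flip (flip b l) k.
Proof. by apply/funext => j; rewrite /flip; case: eqP; case: eqP. Qed.

Lemma flip_self n (b : 'I_n -> bool) k : flip b k k = ~~ b k.
Proof. by rewrite /flip eqxx. Qed.

Lemma flip_other n (b : 'I_n -> bool) k j : j != k -> flip b k j = b j.
Proof. by rewrite /flip => /negPf ->. Qed.

Lemma flip_neq n (b : 'I_n -> bool) k : flip b k <> b.
Proof. by move=> /(congr1 (fun f => f k)); rewrite flip_self; case: (b k). Qed.

Lemma flip_inj n (b : 'I_n -> bool) : injective (flip b).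
Proof.
move=> k l e; apply/eqP/negPn/negP => kl.
have := congr1 (fun f => f k) e; rewrite flip_self flip_other //.
by case: (b k).
Qed.

Definition ptv n (b : 'I_n -> bool) : 'rV[R]_n := \row_k (b k)%:R.

Lemma ptvE n (b : 'I_n -> bool) k : ptv b 0 k = (b k)%:R. Proof. by rewrite mxE. Qed.

Lemma ptv_cube n (b : 'I_n -> bool) : unit_cube (ptv b).
Proof. by move=> k; rewrite ptvE; case: (b k); rewrite /= ?lexx ?ler01. Qed.

Lemma ptv_inj n : injective (@ptv n).
Proof.
move=> b b' /rowP e; apply/funext => k; have := e k; rewrite !ptvE => /eqP.
by case: (b k); case: (b' k) => //; rewrite ?oner_eq0 // eq_sym oner_eq0.
Qed.

Definition ed2 n (x y : 'rV[R]_n) : R := \sum_(i < n) (x 0 i - y 0 i) ^+ 2.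

Lemma ed2_ge0 n (x y : 'rV[R]_n) : 0 <= ed2 x y.
Proof. by apply: sumr_ge0 => i _; exact: sqr_ge0. Qed.

Lemma ed_ed2 n (x y : 'rV[R]_n) : euclid_dist x y ^+ 2 = ed2 x y.
Proof. by rewrite sqr_sqrtr // ed2_ge0. Qed.

Lemma ed_ge0 n (x y : 'rV[R]_n) : 0 <= euclid_dist x y.
Proof. exact: sqrtr_ge0. Qed.

Lemma ed_eq m n (x y : 'rV[R]_m) (z w : 'rV[R]_n) :
  euclid_dist x y = euclid_dist z w <-> ed2 x y = ed2 z w.
Proof. by split=> e; [rewrite -!ed_ed2 e|congr Num.sqrt]. Qed.

Lemma ed2_coord n (x y : 'rV[R]_n) k : (x 0 k - y 0 k) ^+ 2 <= ed2 x y.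
Proof.
by rewrite /ed2 (bigD1 k) //= lerDl; apply: sumr_ge0 => i _; exact: sqr_ge0.
Qed.

Lemma ed_coord n (x y : 'rV[R]_n) k : `|x 0 k - y 0 k| <= euclid_dist x y.
Proof. by rewrite -sqrtr_sqr; apply: ler_wsqrtr; exact: ed2_coord. Qed.

(* The distance from x to the face through the corner b orthogonal to direction k *)
Definition cdist n (b : 'I_n -> bool) (k : 'I_n) (x : 'rV[R]_n) : R :=
  if b k then 1 - x 0 k else x 0 k.

(** Polarization: expressed by distances to two corners, [cdist] is carried along by every isometry
    that maps corners to corners. *)
Lemma cdistE n (b : 'I_n -> bool) k (x : 'rV[R]_n) :
  cdist b k x = (ed2 x (ptv b) - ed2 x (ptv (flip b k)) + 1) / 2.
Proof.
rewrite /ed2 (bigD1 k) //= [X in _ - X](bigD1 k) //= !ptvE flip_self.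
rewrite [X in _ - (_ + X)](eq_bigr (fun i => (x 0 i - ptv b 0 i) ^+ 2)); last first.
  by move=> i ik; rewrite !ptvE flip_other.
set S := \sum_(_ < _ | _) _; rewrite /cdist; case: (b k) => /=; lra.
Qed.

Lemma cdist_flip n (b : 'I_n -> bool) k (x : 'rV[R]_n) :
  cdist (flip b k) k x = 1 - cdist b k x.
Proof. by rewrite /cdist flip_self; case: (b k) => //=; lra. Qed.

Lemma cdist_eq0 n (b : 'I_n -> bool) k (x : 'rV[R]_n) : cdist b k x = 0 <-> x 0 k = (b k)%:R.
Proof. by rewrite /cdist; case: (b k) => /=; split; lra. Qed.

Lemma cdist_ge0 n (b : 'I_n -> bool) k (x : 'rV[R]_n) : unit_cube x -> 0 <= cdist b k x <= 1.
Proof. by move=> /(_ k) /andP[h1 h2]; rewrite /cdist; case: (b k); apply/andP; split; lra. Qed.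

Lemma cdist_inj n (b : 'I_n -> bool) (x y : 'rV[R]_n) :
  (forall k, cdist b k x = cdist b k y) -> x = y.
Proof.
move=> h; apply/rowP => k; have := h k; rewrite /cdist; case: (b k) => //; lra.
Qed.

Lemma cdist_sub n (b : 'I_n -> bool) k (x y : 'rV[R]_n) :
  `|cdist b k x - cdist b k y| = `|x 0 k - y 0 k|.
Proof.
rewrite /cdist; case: (b k) => //.
by rewrite -[LHS]normrN; congr `|_|; lra.
Qed.

Lemma ed2_ptv n (b b' : 'I_n -> bool) : ed2 (ptv b) (ptv b') = \sum_(k < n) (b k != b' k)%:R.
Proof.
apply: eq_bigr => k _; rewrite !ptvE; case: (b k); case: (b' k) => /=; lra.
Qed.

Lemma ed2_flip n (b : 'I_n -> bool) k : ed2 (ptv b) (ptv (flip b k)) = 1.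
Proof.
rewrite ed2_ptv (bigD1 k) //= flip_self big1 ?addr0; first by case: (b k).
by move=> i ik; rewrite flip_other // eqxx.
Qed.

Lemma ed2_1 n (b b' : 'I_n -> bool) : ed2 (ptv b) (ptv b') = 1 -> exists k, b' = flip b k.
Proof.
rewrite ed2_ptv => h.
have [[k hk]|no] := pselect (exists k, b k != b' k); last first.
  move: h; rewrite big1 => [|k _]; first by move/eqP; rewrite eq_sym oner_eq0.
  by case: eqP => // /eqP ne; case: no; exists k.
exists k; apply/funext => j; rewrite /flip; case: eqP => [->|/eqP jk].
  by move: hk; case: (b k); case: (b' k).
apply/eqP/negPn/negP => ne; move: h.
rewrite (bigD1 k) //= (bigD1 j) //= hk eq_sym ne => h.
have : (0 : R) <= \sum_(i < n | (i != k) && (i != j)) (b i != b' i)%:R.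
  by apply: sumr_ge0 => i _; exact: ler0n.
move: h; set S := \sum_(_ < _ | _) _; rewrite /= => h1 h2.
lra.
Qed.
End CubeGeometry.

Section Cells.
Context {R : realType} (X : cubeComplex R).
Implicit Types (i j : cell_index X).

Definition crn i (b : 'I_(dim i) -> bool) : X := chart i (ptv b).

Lemma cellI i x : unit_cube x -> cell i (chart i x).
Proof. by exists x. Qed.

Lemma crn_cell i b : cell i (@crn i b).
Proof. exact/cellI/ptv_cube. Qed.

Lemma crn_inj i : injective (@crn i).
Proof.
by move=> b b' e; apply: ptv_inj; apply: (@chart_inj R X i _ _ _ _ e); rewrite inE; exact: ptv_cube.
Qed.

Lemma ed_chart i j x x' y y' :
  @unit_cube R (dim i) x -> @unit_cube R (dim i) x' ->
  @unit_cube R (dim j) y -> @unit_cube R (dim j) y' ->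
  chart i x = chart j y -> chart i x' = chart j y' -> ed2 x x' = ed2 y y'.
Proof.
move=> cx cx' cy cy' e e'.
have [|s [t [h [[bh hh] g]]]] := @cell_gluing R X i j.
  by exists (chart i x); split; [exact: cellI|rewrite e; exact: cellI].
have [sx _ ->] := proj1 (g x y cx cy) e; have [sx' _ ->] := proj1 (g x' y' cx' cy') e'.
by apply/esym; apply/ed_eq; exact: hh.
Qed.

Lemma inter_face i j p : cell i p -> cell j p ->
  exists s, forall x, unit_cube x -> (cell j (chart i x) <-> cube_face s x).
Proof.
move=> ip jp; have [|s [t [h [[bh hh] g]]]] := @cell_gluing R X i j; first by exists p.
exists s => x cx; split=> [[y cy /esym e]|sx].
  by have [] := proj1 (g x y cx cy) e.
have [hf _ _] := bh; have th : cube_face t (h x) by apply: hf.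
by exists (h x); [case: th|apply/esym; apply/g; [exact: cx|case: th|]].
Qed.

Lemma face_ptv n (s : 'I_n -> option bool) b :
  cube_face s (@ptv R n b) <-> forall k c, s k = Some c -> b k = c.
Proof.
split=> [[_ h] k c sk|h]; last first.
  by split; [exact: ptv_cube|move=> k c sk; rewrite ptvE (h k c sk)].
have := h k c sk; rewrite ptvE => /eqP; case: (b k); case: c {sk} => //=.
  by rewrite oner_eq0.
by rewrite eq_sym oner_eq0.
Qed.

(** The gluing to a 0-cell identifies a face of i with a single point, so no coordinate is free on
    that face. *)
Lemma vertex_corner i v : is_vertex v -> cell i v -> exists b, v = @crn i b.
Proof.
move=> [j dj jv] iv.
have [|s [t [h [[bh hh] g]]]] := @cell_gluing R X i j; first by exists v.
have [x cx ex] := iv; have [y cy ey] := jv.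
have [sx ty eh] : [/\ cube_face s x, cube_face t y & y = h x].
  by apply/g => //; rewrite ex ey.
have uniqx x' : cube_face s x' -> x' = x.
  move=> sx'; have [_ inj _] := bh; apply: inj; rewrite ?inE //.
  by apply/rowP => k; have := ltn_ord k; rewrite [X in (_ < X)%N]dj.
have key k : exists c : bool, x 0 k = c%:R.
  case sk : (s k) => [c|]; first by exists c; case: sx => _ h'; exact: h'.
  (* A free coordinate could take any value without leaving the face, which has one point. *)
  have upd (a : R) : 0 <= a <= 1 -> x 0 k = a.
    move=> ha; rewrite -(uniqx (\row_l (if l == k then a else x 0 l))) ?mxE ?eqxx //.
    split=> [l|l c sl]; rewrite mxE; first by case: eqP => // _; exact: cx.
    by case: eqP => [lk|_]; [move: sl; rewrite lk sk|case: sx => _; exact].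
  by exists false; apply: upd; rewrite lexx ler01.
exists (fun k => sval (cid (key k))); rewrite /crn -ex; congr chart.
by apply/rowP => k; rewrite ptvE; exact: (svalP (cid (key k))).
Qed.

Lemma corner_vertex i b : is_vertex (@crn i b).
Proof.
have [j ej] := @face_closed R X i (fun k => Some (b k)).
have pt p : cell j p -> p = crn b.
  rewrite /cell ej => -[x [_ h] <-]; rewrite /crn; congr chart.
  by apply/rowP => k; rewrite ptvE; apply: h.
exists j; last first.
  rewrite /cell ej; exists (ptv b) => //.
  by apply/face_ptv => k c [].
apply/eqP/negPn/negP => nz; have dj : (0 < dim j)%N by rewrite lt0n.
pose k := Ordinal dj.
have := crn_inj (etrans (pt _ (crn_cell (fun=> true))) (esym (pt _ (crn_cell (fun=> false))))).
by move=> /(congr1 (fun f => f k)).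
Qed.

Definition vert := {p : X | is_vertex p}.

Definition vx (v : vert) : X := sval v.

Lemma vx_inj : injective vx.
Proof.
by move=> [p hp] [q hq] /= e; subst q; congr exist; exact: Prop_irrelevance.
Qed.

Definition crnV i b : vert := exist _ _ (@corner_vertex i b).

Lemma crnV_inj i : injective (@crnV i).
Proof. by move=> b b' /(congr1 vx) /crn_inj. Qed.

Lemma vertexP i (v : vert) : cell i (vx v) -> exists b, v = @crnV i b.
Proof.
by move=> /(vertex_corner (svalP v)) [b e]; exists b; apply: vx_inj.
Qed.

Lemma transfer i j b b' k : @crnV i b = @crnV j b' -> cell j (crn (flip b k)) ->
  exists k', crnV (flip b k) = crnV (flip b' k').
Proof.
move=> e h; have [b1 e1] := vertexP (v := crnV (flip b k)) h.
have [|k' ek] := @ed2_1 R _ b' b1; last by exists k'; rewrite e1 ek.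
rewrite -(ed2_flip b k); apply/esym.
apply: (@ed_chart i j); try exact: ptv_cube.
  by move/(congr1 vx): e.
by move/(congr1 vx): e1.
Qed.

(** The common face of i and j contains a corner and all its neighbours in i, so it fixes no
    coordinate. *)
Lemma cell_sub i j b : cell j (@crn i b) -> (forall k, cell j (crn (flip b k))) ->
  cell i `<=` cell j.
Proof.
move=> jb jk p [x cx <-]; have [s hs] := inter_face (crn_cell b) jb.
apply/hs => //; split => // k c sk.
have h1 := proj1 (face_ptv s b) (proj1 (hs _ (ptv_cube b)) jb) k c sk.
have := proj1 (face_ptv s _) (proj1 (hs _ (ptv_cube (flip b k))) (jk k)) k c sk.
by rewrite flip_self h1; case: c {sk h1}.
Qed.

Lemma cell_antisym i j : cell i `<=` cell j -> cell j `<=` cell i -> i = j.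
Proof. by move=> h1 h2; apply: (@cell_inj R X); apply/seteqP. Qed.

Definition dface n (b : 'I_n -> bool) (K : pred 'I_n) : 'I_n -> option bool :=
  fun k => if K k then None else Some (b k).

Lemma dface_ptv n (b d : 'I_n -> bool) (K : pred 'I_n) :
  cube_face (dface b K) (@ptv R n d) <-> forall k, ~~ K k -> d k = b k.
Proof.
rewrite face_ptv /dface; split=> [h k nk|h k c]; first by apply: h; rewrite (negPf nk).
by case: ifPn => // /h -> [].
Qed.

Lemma chart_face i s x : unit_cube x ->
  (chart i @` cube_face s) (chart i x) <-> cube_face s x.
Proof.
move=> cx; split=> [[y sy e]|sx]; last by exists x.
suff -> : x = y by [].
by apply/esym; apply: (@chart_inj R X i _ _ _ _ e); rewrite inE //; case: sy.
Qed.

(** The dimension of the cell c is read off from its corner at b: its edges there correspond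
    bijectively to the directions in K. *)
Lemma dface_ex i (b : 'I_(dim i) -> bool) (K : pred 'I_(dim i)) :
  exists c, [/\ cell c = chart i @` cube_face (dface b K), dim c = #|K| & cell c `<=` cell i].
Proof.
have [c ec] := @face_closed R X i (dface b K); rewrite -/(cell c) in ec.
have ci : cell c `<=` cell i by rewrite ec => _ [x [cx _] <-]; exact: cellI.
have cin d : cell c (crn d) <-> forall k, ~~ K k -> d k = b k.
  by rewrite ec; apply: iff_trans (chart_face _ (ptv_cube _)) (dface_ptv _ _ _).
exists c; split => //.
have cb : cell c (crn b) by apply/cin.
have [b' eb] := vertexP (v := crnV b) cb.
have f1 k : exists m, crnV (flip b' k) = crnV (flip b m) by apply: transfer (esym eb) _; apply: ci; exact: crn_cell.
pose f k := sval (cid (f1 k)).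
have fP k : crnV (flip b' k) = crnV (flip b (f k)) := svalP (cid (f1 k)).
have fi : injective f.
  by move=> k l e; apply: (@flip_inj _ b'); apply: crnV_inj; rewrite !fP e.
have fK k : K (f k).
  apply/negPn/negP => nk; have := crn_cell (flip b' k).
  move/(congr1 vx): (fP k) => /= -> /cin /(_ _ nk); rewrite flip_self.
  by case: (b _).
rewrite -[LHS]card_ord -(card_imset predT fi); apply: eq_card => m.
apply/imsetP/idP => [[k _ ->]|Km]; first exact: fK.
have [|k ek] := transfer (k := m) eb.
  by apply/cin => k nk; rewrite flip_other //; apply: contraNneq nk => ->.
by exists k => //; apply: (@flip_inj _ b); apply: crnV_inj; rewrite ek fP.
Qed.

Definition adjV (v w : vert) : Prop :=
  exists i b k, v = @crnV i b /\ w = crnV (flip b k).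

Definition sqV (u a w b : vert) : Prop :=
  exists i c k l, [/\ k <> l, u = @crnV i c, a = crnV (flip c k),
    w = crnV (flip (flip c k) l) & b = crnV (flip c l)].

Lemma adjV_sym v w : adjV v w -> adjV w v.
Proof. by move=> [i [b [k [-> ->]]]]; exists i, (flip b k), k; rewrite flipK. Qed.

Lemma adjV_neq v w : adjV v w -> v <> w.
Proof. by move=> [i [b [k [-> ->]]]] /crnV_inj /esym; exact: flip_neq. Qed.

Lemma sqV_rot u a w b : sqV u a w b -> sqV a w b u.
Proof.
move=> [i [c [k [l [kl -> -> -> ->]]]]]; exists i, (flip c k), l, k; split => //.
- by move=> e; apply: kl.
- by rewrite flipC flipK.
- by rewrite flipK.
Qed.

Lemma sqV_flip u a w b : sqV u a w b -> sqV u b w a.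
Proof.
move=> [i [c [k [l [kl -> -> -> ->]]]]]; exists i, c, l, k; split => //; last by rewrite flipC.
by move=> e; apply: kl.
Qed.

Lemma sqV_neq u a w b : sqV u a w b -> a <> b.
Proof. by move=> [i [c [k [l [kl _ -> _ ->]]]]] /crnV_inj /flip_inj. Qed.

Lemma sqV_adj u a w b : sqV u a w b -> adjV u a.
Proof. by move=> [i [c [k [l [kl -> -> _ _]]]]]; exists i, c, k. Qed.

Lemma face_in i j b k l : cell j (@crn i b) -> cell j (crn (flip b k)) ->
  cell j (crn (flip b l)) -> cell j (crn (flip (flip b k) l)).
Proof.
move=> h hk hl; have [s hs] := inter_face (crn_cell b) h.
have g d := hs _ (@ptv_cube R _ d).
have e := proj1 (face_ptv s b) (proj1 (g b) h).
have nk : s k = None.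
  case sk : (s k) => [c|//]; have := proj1 (face_ptv s _) (proj1 (g _) hk) k c sk.
  by rewrite flip_self (e _ _ sk); case: c {sk}.
have nl : s l = None.
  case sl : (s l) => [c|//]; have := proj1 (face_ptv s _) (proj1 (g _) hl) l c sl.
  by rewrite flip_self (e _ _ sl); case: c {sl}.
apply/g; apply/face_ptv => m c sm; rewrite /flip.
case: eqP => [ml|_]; first by rewrite ml nl in sm.
by case: eqP => [mk|_]; [rewrite mk nk in sm|exact: e].
Qed.

Lemma flip_two n (b d : 'I_n -> bool) k l : k <> l -> d <> b ->
  (exists m, d = flip (flip b k) m) -> (exists m, d = flip (flip b l) m) ->
  d = flip (flip b k) l.
Proof.
move=> kl db [m em] [m' em'].
have [ml|/eqP ml] := eqVneq m l; first by rewrite em ml.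
case: db; have e := congr1 (fun f => f l) em; rewrite em' in e.
rewrite em'; have [->|/eqP m'l] := eqVneq m' l; first by rewrite flipK.
move: e; rewrite /flip; case: eqP => [lm'|_]; first by case: m'l.
rewrite eqxx; case: eqP => [lm|_]; first by case: ml.
by case: eqP => [lk|_]; [case: kl|case: (b l)].
Qed.

(** The cell carrying the square meets j in a face; containing u, a and b, this face contains w too,
    and w is determined by its adjacency to a and b. *)
Lemma sq_in_cell j d k l u a w b : sqV u a w b -> u = @crnV j d ->
  a = crnV (flip d k) -> b = crnV (flip d l) -> w = crnV (flip (flip d k) l).
Proof.
move=> sq1; have kl : a <> b := sqV_neq sq1.
move=> eu ea eb; have {}kl : k <> l by move=> e; apply: kl; rewrite ea eb e.
move: sq1 => [i [c [p [q [pq eu' ea' ew eb']]]]].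
have ju : cell j (@crn i c) by move/(congr1 vx): eu'; rewrite eu /= => <-; exact: crn_cell.
have ja : cell j (crn (flip c p)).
  by move/(congr1 vx): ea'; rewrite ea /= => <-; exact: crn_cell.
have jb : cell j (crn (flip c q)).
  by move/(congr1 vx): eb'; rewrite eb /= => <-; exact: crn_cell.
have jw := face_in ju ja jb.
have [d' ed'] := vertexP (v := crnV (flip (flip c p) q)) jw.
rewrite ew ed'; congr crnV; apply: flip_two => //.
- move=> e; move: ed'; rewrite e -eu eu' => /crnV_inj /(congr1 (fun f => f p)).
  by rewrite flip_other ?flip_self; [case: (c p)|apply/eqP].
- have [m em] := @transfer i j (flip c p) (flip d k) q (etrans (esym ea') ea) jw.
  by exists m; apply: crnV_inj; rewrite -ed' em.
- rewrite flipC in jw.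
  have [m em] := @transfer i j (flip c q) (flip d l) p (etrans (esym eb') eb) jw.
  by exists m; apply: crnV_inj; rewrite -ed' -em flipC.
Qed.

Lemma sqV_inj u a w w' b : sqV u a w b -> sqV u a w' b -> w = w'.
Proof.
move=> s1 s2; have [i [c [k [l [_ eu ea ew eb]]]]] := s1.
by rewrite ew; apply/esym; exact: sq_in_cell s2 eu ea eb.
Qed.

Definition edge_on e (u a : vert) := [/\ is_edge e, cell e (vx u) & cell e (vx a)].

Lemma edge_cornerP e v : is_edge e -> cell e (vx v) -> exists b k,
  v = @crnV e b /\ forall w, cell e (vx w) -> w = v \/ w = crnV (flip b k).
Proof.
move=> ee ev; have [b eb] := vertexP ev; rewrite /is_edge in ee.
have d1 : (0 < dim e)%N by rewrite ee.
pose k := Ordinal d1; exists b, k; split => // w /vertexP [b' ->].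
have uk m : m = k by exact: ord_eq1 ee.
have [e1|ne] := eqVneq (b' k) (b k); [left|right]; rewrite ?eb; congr crnV;
  apply/funext => m; rewrite (uk m) // flip_self; move: ne; by case: (b k); case: (b' k).
Qed.

Lemma edge_uniq e e' u a : u <> a -> edge_on e u a -> edge_on e' u a -> e = e'.
Proof.
move=> ua; suff h f f' : edge_on f u a -> edge_on f' u a -> cell f `<=` cell f'.
  by move=> h1 h2; apply: cell_antisym; exact: h.
move=> [ef fu fa] [ef' f'u f'a]; have [b [k [eb hw]]] := edge_cornerP ef fu.
have ea : a = crnV (flip b k) by case: (hw _ fa) => // h; case: ua.
apply: (@cell_sub _ _ b); first by rewrite eb in f'u.
move=> m; have -> : m = k.
  exact: ord_eq1 ef.
by rewrite ea in f'a.
Qed.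

Lemma edge_ex i b k : exists e, edge_on e (@crnV i b) (crnV (flip b k)) /\
  cell e = chart i @` cube_face (dface b (pred1 k)).
Proof.
have [e [ee de _]] := dface_ex b (pred1 k); exists e; split => //; split.
- by rewrite /is_edge de card1.
- by rewrite ee /=; apply/chart_face; [exact: ptv_cube|exact/dface_ptv].
- rewrite ee /=; apply/chart_face; first exact: ptv_cube.
  by apply/dface_ptv => m; rewrite /= => mk; rewrite flip_other.
Qed.

Lemma adj_edge u a : adjV u a -> exists e, edge_on e u a.
Proof. by move=> [i [b [k [-> ->]]]]; have [e [h _]] := edge_ex b k; exists e. Qed.

Lemma edge_other e u a w : u <> a -> edge_on e u a -> cell e (vx w) -> w = u \/ w = a.
Proof.
move=> ua [ee eu ea]; have [b [k [_ hw]]] := edge_cornerP ee eu.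
by move=> /hw [->|->]; [left|right; case: (hw _ ea) => // h; case: ua].
Qed.

Lemma edge_nbr e u : is_edge e -> cell e (vx u) -> exists2 a, adjV u a & edge_on e u a.
Proof.
move=> ee eu; have [b [k [eb _]]] := edge_cornerP ee eu.
by exists (crnV (flip b k)); [exists e, b, k|split => //; exact: crn_cell].
Qed.

Lemma edge_sub e u a j : u <> a -> edge_on e u a -> cell j (vx u) -> cell j (vx a) ->
  cell e `<=` cell j.
Proof.
move=> ua [ee eu ea] ju ja; have [b [k [eb hw]]] := edge_cornerP ee eu.
apply: (@cell_sub _ _ b); first by rewrite eb in ju.
move=> m; rewrite (@ord_eq1 _ k m) //.
by case: (hw _ ea) => [h|h]; [case: ua|rewrite h in ja].
Qed.

Lemma nbr_in_cell i d a : adjV (@crnV i d) a -> cell i (vx a) ->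
  exists k, a = crnV (flip d k).
Proof.
move=> [j [b [k [e ->]]]] h; have [k' ek] := transfer (esym e) h.
by exists k'.
Qed.

(** A simplex of [link] is the set of all edges at u of one cell, so the cell has to be cut down to
    a single edge, or to the square in the directions k and l. *)
Lemma link_pair u a b : adjV u a -> adjV u b -> (a <> b -> exists w, sqV u a w b) ->
  forall e1 e2, edge_on e1 u a -> edge_on e2 u b -> link (vx u) [set e1; e2].
Proof.
move=> ua ub h e1 e2 h1 h2.
have na := adjV_neq ua; have nb := adjV_neq ub.
have [eab|ab] := pselect (a = b).
  subst b; have -> : e2 = e1 by exact: (edge_uniq na).
  exists e1; first by case: h1.
  apply/seteqP; split=> [e [->|->]|e [ee eu es]]; try by case: h1; split.
  have [a' ua' h'] := edge_nbr ee eu; left; apply: (edge_uniq na) => //.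
  have [_ _ /es ea'] := h'; case: (edge_other na h1 ea') => // e'.
    by case: (adjV_neq ua').
  by subst a'.
have [w [i [c [k [l [kl eu ea _ eb]]]]]] := h ab.
have [c0 [ec0 _ ci]] := dface_ex c (mem [:: k; l]).
have cin d : cell c0 (crn d) <-> forall m, ~~ (m \in [:: k; l]) -> d m = c m.
  by rewrite ec0; apply: iff_trans (chart_face _ (ptv_cube _)) (dface_ptv _ _ _).
have cu : cell c0 (vx u) by rewrite eu; apply/cin.
have ca : cell c0 (vx a).
  by rewrite ea; apply/cin => m; rewrite !inE negb_or => /andP[h' _]; rewrite flip_other.
have cb : cell c0 (vx b).
  by rewrite eb; apply/cin => m; rewrite !inE negb_or => /andP[_ h']; rewrite flip_other.
exists c0 => //; apply/seteqP; split=> [e [->|->]|e [ee eu' es]].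
- by split; [case: h1|case: h1|exact: edge_sub na h1 cu ca].
- by split; [case: h2|case: h2|exact: edge_sub nb h2 cu cb].
have [a' ua' h'] := edge_nbr ee eu'.
have [_ _ /es ca'] := h'; have ua2 : adjV (crnV c) a' by rewrite -eu.
have [m em] := nbr_in_cell ua2 (ci _ ca').
have : m \in [:: k; l].
  apply/negPn/negP => nm; have := proj1 (cin (flip c m)); rewrite em in ca'.
  by move=> /(_ ca' m nm); rewrite flip_self; case: (c m).
rewrite !inE => /orP[/eqP mk|/eqP ml]; [left|right].
  by apply: (edge_uniq na) => //; rewrite ea -mk -em.
by apply: (edge_uniq nb) => //; rewrite eb -ml -em.
Qed.

(** The flag condition in terms of neighbours. The last clause, that the cell has no further edge at
    u, is what lets [diagonal_cell] build a cell with prescribed directions. *)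
Lemma flag_cube u (l : seq vert) : flag (link (vx u)) ->
  (forall a, List.In a l -> adjV u a) ->
  (forall a b, List.In a l -> List.In b l -> a <> b -> exists w, sqV u a w b) ->
  exists i d, [/\ u = @crnV i d, forall a, List.In a l -> exists k, a = crnV (flip d k) &
    forall k, List.In (crnV (flip d k)) l].
Proof.
move=> F h1 h2.
pose S l : set (cell_index X) := [set e | is_edge e /\ cell e (vx u) /\
   exists a, List.In a l /\ cell e (vx a)].
have fS : finite_set (S l).
  elim: (l) h1 => [|a l' IH] h1.
    by apply: (sub_finite_set _ (@finite_set0 _)) => e [_ [_ [a []]]].
  have na := adjV_neq (h1 a (or_introl erefl)).
  have [e0 he0] := adj_edge (h1 a (or_introl erefl)).
  apply: (@sub_finite_set _ _ ([set e0] `|` S l')).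
    move=> e [ee [eu [b [[<-|bl] eb]]]]; [left|right].
      by apply: (edge_uniq na).
    by split => //; split => //; exists b.
  by rewrite finite_setU; split; [exact: finite_set1|apply: IH => b bl; apply: h1; right].
have [c0 c0u eS] : link (vx u) (S l).
  apply: F => // e1 e2 [ee1 [eu1 [a [al ea]]]] [ee2 [eu2 [b [bl eb]]]].
  by apply: (link_pair (h1 a al) (h1 b bl)) => // ab; apply: h2.
have [d ed] := vertexP c0u; exists c0, d; split => //.
- move=> a al; have ua := h1 a al; have [e0 he0] := adj_edge ua.
  apply: nbr_in_cell; first by rewrite -ed.
  have : S l e0 by split; [case: he0|split; [case: he0|exists a; split => //; case: he0]].
  by rewrite eS => -[_ _]; apply; case: he0.
- move=> k; have [e [[ee ec ek] _]] := edge_ex d k.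
  have ne : u <> crnV (flip d k) by rewrite ed => /crnV_inj /esym; exact: flip_neq.
  have eon : edge_on e u (crnV (flip d k)) by rewrite ed.
  have : S l e.
    rewrite eS; split => //; first by rewrite ed.
    by apply: (edge_sub ne eon); [rewrite ed; exact: crn_cell|exact: crn_cell].
  move=> [_ [_ [a [al ea]]]]; case: (edge_other ne eon ea) => ea'; last by rewrite -ea'.
  by case: (adjV_neq (h1 a al)).
Qed.

Lemma sqV_cube u a b c ab bc ac : flag (link (vx u)) ->
  sqV u a ab b -> sqV u b bc c -> sqV u a ac c ->
  exists z, [/\ sqV a ab z ac, sqV b ab z bc & sqV c ac z bc].
Proof.
move=> F s1 s2 s3; have [||i [d [eu h _]]] := @flag_cube u [:: a; b; c] F.
- move=> x /= [<-|[<-|[<-|//]]]; first exact: sqV_adj s1.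
    exact: sqV_adj s2.
  exact: sqV_adj (sqV_flip s3).
- move=> x y /= [<-|[<-|[<-|//]]] [<-|[<-|[<-|//]]] // _.
  + by exists ab. + by exists ac. + by exists ab; exact: sqV_flip.
  + by exists bc. + by exists ac; exact: sqV_flip.
  + by exists bc; exact: sqV_flip.
have [ka ea] := h a (or_introl erefl).
have [kb eb] := h b (or_intror (or_introl erefl)).
have [kc ec] := h c (or_intror (or_intror (or_introl erefl))).
have eab := sq_in_cell s1 eu ea eb; have ebc := sq_in_cell s2 eu eb ec.
have eac := sq_in_cell s3 eu ea ec.
have nab : ka <> kb by move=> e; case: (sqV_neq s1); rewrite ea eb e.
have nbc : kb <> kc by move=> e; case: (sqV_neq s2); rewrite eb ec e.
have nac : ka <> kc by move=> e; case: (sqV_neq s3); rewrite ea ec e.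
exists (crnV (flip (flip (flip d ka) kb) kc)); split.
- by exists i, (flip d ka), kb, kc.
- exists i, (flip d kb), ka, kc; split => //; [by rewrite eab flipC|by rewrite (flipC d)].
- exists i, (flip d kc), ka, kb; split => //; first by rewrite eac flipC.
    by rewrite (flipC _ kb) (flipC d ka) .
  by rewrite ebc flipC.
Qed.

Lemma clique_dim N u (l : seq vert) (T : eqType) (w : vert -> T) :
  flag (link (vx u)) -> (forall i : cell_index X, (dim i <= N)%N) ->
  uniq [seq w a | a <- l] ->
  (forall a, List.In a l -> adjV u a) ->
  (forall a b, List.In a l -> List.In b l -> a <> b -> exists w, sqV u a w b) ->
  (size l <= N)%N.
Proof.
move=> F dN ul h1 h2; have [i [d [eu h _]]] := flag_cube F h1 h2.
have [ks eks] : exists ks : seq 'I_(dim i), l = [seq crnV (flip d k) | k <- ks].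
  elim: (l) h => [|a l' IH] h; first by exists [::].
  have [k ek] := h a (or_introl erefl).
  have [ks eks] := IH (fun b bl => h b (or_intror bl)).
  by exists (k :: ks); rewrite /= -ek -eks.
move: ul; rewrite eks -map_comp size_map => /map_uniq uk.
by apply: leq_trans (dN i); rewrite -[X in (_ <= X)%N]card_ord -(card_uniqP uk) max_card.
Qed.

(** In a square, a corner off the edge e differs from u in the direction l other than that of e;
    this leaves two corners for e', those facing u and a. *)
Lemma opposite_sq e e' u a : opposite_in_square e e' -> edge_on e u a -> u <> a ->
  exists u' a', edge_on e' u' a' /\ sqV u u' a' a.
Proof.
move=> [ee ee' [c [dc ec ec' dj]]] h ua.
have [d ed] : exists d, u = @crnV c d by apply: vertexP; apply: ec; case: h.
have [_ eu ea] := h.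
have ua1 : adjV (crnV d) a.
  have [a' ua' h'] := edge_nbr ee eu; rewrite -ed.
  by case: h' => _ _ /(edge_other ua h) [e1|<- //]; case: (adjV_neq ua').
have [k ek] := nbr_in_cell ua1 (ec _ ea).
have [u' eu'] : exists u', cell e' (vx u').
  by exists (@crnV e' (fun=> false)); exact: crn_cell.
have [d' ed'] := vertexP (ec' _ eu').
have out z : cell e z -> ~ cell e' z.
  by move=> h1 h2; have : (cell e `&` cell e') z by []; rewrite dj.
have ucrn (f : 'I_(dim c) -> bool) : cell e' (crn f) -> exists m, m <> k /\ f m <> d m.
  move=> ef; apply: contrapT => no.
  have same m : m <> k -> f m = d m.
    by move=> mk; apply: contrapT => ne; apply: no; exists m.
  have [e1|/eqP ne] := eqVneq (f k) (d k).
    apply: (out (vx u)); first by case: h.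
    rewrite ed /=; suff -> : d = f by [].
    by apply/funext => m; have [->//|/eqP mk] := eqVneq m k; rewrite same.
  apply: (out (vx a)); first by case: h.
  rewrite ek /=; suff -> : flip d k = f by [].
  apply/funext => m; rewrite /flip; case: eqP => [->|mk]; last by rewrite same.
  by move: ne; case: (f k); case: (d k).
have [l [lk dl]] : exists m, m <> k /\ d' m <> d m.
  by apply: ucrn; rewrite ed' in eu'.
have alll m : m <> k -> m = l by move=> mk; apply: ord_two dc mk lk.
have inl f : cell e' (@crn c f) -> f = flip d l \/ f = flip (flip d k) l.
  move=> /ucrn [m [mk fm]]; have e1 := alll m mk; subst m.
  have fl : f l = ~~ d l by move: fm; case: (f l); case: (d l).
  have [e2|/eqP ne] := eqVneq (f k) (d k); [left|right]; apply/funext => m;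
    have [->|/eqP mk2] := eqVneq m k; rewrite ?(alll m mk2).
  - by rewrite flip_other //; apply/eqP => kl; apply: lk.
  - by rewrite flip_self.
  - rewrite flip_other ?flip_self; last by apply/eqP => kl; apply: lk.
    by move: ne; case: (f k); case: (d k).
  - by rewrite flip_self flip_other //; apply/eqP.
have [a' ua' h'] := edge_nbr ee' eu'; have nua' := adjV_neq ua'.
have [da' eda'] : exists d, a' = @crnV c d by apply: vertexP; apply: ec'; case: h'.
have kl : k <> l by move=> e1; apply: lk.
have ok : edge_on e' (crnV (flip d l)) (crnV (flip (flip d k) l)).
  have h1 : cell e' (@crn c d') by rewrite ed' in eu'.
  have h2 : cell e' (@crn c da') by rewrite eda' in h'; case: h'.
  have ne : d' <> da' by move=> e1; apply: nua'; rewrite ed' eda' e1.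
  split => //=; case: (inl _ h1) (inl _ h2) => e1 [] e2; rewrite e1 e2 in ne h1 h2 *;
    by rewrite ?h1 ?h2 //; case: ne.
exists (crnV (flip d l)), (crnV (flip (flip d k) l)); split => //.
by exists c, d, l, k; split => //; rewrite flipC.
Qed.

Lemma sq_opposite u u' a' a e e' : sqV u u' a' a -> edge_on e u a -> edge_on e' u' a' ->
  opposite_in_square e e'.
Proof.
move=> [i [c [l [k [lk eu eu' ea' ea]]]]] h h'.
have [ee _ _] := h; have [ee' _ _] := h'; split => //.
have [c0 [ec0 dc0 ci]] := dface_ex c (mem [:: l; k]).
have cin d : cell c0 (crn d) <-> forall m, ~~ (m \in [:: l; k]) -> d m = c m.
  by rewrite ec0; apply: iff_trans (chart_face _ (ptv_cube _)) (dface_ptv _ _ _).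
have inn d : (forall m, m <> l -> m <> k -> d m = c m) -> cell c0 (crn d).
  by move=> hd; apply/cin => m; rewrite !inE negb_or => /andP[/eqP m1 /eqP m2]; exact: hd.
have cu : cell c0 (vx u) by rewrite eu; apply: inn.
have cu' : cell c0 (vx u').
  by rewrite eu'; apply: inn => m /eqP m1 _; rewrite flip_other.
have ca : cell c0 (vx a).
  by rewrite ea; apply: inn => m _ /eqP m1; rewrite flip_other.
have ca' : cell c0 (vx a').
  by rewrite ea'; apply: inn => m /eqP m1 /eqP m2; rewrite !flip_other.
have ua : u <> a by rewrite eu ea => /crnV_inj /esym; exact: flip_neq.
have u'a' : u' <> a' by rewrite eu' ea' => /crnV_inj /esym; exact: flip_neq.
exists c0; split.
- by rewrite dc0; apply/card_uniqP; rewrite /= inE andbT; apply/eqP.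
- exact: edge_sub ua h cu ca.
- exact: edge_sub u'a' h' cu' ca'.
(* Disjointness of the two edges as point sets: the coordinate l is constant along each of them,
   with different values. *)
have side f v w (d : 'I_(dim i) -> bool) : v <> w -> edge_on f v w -> v = crnV d ->
    w = crnV (flip d k) -> forall x, unit_cube x -> cell f (chart i x) -> x 0 l = (d l)%:R.
  move=> vw [ef fv fw] ev ew x cx fx.
  have [s hs] := inter_face (crn_cell d) (j := f) (eq_ind v (fun z => cell f (vx z)) fv _ ev).
  rewrite ev in fv; rewrite ew in fw.
  have sl : s l = Some (d l).
    case sl : (s l) => [b|].
      by have := proj1 (face_ptv s d) (proj1 (hs _ (ptv_cube d)) fv) l b sl => ->.
    have sk : s k = None.
      case sk : (s k) => [b|//].
      have := proj1 (face_ptv s d) (proj1 (hs _ (ptv_cube d)) fv) k b sk.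
      have := proj1 (face_ptv s _) (proj1 (hs _ (ptv_cube (flip d k))) fw) k b sk.
      by rewrite flip_self => <-; case: (d k).
    have fl : cell f (crn (flip d l)).
      apply/hs; first exact: ptv_cube.
      apply/face_ptv => m b sm; have [ml|ml] := eqVneq m l; first by rewrite ml sl in sm.
      rewrite flip_other //.
      exact: (proj1 (face_ptv s d) (proj1 (hs _ (ptv_cube d)) fv) m b sm).
    have := edge_other vw (And3 ef _ _) (w := crnV (flip d l)) fl.
    rewrite ev ew => /(_ fv fw) [/crnV_inj /flip_neq //|/crnV_inj /flip_inj lk'].
    by case: lk.
  by case: (proj1 (hs x cx) fx) => _; apply.
apply/seteqP; split => // p [ep ep'].
have [x cx xp] : cell i p by apply: ci; apply: (edge_sub ua h cu ca).
have k1 := side e u a c ua h eu ea x cx; rewrite xp in k1.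
have k2 := side e' u' a' (flip c l) u'a' h' eu' ea' x cx; rewrite xp in k2.
have := etrans (esym (k1 ep)) (k2 ep'); rewrite flip_self => /eqP.
by case: (c l) => /=; rewrite ?oner_eq0 // eq_sym oner_eq0.
Qed.
End Cells.

(** * Homotopies of edge paths *)

Section Stars.
Context {R : realType} (X : cubeComplex R).
Implicit Types (i j : cell_index X) (p q : X) (u v w : vert X).

(** If the common face fixes the coordinate k, the point and the corner b agree in it and the
    distance is 0; otherwise k is also a direction of j, and [cdistE] compares the distances. *)
Lemma cdist_transfer i j x y (b : 'I_(dim i) -> bool) (b' : 'I_(dim j) -> bool) k :
  unit_cube x -> unit_cube y -> chart i x = chart j y -> @crnV R X i b = crnV b' ->
  cdist b k x = 0 \/
  exists k', @crnV R X i (flip b k) = crnV (flip b' k') /\ cdist b k x = cdist b' k' y.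
Proof.
move=> cx cy exy eb.
have [s hs] := inter_face (cellI (X := X) cx) (j := j) (eq_ind_r (cell j) (cellI cy) exy).
have jb : cell j (@crn R X i b).
  by move/(congr1 (@vx R X)): eb => /= ->; exact: crn_cell.
have sb := proj1 (face_ptv s b) (proj1 (hs _ (ptv_cube b)) jb).
have [_ sx] := proj1 (hs x cx) (eq_ind_r (cell j) (cellI cy) exy).
case sk : (s k) => [c|].
  by left; apply/cdist_eq0; rewrite (sx _ _ sk) (sb _ _ sk).
have [|k' ek] := transfer (k := k) eb.
  apply/hs; first exact: ptv_cube.
  apply/face_ptv => m c sm; rewrite flip_other ?(sb m c) //.
  by apply: contraPneq sm => ->; rewrite sk.
right; exists k'; split => //; rewrite !cdistE; congr ((_ - _ + _) / _).
  apply: ed_chart => //; try exact: ptv_cube.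
  by move/(congr1 (@vx R X)): eb.
apply: ed_chart => //; try exact: ptv_cube.
by move/(congr1 (@vx R X)): ek.
Qed.

(** For r < 1 this is a neighbourhood of v in its open star: every cell through p has v as a corner.
    Radius 1/2 is always enough to find such a v, and it leaves less than 1/2 for moving p along a
    string. *)
Definition near_vertex (r : R) v p := exists i x b,
  [/\ unit_cube x, chart i x = p, v = @crnV R X i b & forall k, cdist b k x <= r].

Lemma near_vertex_ex p : exists v, near_vertex (1 / 2) v p.
Proof.
have [i [x cx xp]] := chart_cover R X p.
exists (@crnV R X i (fun k => 1 / 2 <= x 0 k)), i, x, (fun k => 1 / 2 <= x 0 k).
by split => // k; rewrite /cdist; case: ifPn; [|rewrite -ltNge]; lra.
Qed.

Lemma near_vertex_cell r v p j : r < 1 -> near_vertex r v p -> cell j p -> cell j (vx v).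
Proof.
move=> r1 [i [x [b [cx xp -> h]]]] jp; rewrite -xp in jp.
have [s hs] := inter_face (cellI cx) jp.
apply/hs; first exact: ptv_cube.
have [_ sx] := proj1 (hs x cx) jp.
apply/face_ptv => k c sk; have := h k; rewrite /cdist (sx _ _ sk).
by case: (b k); case: c {sk} => //=; lra.
Qed.

Lemma near_vertex_step r v p q l : 0 <= r -> r < 1 -> near_vertex r v p -> step p q l ->
  near_vertex (r + l) v q.
Proof.
move=> r0 r1 nv [j [y [z [cy cz ep eq le]]]].
have jv : cell j (vx v) by apply: near_vertex_cell r1 nv _; rewrite -ep; exact: cellI.
have [i [x [b [cx xp ev h]]]] := nv; have [b' ev'] := vertexP jv.
exists j, z, b'; split => // k.
have h1 : cdist b' k y <= r.
  have e1 : chart j y = chart i x by rewrite xp.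
  have e2 : crnV b' = crnV b by rewrite -ev -ev'.
  by have [->|[k' [_ ->]]] := cdist_transfer k cy cx e1 e2.
have h2 := ed_coord y z k; rewrite -(cdist_sub b') -le in h2.
have := ler_norm (cdist b' k z - cdist b' k y); rewrite distrC; lra.
Qed.

Lemma step_ge0 p q l : step p q l -> 0 <= l.
Proof. by move=> [i [x [y [_ _ _ _ ->]]]]; exact: ed_ge0. Qed.

Lemma string_ge0 p q l : string p q l -> 0 <= l.
Proof. by elim=> // p1 q1 r l1 m /step_ge0 h _ h2; exact: addr_ge0. Qed.

Lemma near_vertex_string r v p q l : 0 <= r -> r + l < 1 -> near_vertex r v p ->
  string p q l -> near_vertex (r + l) v q.
Proof.
move=> r0 + + s; elim: s r r0 => {p q l} [p|p q q' l m st sq IH] r r0 rl nv.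
  by rewrite addr0.
have l0 := step_ge0 st; have m0 := string_ge0 sq.
have r1 : r < 1 by lra.
by rewrite addrA; apply: IH; [lra|lra|exact: (near_vertex_step r0 r1 nv st)].
Qed.

Lemma near_string_cell v p q l j : near_vertex (1 / 2) v p -> string p q l -> l < 1 / 2 ->
  cell j q -> cell j (vx v).
Proof.
move=> nv st l2; have rl : 1 / 2 + l < 1 by lra.
have r0 : (0 : R) <= 1 / 2 by lra.
exact: near_vertex_cell rl (near_vertex_string r0 rl nv st).
Qed.

Lemma near_vertex_self r v w : r < 1 -> near_vertex r v (vx w) -> v = w.
Proof.
move=> r1 [i [x [b [cx xw -> h]]]]; have iw : cell i (vx w) by rewrite -xw; exact: cellI.
have [b' eb'] := vertexP iw.
have xb' : x = ptv b'.
  by apply: (@chart_inj R X i); rewrite ?inE ?xw ?eb' //; exact: ptv_cube.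
rewrite eb'; congr crnV; apply/funext => k; have := h k; rewrite /cdist xb' ptvE.
by case: (b k); case: (b' k) => //=; lra.
Qed.
End Stars.

(** * Edge paths inside one cell *)

Section CellPaths.
Context {R : realType} (X : cubeComplex R).
Implicit Types (i j : cell_index X) (u v w : vert X) (s t : seq (vert X)).
Notation htp := (htp (@sqV R X)).

Lemma cons_eq T (x y : T) (s t : seq T) : x :: s = y :: t -> x = y /\ s = t.
Proof. by case. Qed.

Fixpoint wlk i (b : 'I_(dim i) -> bool) (ks : seq 'I_(dim i)) s : seq (vert X) :=
  if ks is k :: ks' then wlk (flip b k) ks' (crnV b :: s) else crnV b :: s.

Definition flips n (b : 'I_n -> bool) (ks : seq 'I_n) := foldl (@flip n) b ks.

Lemma wlk_htp i b ks s t : htp (@crnV R X i b :: s) (crnV b :: t) ->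
  htp (wlk b ks s) (wlk b ks t).
Proof. by elim: ks b s t => //= k ks IH b s t h; apply: IH; exact: htp_cons. Qed.

Lemma wlk_head i b ks s : exists t, @wlk i b ks s = crnV (flips b ks) :: t.
Proof. by elim: ks b s => [|k ks IH] b s /=; [exists s|exact: IH]. Qed.

Lemma wlk_cat i b ks ls s t : @wlk i b ks s = crnV (flips b ks) :: t ->
  wlk b (ks ++ ls) s = wlk (flips b ks) ls t.
Proof. by elim: ks b s => [|k ks IH] b s /=; [move=> [->]|exact: IH]. Qed.

Lemma flips_cat n (b : 'I_n -> bool) p q : flips b (p ++ q) = flips (flips b p) q.
Proof. exact: foldl_cat. Qed.

Lemma wlk_swap i b k l ks s : htp (@wlk i b [:: k, l & ks] s) (wlk b [:: l, k & ks] s).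
Proof.
have [->|/eqP kl] := eqVneq k l; first exact: htp_refl.
rewrite /= flipC; apply: wlk_htp; rewrite -[X in crnV X :: crnV (flip b k) :: _]flipC.
apply: htp_step (htp_refl _ _); rewrite [X in crnV X :: crnV (flip b l) :: _]flipC.
by apply: hstep_flip; exists i, b, k, l.
Qed.

Lemma wlk_cancel i b k ks s : htp (@wlk i b [:: k, k & ks] s) (wlk b ks s).
Proof.
by rewrite /= flipK; apply: wlk_htp; apply: htp_step (htp_refl _ _); exact: hstep_bt.
Qed.

Lemma wlk_move i b k p r s : htp (@wlk i b (k :: p ++ r) s) (wlk b (p ++ k :: r) s).
Proof.
elim: p b s => [|l p IH] b s; first exact: htp_refl.
exact: htp_trans (wlk_swap _ _ _ _ _) (IH _ _).
Qed.

Lemma wlk_prefix i b p r r' s :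
  (forall b s, htp (@wlk i b r s) (wlk b r' s)) -> htp (wlk b (p ++ r) s) (wlk b (p ++ r') s).
Proof. by move=> h; elim: p b s => [|k p IH] b s; [exact: h|exact: IH]. Qed.

Lemma flips_notin n (b : 'I_n -> bool) ks k : k \notin ks -> flips b ks k = b k.
Proof.
elim: ks b => //= l ks IH b; rewrite inE negb_or => /andP[kl /IH ->].
by rewrite flip_other.
Qed.

Lemma flips_move n (b : 'I_n -> bool) k p r : flips b (k :: p ++ r) = flips b (p ++ k :: r).
Proof. by elim: p b => //= l p IH b; rewrite -IH /= flipC. Qed.

(** Directions of a cube behave like commuting involutions: in a closed path the first direction
    occurs again, can be moved next to that occurrence across squares, and cancels. *)
Lemma wlk_closed i b ks s : flips b ks = b -> htp (@wlk i b ks s) (crnV b :: s).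
Proof.
have [n] := ubnP (size ks); elim: n b ks s => // n IH b [|k ks] s /= sz e.
  exact: htp_refl.
have kin : k \in ks.
  apply: contraPT (congr1 (fun f => f k) e) => nk.
  by rewrite flips_notin // flip_self; case: (b k).
case/splitPr: kin sz e => p q sz e.
apply: htp_trans (wlk_move _ _ _ (k :: q) _) _.
apply: htp_trans (wlk_prefix _ _ _ (r' := q) _) _ => [b' s'|].
  exact: wlk_cancel.
apply: IH; first by move: sz; rewrite !size_cat /=; lia.
rewrite -[RHS]e -/(flips _ _) (_ : flips (flip b k) (p ++ k :: q) = flips b (k :: p ++ k :: q)) //.
by rewrite flips_move !flips_cat /= flipK.
Qed.

Lemma flips_rev n (b : 'I_n -> bool) ks : flips (flips b ks) (rev ks) = b.
Proof.
elim: ks b => //= k ks IH b.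
by rewrite rev_cons -cats1 flips_cat IH /= flipK.
Qed.

Lemma wlk_uniq i b ks ls s : flips b ks = flips b ls -> htp (@wlk i b ks s) (wlk b ls s).
Proof.
move=> e; have [t et] := wlk_head b ks s; have [t' et'] := wlk_head b (ks ++ rev ks) s.
apply: (@htp_trans _ _ _ (wlk b (ks ++ (rev ks ++ ls)) s)).
  rewrite (wlk_cat _ et) et; apply: htp_sym; apply: wlk_closed.
  by rewrite flips_cat flips_rev -e.
rewrite catA (wlk_cat _ et') flips_cat flips_rev; apply: wlk_htp.
rewrite -[X in crnV X :: t'](flips_rev b ks) -flips_cat -et'; apply: wlk_closed.
by rewrite flips_cat flips_rev.
Qed.

Lemma flips_ex2 n (b b' : 'I_n -> bool) :
  exists2 ks, flips b ks = b' & forall k, k \in ks -> b k != b' k.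
Proof.
exists (enum [pred k | b k != b' k]); last by move=> k; rewrite mem_enum.
apply/funext => k.
have main (ks : seq 'I_n) (c : 'I_n -> bool) : uniq ks ->
    flips c ks k = if k \in ks then ~~ c k else c k.
  elim: ks c => //= l ks IH c /andP[nl uk]; rewrite IH // inE.
  have [->|ne] := eqVneq k l; first by rewrite (negPf nl) flip_self.
  by rewrite flip_other.
rewrite main ?enum_uniq // mem_enum inE /=.
by case: (b k); case: (b' k).
Qed.

Lemma flips_ex n (b b' : 'I_n -> bool) : exists ks, flips b ks = b'.
Proof. by have [ks] := flips_ex2 b b'; exists ks. Qed.

(* t extends the path s by an edge path in the cell j *)
Definition cext j s t := exists b ks s', s = @crnV R X j b :: s' /\ t = wlk b ks s'.

Lemma cext_ex j u w s : cell j (vx u) -> cell j (vx w) -> exists t, cext j (u :: s) (w :: t).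
Proof.
move=> /vertexP [b ->] /vertexP [b' ->]; have [ks e] := flips_ex b b'.
have [t et] := wlk_head b ks s; exists t, b, ks, s; split => //.
by rewrite et e.
Qed.

Lemma cext_trans j s t r : cext j s t -> cext j t r -> cext j s r.
Proof.
move=> [b [ks [s' [es et]]]] [b1 [ls [t' [et1 er]]]].
have [t2 et2] := wlk_head b ks s'.
have e : crnV (flips b ks) :: t2 = crnV b1 :: t' by rewrite -et2 -et -et1.
have e1 := crnV_inj (congr1 (head (crnV b1)) e); have e2 : t2 = t' := congr1 behead e.
by exists b, (ks ++ ls), s'; split => //; rewrite (wlk_cat _ et2) e1 e2.
Qed.

Lemma cext_htp j u s s' t : htp (u :: s) (u :: s') -> cext j (u :: s) t ->
  exists2 t', cext j (u :: s') t' & htp t t' /\ forall x, head x t = head x t'.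
Proof.
move=> h [b [ks [s1 [e1 et]]]]; have [eu es] := cons_eq e1; subst s1.
exists (wlk b ks s'); first by exists b, ks, s'; rewrite eu.
rewrite et; split; first by apply: wlk_htp; rewrite eu in h.
by move=> x; have [t1 ->] := wlk_head b ks s; have [t2 ->] := wlk_head b ks s'.
Qed.

Lemma cext_uniq1 j s w t t' : cext j s (w :: t) -> cext j s (w :: t') -> htp (w :: t) (w :: t').
Proof.
move=> [b [ks [s1 [es et]]]] [b' [ls [s2 [es' et']]]].
rewrite es in es'; have [/crnV_inj eb e2] := cons_eq es'; subst b' s2.
rewrite et et'; apply: wlk_uniq; apply: crnV_inj.
have [t1 e1] := wlk_head b ks s1; have [t2 e2] := wlk_head b ls s1.
by rewrite e1 in et; rewrite e2 in et'; have [<- _] := cons_eq et; have [<- _] := cons_eq et'.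
Qed.

Lemma cext_sub i j s t : cell i `<=` cell j -> cext i s t -> cext j s t.
Proof.
move=> ij [b [ks [s' [-> ->]]]].
elim: ks b s' => [|k ks IH] b s' /=.
  have [b' eb] := vertexP (v := crnV b) (ij _ (@crn_cell R X i b)).
  by exists b', [::], s'; rewrite /= -eb.
have [b' eb] := vertexP (v := crnV b) (ij _ (@crn_cell R X i b)).
apply: cext_trans (IH _ _).
have [k' ek] := transfer (k := k) eb (ij _ (@crn_cell R X i (flip b k))).
by exists b', [:: k'], s'; rewrite /= -ek -eb.
Qed.

Lemma cell_inter i j p : cell i p -> cell j p -> exists c, cell c = cell i `&` cell j.
Proof.
move=> ip jp; have [s hs] := inter_face ip jp.
have [c ec] := face_closed R X i s; exists c; rewrite /cell ec; apply/seteqP; split.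
  by move=> _ [x [cx sx] <-]; split; [exact: cellI|apply/hs].
move=> _ [[x cx <-] h]; exists x => //; exact/hs.
Qed.

(** The two cells meet in a cell containing both ends, and a path in that cell can be compared with
    both given ones. *)
Lemma cext_uniq i j u w s t t' : cext i (u :: s) (w :: t) -> cext j (u :: s) (w :: t') ->
  htp (w :: t) (w :: t').
Proof.
move=> h1 h2.
have hu k r : cext k (u :: s) (w :: r) -> cell k (vx u) /\ cell k (vx w).
  move=> [b [ks [s1 [e1 e2]]]]; have [t1 e3] := wlk_head b ks s1; rewrite e3 in e2.
  by have [-> _] := cons_eq e1; have [-> _] := cons_eq e2; split; exact: crn_cell.
have [iu iw] := hu _ _ h1; have [ju jw] := hu _ _ h2.
have [c ec] := cell_inter iu ju.
have [|| r hr] := @cext_ex c u w s; [by rewrite ec|by rewrite ec|].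
apply: (htp_trans (t := w :: r)).
  by apply: (cext_uniq1 h1); apply: cext_sub hr; rewrite ec => z [].
by apply: (@cext_uniq1 j) h2; apply: cext_sub hr; rewrite ec => z [].
Qed.
End CellPaths.

(** * Grids of vertices and sampled paths *)

Section Grid.
Context {R : realType} (X : cubeComplex R).
Implicit Types (i j : cell_index X) (u v w : vert X) (s t : seq (vert X)).
Notation htp := (htp (@sqV R X)).
Notation cext := (@cext R X).

(** The path inside the cell is not recorded: by [mv_uniq] neither it nor the cell matters up to
    homotopy. *)
Definition mv s t := exists c, cext c s t.

Lemma mv_refl u s : mv (u :: s) (u :: s).
Proof.
have [i _ iu] := svalP u; have [b eb] := vertexP iu.
by exists i, b, [::], s; rewrite eb.
Qed.

Lemma mv_uniq u w s t t' : mv (u :: s) (w :: t) -> mv (u :: s) (w :: t') ->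
  htp (w :: t) (w :: t').
Proof. by move=> [c h] [c' h']; exact: cext_uniq h h'. Qed.

Lemma mv_htp u w s s' t t' : htp (u :: s) (u :: s') -> mv (u :: s) (w :: t) ->
  mv (u :: s') (w :: t') -> htp (w :: t) (w :: t').
Proof.
move=> h [c hc] [c' hc']; have [r hr [hr1 hr2]] := cext_htp h hc.
case: r hr hr1 hr2 => [|w' r] hr hr1 hr2.
  by have [i0 _ _] := svalP u; have [b [ks [s1 [_ e]]]] := hr;
     have [t1 e1] := wlk_head b ks s1; rewrite e1 in e.
have := hr2 w => /= e; subst w'.
by apply: htp_trans hr1 _; exact: cext_uniq hr hc'.
Qed.

Definition chain (w : nat -> vert X) n (s : nat -> seq (vert X)) :=
  forall k, (k < n)%N -> mv (w k :: s k) (w k.+1 :: s k.+1).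

Lemma chain_ex (w : nat -> vert X) n s0 :
  (forall k, (k < n)%N -> exists c, cell c (vx (w k)) /\ cell c (vx (w k.+1))) ->
  exists2 s, chain w n s & s 0%N = s0.
Proof.
move=> h.
have ex k (s : seq (vert X)) : exists t, (k < n)%N -> mv (w k :: s) (w k.+1 :: t).
  have [kn|_] := ltnP k n; last by exists [::].
  have [c [c1 c2]] := h k kn; have [t ht] := cext_ex s c1 c2.
  by exists t => _; exists c.
pose f := fix f k := if k is k'.+1 then sval (cid (ex k' (f k'))) else s0.
by exists f => // k kn; exact: (svalP (cid (ex k (f k))) kn).
Qed.

(** Induction on the columns: the first row up to column k, followed by the rung, is homotopic to
    the second row up to k, since each mesh square lies in a single cell. *)
Lemma chain_row (w z : nat -> vert X) n (s t : nat -> seq (vert X)) : chain w n s -> chain z n t ->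
  (forall k, (k < n)%N -> exists c, [/\ cell c (vx (w k)), cell c (vx (w k.+1)),
     cell c (vx (z k)) & cell c (vx (z k.+1))]) ->
  w 0%N = z 0%N -> htp (w 0%N :: s 0%N) (z 0%N :: t 0%N) -> w n = z n ->
  htp (w n :: s n) (z n :: t n).
Proof.
move=> cs ct h e0 h0 en.
suff key k : (k <= n)%N -> forall r, mv (w k :: s k) (z k :: r) -> htp (z k :: r) (z k :: t k).
  by rewrite {1}en; apply: key => //; rewrite -en; exact: mv_refl.
elim: k => [_|k IH kn] r hr.
  rewrite -e0 in hr h0 *; apply: htp_trans h0.
  by apply: mv_uniq hr _; exact: mv_refl.
have [c [c1 c2 c3 c4]] := h k kn.
have [r0 hr0] := cext_ex (s k) c1 c3; have [r1 hr1] := cext_ex r0 c3 c4.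
have h1 := IH (ltnW kn) r0 (ex_intro _ c hr0).
have h2 := mv_htp h1 (ex_intro _ c hr1) (ct k kn).
apply: htp_trans h2.
have [p hp] := cext_ex (s k) c1 c2; have [p2 hp2] := cext_ex p c2 c4.
have h3 := mv_uniq (ex_intro _ c hp) (cs k kn).
apply: (htp_trans (t := z k.+1 :: p2)).
  apply: mv_htp (htp_sym h3) hr _; by exists c.
exact: cext_uniq1 (cext_trans hp hp2) (cext_trans hr0 hr1).
Qed.

(** Induction on the rows, starting from the last one, which is constant. *)
Lemma grid_trivial (w : nat -> nat -> vert X) n m (s : nat -> seq (vert X)) :
  (forall k l, (k < n)%N -> (l < m)%N -> exists c, [/\ cell c (vx (w k l)),
     cell c (vx (w k.+1 l)), cell c (vx (w k l.+1)) & cell c (vx (w k.+1 l.+1))]) ->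
  (forall l, (l <= m)%N -> w 0%N l = w 0%N 0%N /\ w n l = w 0%N 0%N) ->
  (forall k, (k <= n)%N -> w k m = w 0%N 0%N) -> (0 < m)%N ->
  chain (w^~ 0%N) n s -> s 0%N = [::] -> htp (w n 0%N :: s n) [:: w 0%N 0%N].
Proof.
move=> h h0 hm m0 cs s0.
suff key l : (l <= m)%N -> forall t : nat -> seq (vert X), chain (w^~ (m - l)%N) n t -> t 0%N = [::] ->
    htp (w n (m - l)%N :: t n) [:: w 0%N 0%N].
  by have := key m (leqnn m) s; rewrite subnn; apply.
elim: l => [_|l IH lm] t ct t0.
  rewrite subn0 in ct *; rewrite hm //.
  suff hk k : (k <= n)%N -> htp (w 0%N 0%N :: t k) [:: w 0%N 0%N] by exact: hk.
  elim: k => [_|k IH kn]; first by rewrite t0; exact: htp_refl.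
  apply: htp_trans (IH (ltnW kn)); apply: htp_sym.
  have := ct k kn; rewrite !hm //; last exact: ltnW.
  by apply: mv_uniq; exact: mv_refl.
have e : (m - l = (m - l.+1).+1)%N by rewrite -subSn.
have lm' : (m - l.+1 < m)%N by lia.
have [|t' ct' t0'] := @chain_ex (w^~ (m - l)%N) n [::].
  move=> k kn; have [c [c1 c2 c3 c4]] := h k _ kn lm'.
  by exists c; rewrite e.
have := IH (ltnW lm) t' ct' t0'; apply: htp_trans.
have [e1 e2] := h0 (m - l.+1)%N (leq_subr _ _); have [e3 e4] := h0 (m - l)%N (leq_subr _ _).
rewrite e2 e4.
have := @chain_row (w^~ (m - l.+1)%N) (w^~ (m - l)%N) n t t' ct ct'.
rewrite /= e2 e4; apply => //; last by rewrite t0 t0' e1 e3; exact: htp_refl.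
  by move=> k kn; have [c hc] := h k _ kn lm'; exists c; rewrite e.
by rewrite e1 e3.
Qed.

Definition nv p : vert X := sval (cid (near_vertex_ex p)).

Lemma nvP p : near_vertex (1 / 2) (nv p) p.
Proof. exact: (svalP (cid (near_vertex_ex p))). Qed.

Lemma nv_cell p q l c : string p q l -> l < 1 / 2 -> cell c q -> cell c (vx (nv p)).
Proof. by apply: near_string_cell; exact: nvP. Qed.

Lemma nv_cell0 p c : cell c p -> cell c (vx (nv p)).
Proof. by apply: (nv_cell (string_nil _)); lra. Qed.

Lemma nv_vertex v : nv (vx v) = v.
Proof. by apply: near_vertex_self (nvP _); lra. Qed.

Lemma edge_path u a : adjV u a -> exists c (ep : R -> X), [/\ ep 0 = vx u, ep 1 = vx a,
  forall s t : R, 0 <= s <= 1 -> 0 <= t <= 1 -> step (ep s) (ep t) `|s - t|,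
  forall t : R, 0 <= t <= 1 -> cell c (ep t) &
  forall s, cext c (u :: s) (a :: u :: s)].
Proof.
move=> [i [b [k [-> ->]]]].
pose pt (t : R) : 'rV[R]_(dim i) := \row_l (if l == k then (if b k then 1 - t else t) else (b l)%:R).
have cpt (t : R) : 0 <= t <= 1 -> unit_cube (pt t).
  move=> ht l; rewrite mxE; case: eqP => _; first by case: (b k); lra.
  by case: (b l); rewrite /= ?lexx ?ler01.
exists i, (fun t : R => chart i (pt t)); split.
- rewrite /= /crn; congr chart; apply/rowP => l; rewrite !mxE.
  by case: eqP => // ->; case: (b k) => //=; rewrite subr0.
- rewrite /= /crn; congr chart; apply/rowP => l; rewrite !mxE /flip.
  by case: eqP => // ->; case: (b k) => //=; rewrite subrr.
- move=> s t hs ht; exists i, (pt s), (pt t); split => //; try exact: cpt.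
  rewrite -sqrtr_sqr; congr Num.sqrt; rewrite (bigD1 k) //= big1 ?addr0.
    by rewrite !mxE eqxx; case: (b k) => //; lra.
  by move=> l lk; rewrite !mxE (negPf lk) subrr expr0n.
- by move=> t ht; exact/cellI/cpt.
- by move=> s; exists b, [:: k], s.
Qed.

(** The path is traversed at unit speed, from [last v C] because lists run backwards. The last
    clause compares C with the vertices nearest to q samples per edge: along an edge they all belong
    to its cell. *)
Lemma path_param v C : gpath (@adjV R X) (v :: C) -> exists g : R -> X,
  [/\ g 0 = vx (last v C), g (size C)%:R = vx v,
    forall s t : R, 0 <= s -> s <= t -> t <= (size C)%:R -> string (g s) (g t) (t - s) &
    forall q (sg : nat -> seq (vert X)), (0 < q)%N ->
      chain (fun k : nat => nv (g (k%:R / q%:R))) (size C * q) sg -> sg 0%N = [::] ->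
      htp (v :: C) (v :: sg (size C * q)%N)].
Proof.
elim: C v => [|w D IH] v /=.
  move=> _; exists (fun=> vx v); split => //.
    move=> s t s0 st t0; have -> : t - s = 0 by apply/eqP; rewrite subr_eq0; lra.
    exact: string_nil.
  by move=> q sg q0 _; rewrite mul0n => ->; exact: htp_refl.
move=> [wv gD]; have [gd [g0 gm gs gh]] := IH w gD.
have [c [ep [ep0 ep1 est ec ext]]] := edge_path wv.
set m : R := (size D)%:R in gm gs; have m0 : 0 <= m by exact: ler0n.
pose g (t : R) := if t <= m then gd t else ep (t - m).
have gle (t : R) : t <= m -> g t = gd t by rewrite /g => ->.
have gge (t : R) : m <= t -> g t = ep (t - m).
  by rewrite /g le_eqVlt => /orP[/eqP <-|tm]; [rewrite lexx subrr ep0|rewrite leNgt tm].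
have em : (size D).+1%:R = m + 1 :> R by rewrite -natr1.
exists g; split.
- by rewrite gle.
- by rewrite gge em; [rewrite addrAC subrr add0r|lra].
- move=> s t s0 st; rewrite em => tm.
  have est' a b : m <= a -> a <= b -> b <= m + 1 -> string (g a) (g b) (b - a).
    move=> h1 h2 h3; rewrite !gge; [|lra|lra].
    have := est (a - m) (b - m); rewrite (_ : a - m - (b - m) = a - b); last by lra.
    rewrite distrC ger0_norm; last by lra.
    move=> h; rewrite -[b - a]addr0; apply: string_cons (string_nil _); apply: h; lra.
  have [tm'|mt] := leP t m; first by rewrite !gle //; [apply: gs|lra].
  have [sm|ms] := leP s m; last by apply: est'; lra.
  have -> : t - s = (m - s) + (t - m) by lra.
  apply: (@string_cat _ _ _ (g m)); last by apply: est'; lra.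
  by rewrite !gle //; apply: gs.
- move=> q sg q0 csg sg0.
  have qR : 0 < q%:R :> R by rewrite ltr0n.
  have hD : htp (w :: D) (w :: sg (size D * q)%N).
    apply: gh => // k kn; have := csg k _; rewrite mulSn => /(_ _).
    have e1 (k' : nat) : (k' <= size D * q)%N -> g (k'%:R / q%:R) = gd (k'%:R / q%:R).
      move=> jq; apply: gle; rewrite ler_pdivrMr // -natrM ler_nat //.
    rewrite !e1 //; last exact: ltnW.
    by apply; lia.
  have pos k : (k <= q)%N -> [/\ g ((size D * q + k)%:R / q%:R) = ep (k%:R / q%:R),
       (0 : R) <= k%:R / q%:R & k%:R / q%:R <= 1 :> R].
    move=> kq; split; last by rewrite ler_pdivrMr // mul1r ler_nat.
      have -> : (size D * q + k)%:R / q%:R = m + k%:R / q%:R.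
        by rewrite natrD natrM mulrDl mulfK // gt_eqF.
      rewrite gge; last by rewrite lerDl divr_ge0 ?ler0n // ltW.
      by rewrite addrAC subrr add0r.
    by rewrite divr_ge0 ?ler0n // ltW.
  have cw : cell c (vx w) by rewrite -ep0; apply: ec; rewrite lexx ler01.
  have key k : (k <= q)%N -> forall t, cext c (w :: D) (nv (g ((size D * q + k)%:R / q%:R)) :: t) ->
      htp (nv (g ((size D * q + k)%:R / q%:R)) :: t)
          (nv (g ((size D * q + k)%:R / q%:R)) :: sg (size D * q + k)%N).
    elim: k => [_|k IHk kq] t ht.
      have [e _ _] := pos 0%N (leq0n q).
      move: ht; rewrite e mul0r ep0 nv_vertex addn0 => ht.
      by apply: htp_trans hD; apply: mv_uniq (mv_refl _ _); exists c.
    have [e1 p1 p2] := pos k (ltnW kq); have [e2 p3 p4] := pos k.+1 kq.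
    have c1 : cell c (vx (nv (g ((size D * q + k)%:R / q%:R)))).
      by apply: nv_cell0; rewrite e1; apply: ec; rewrite p1.
    have c2 : cell c (vx (nv (g ((size D * q + k.+1)%:R / q%:R)))).
      by apply: nv_cell0; rewrite e2; apply: ec; rewrite p3.
    have [t0 ht0] := cext_ex D cw c1; have [t1 ht1] := cext_ex t0 c1 c2.
    apply: htp_trans (cext_uniq1 ht (cext_trans ht0 ht1)) _.
    apply: mv_htp (IHk (ltnW kq) _ ht0) _ _; first by exists c.
    by rewrite addnS; apply: csg; rewrite mulSn; lia.
  have [e _ _] := pos q (leqnn q).
  have eq : ((size D).+1 * q = size D * q + q)%N by rewrite mulSn addnC.
  have := key q (leqnn q); rewrite e divff ?gt_eqF // ep1 nv_vertex eq; apply.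
  exact: ext.
Qed.

(** Uniform continuity by compactness; 1/2 is the displacement that [nv_cell] tolerates, split into
    1/4 on each side of a centre. *)
Lemma square_uniform (H : R * R -> X) :
  {within `[0, 1] `*` `[0, 1], continuous H} ->
  exists2 d : R, 0 < d & forall a b : R * R, (`[0, 1] `*` `[0, 1]) a ->
    (`[0, 1] `*` `[0, 1]) b -> `|a.1 - b.1| < d -> `|a.2 - b.2| < d ->
    string_ball (H a) (1 / 2) (H b).
Proof.
move=> cH; set S := (X in {within X, continuous _}) in cH *.
have cS : compact S by apply: compact_setX; exact: segment_compact.
move/compact_near_coveringP: cS.
pose P (d : R) (a : R * R) := forall b, S a -> S b -> `|a.1 - b.1| < d -> `|a.2 - b.2| < d ->
    string_ball (H a) (1 / 2) (H b).
move=> /(_ R (0^'+) P _) [|/= d0 d0p hd].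
  move=> a Sa; move/subspace_continuousP: cH => /(_ a Sa) /cvg_ballP /(_ (1 / 4)).
  have r4 : (0 : R) < 1 / 4 by lra.
  move=> /(_ r4); rewrite near_withinE => /nbhs_ballP [e /= e0 he].
  exists (ball a (e / 2), [set d | 0 < d < e / 2]); first split.
  - have e2 : 0 < e / 2 by lra.
    exists (ball a.1 (e / 2), ball a.2 (e / 2)); last by move=> z [].
    by split; apply/nbhs_ballP; exists (e / 2).
  - have e2 : 0 < e / 2 by lra.
    near=> d; apply/andP; split; near: d; [exact: nbhs_right_gt|exact: nbhs_right_lt].
  move=> [z d] /= [[z1 z2] /andP[d0 de]] b Sz Sb h1 h2.
  have hz : string_ball (H a) (1 / 4) (H z).
    by apply: he => //; split; [apply: lt_trans z1 _|apply: lt_trans z2 _]; lra.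
  have hb : string_ball (H a) (1 / 4) (H b).
    apply: he => //; split.
      have := ler_normD (a.1 - z.1) (z.1 - b.1); move: z1; rewrite /ball /= => z1.
      by rewrite addrA subrK; lra.
    have := ler_normD (a.2 - z.2) (z.2 - b.2); move: z2; rewrite /ball /= => z2.
    by rewrite addrA subrK; lra.
  have -> : 1 / 2 = 1 / 4 + 1 / 4 :> R by lra.
  exact: string_ball_triangle (string_ball_sym hz) hb.
exists (d0 / 2); first by move: d0p => /=; lra.
move=> a b Sa Sb h1 h2; apply: (hd (d0 / 2)) => //=; last by move: d0p => /=; lra.
by rewrite sub0r normrN ger0_norm; move: d0p => /=; lra.
Unshelve. all: by end_near.
Qed.
End Grid.

(** * Combinatorial homotopies from continuous ones *)

Section Loops.
Context {R : realType} (X : cubeComplex R).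
Implicit Types (u v w : vert X).
Notation htp := (htp (@sqV R X)).
Notation gpath := (gpath (@adjV R X)).
Notation walk := (walk (@adjV R X)).

Lemma string_lipschitz_continuous (f : R -> X) (A : set R) K : 0 < K ->
  (forall s t, A s -> A t -> s <= t ->
    exists2 l, string (f s) (f t) l & l <= K * (t - s)) ->
  {within A, continuous f}.
Proof.
move=> K0 h; apply/subspace_continuousP => x Ax; apply/cvg_ballP => e e0.
rewrite near_withinE; apply/nbhs_ballP; exists (e / K); first by rewrite /= divr_gt0.
move=> y; rewrite /ball /= ltr_pdivlMr // => xy Ay.
have [le|lt] := leP x y.
  have [l hl lK] := h x y Ax Ay le; exists l => //; apply: le_lt_trans lK _.
  by move: xy; rewrite distrC ger0_norm ?subr_ge0 // mulrC.
have [l hl lK] := h y x Ay Ax (ltW lt); exists l; first exact: string_sym.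
apply: le_lt_trans lK _.
by move: xy; rewrite ger0_norm ?subr_ge0 ?(ltW lt) // mulrC.
Qed.

Lemma loop_htp u C : loops_contractible R X -> gpath (u :: C) -> last u C = u ->
  htp (u :: C) [:: u].
Proof.
move=> SC gC lC.
have [g [g0 gm gs gh]] := path_param gC; rewrite lC in g0.
set m := size C in gm gs gh.
have [m0|m0] := posnP m; first by rewrite (size0nil m0); exact: htp_refl.
have mR : 0 < m%:R :> R by rewrite ltr0n.
pose f (t : R) := g (m%:R * t).
have cf : {within `[0, 1], continuous f}.
  apply: (string_lipschitz_continuous mR) => s t /=.
  rewrite !in_itv /= => /andP[s0 s1] /andP[t0 t1] st.
  exists (m%:R * (t - s)) => //; rewrite mulrBr; apply: gs; first by rewrite mulr_ge0 // ltW.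
    by rewrite ler_pM2l.
  by rewrite ler_piMr // ltW.
have f0 : f 0 = vx u by rewrite /f mulr0.
have f1 : f 1 = vx u by rewrite /f mulr1.
have [H [cH H1 H2]] := SC f cf (etrans f0 (esym f1)).
have [d d0 hd] := square_uniform cH.
(* This makes the mesh [1 / (m * q)] smaller than d; being a multiple of the number m of edges, the
   subdivision puts q samples on each edge, as [path_param] requires. *)
pose q := (Num.bound d^-1).+1.
have qd : q%:R^-1 < d.
  rewrite -[d]invrK ltf_pV2 ?posrE ?invr_gt0 ?ltr0n //.
  apply: (lt_trans (archi_boundP _)); first by rewrite invr_ge0 ltW.
  by rewrite ltr_nat.
pose n := (m * q)%N; have n0 : (0 < n)%N by rewrite muln_gt0 m0.
have nR : 0 < n%:R :> R by rewrite ltr0n.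
have nd : n%:R^-1 < d.
  apply: le_lt_trans qd; rewrite lef_pV2 ?posrE ?ltr0n // ler_nat.
  by rewrite leq_pmull.
pose P k l := H (k%:R / n%:R, l%:R / n%:R).
have dom k : (k <= n)%N -> 0 <= k%:R / n%:R :> R /\ k%:R / n%:R <= 1 :> R.
  by move=> kn; rewrite divr_ge0 ?ler0n // ler_pdivrMr // mul1r ler_nat.
have domS k l : (k <= n)%N -> (l <= n)%N ->
    (`[0, 1] `*` `[0, 1]) (k%:R / n%:R : R, l%:R / n%:R : R).
  move=> kn ln; have [a1 a2] := dom _ kn; have [b1 b2] := dom _ ln.
  by split; rewrite /= in_itv /=; apply/andP.
have close k k' : (k <= k')%N -> (k' <= k.+1)%N -> `|k'%:R / n%:R - k%:R / n%:R| < d.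
  move=> h1 h2; rewrite -mulrBl -natrB // normrM ger0_norm ?ler0n // gtr0_norm ?invr_gt0 //.
  apply: le_lt_trans nd; rewrite ler_piMl ?invr_ge0 ?ler0n //.
  by rewrite -[X in _ <= X]/(1%:R) ler_nat; lia.
(* Any cell through [P k l] works: the other corners of the mesh square are within 1/2 of this
   point, so their nearest vertices are corners of the cell. *)
have mesh k l : (k < n)%N -> (l < n)%N -> exists c, [/\ cell c (vx (nv (P k l))),
     cell c (vx (nv (P k.+1 l))), cell c (vx (nv (P k l.+1))) & cell c (vx (nv (P k.+1 l.+1)))].
  move=> kn ln; have [c [x cx ec]] := chart_cover R X (P k l).
  have cP : cell c (P k l) by exists x.
  have near k' l' : (k <= k' <= k.+1)%N -> (l <= l' <= l.+1)%N -> cell c (vx (nv (P k' l'))).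
    move=> /andP[k1 k2] /andP[l1 l2].
    have [||||r hr rl] := hd (k'%:R / n%:R, l'%:R / n%:R) (k%:R / n%:R, l%:R / n%:R).
    - by apply: domS; [exact: leq_trans kn|exact: leq_trans ln].
    - by apply: domS; exact: ltnW.
    - exact: close.
    - exact: close.
    - exact: nv_cell hr rl cP.
  by exists c; split; apply: near; rewrite ?leqnn ?leqnSn.
have row0 k : (k <= n)%N -> P k 0%N = g (k%:R / q%:R).
  move=> kn; rewrite /P mul0r; have [a1 a2] := dom _ kn.
  have [-> _] := H1 (k%:R / n%:R) (introT andP (conj a1 a2)).
  rewrite /f /n natrM invfM mulrCA [m%:R * _]mulrA divff ?mul1r ?mulrA //.
  by rewrite gt_eqF.
have [|sg csg sg0] := @chain_ex R X (fun k => nv (P k 0%N)) n [::].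
  by move=> k kn; have [c [c1 c2 _ _]] := mesh k 0%N kn n0; exists c.
have w0 : P 0%N 0%N = vx u by rewrite row0 // mul0r g0.
have wl l : (l <= n)%N -> P 0%N l = vx u /\ P n l = vx u.
  move=> ln; rewrite /P mul0r divff ?gt_eqF //; have [a1 a2] := dom _ ln.
  by have [-> ->] := H2 (l%:R / n%:R) (introT andP (conj a1 a2)).
have wn k : (k <= n)%N -> P k n = vx u.
  move=> kn; rewrite /P divff ?gt_eqF //; have [a1 a2] := dom _ kn.
  by have [_ ->] := H1 (k%:R / n%:R) (introT andP (conj a1 a2)).
have := @grid_trivial R X (fun k l => nv (P k l)) n n sg mesh.
rewrite w0 (wl 0%N (leq0n n)).2 nv_vertex => /(_ _ _ n0 csg sg0) triv.
have q0 : (0 < q)%N by [].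
apply: (htp_trans (gh q sg q0 _ sg0)).
  by move=> k kn; rewrite -!row0 //; [exact: csg|exact: ltnW].
apply: triv => [l ln|k kn]; last by rewrite wn // nv_vertex.
by have [-> ->] := wl l ln; rewrite nv_vertex.
Qed.

Lemma gpath_rev_cat v s t : gpath (v :: s) -> gpath (v :: t) ->
  gpath (rev t ++ v :: s) /\ head v (rev t ++ v :: s) = last v t.
Proof.
elim: t v s => [|x t IH] v s //= gs [xv gt].
rewrite rev_cons cat_rcons.
have gx : gpath (x :: v :: s) by split => //; exact: adjV_sym.
have [h1 h2] := IH x (v :: s) gx gt; split => //.
by rewrite -h2; case: (rev t).
Qed.

Lemma htp_back v s t : htp (belast v t ++ rev t ++ v :: s) (v :: s).
Proof.
elim: t v s => [|x t IH] v s; first exact: htp_refl.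
rewrite /= rev_cons cat_rcons.
apply: htp_trans (htp_cons v (IH x (v :: s))) _.
by apply: htp_step (htp_refl _ _); exact: hstep_bt.
Qed.

Lemma htp_prefix p s t : htp s t -> htp (p ++ s) (p ++ t).
Proof. by move=> h; elim: p => //= x p IH; exact: htp_cons. Qed.

(** Continue s by t backwards and then t again. The first two pieces form a loop at u, which is
    trivial; the last two cancel. *)
Lemma walks_htp u v s t : loops_contractible R X -> walk u v s -> walk u v t ->
  htp (v :: s) (v :: t).
Proof.
move=> SC [gs ls] [gt lt].
have [g1 h1] := gpath_rev_cat gs gt.
apply: htp_trans (htp_sym (htp_back v s t)) _.
have e : rev t ++ v :: s = u :: behead (rev t ++ v :: s).
  by rewrite -lt -h1; case: (rev t).
have := loop_htp (C := behead (rev t ++ v :: s)) (u := u) SC.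
rewrite -e => /(_ g1) h2.
have -> : v :: t = belast v t ++ [:: u] by rewrite -lt cats1 -lastI.
apply: htp_prefix; apply: h2.
have : last u (rev t ++ v :: s) = u by rewrite last_cat /= ls.
by rewrite e.
Qed.

Lemma cell_walk i (b b' : 'I_(dim i) -> bool) s : gpath (@crnV R X i b :: s) ->
  exists t, gpath (crnV b' :: t) /\ last (crnV b') t = last (crnV b) s.
Proof.
have [ks <-] := flips_ex b b'; elim: ks b s => [|k ks IH] b s gs /=; first by exists s.
have [|t [gt lt]] := IH (flip b k) (crnV b :: s); last by exists t.
by split => //; exists i, b, k.
Qed.

(** Points of X less than 1/2 apart have nearest vertices in a common cell, which are joined by
    edges. So being joined to u is locally constant along a path, and a supremum argument
    concludes. *)
Lemma walk_connected u v : path_connected R X -> exists s, walk u v s.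
Proof.
move=> pc; have [f [cf f0 f1]] := pc (vx u) (vx v).
pose conn t := exists s, gpath (nv (f t) :: s) /\ last (nv (f t)) s = u.
have loc t : 0 <= t <= 1 -> exists2 d, 0 < d & forall t', 0 <= t' <= 1 -> `|t - t'| < d ->
    (conn t <-> conn t').
  move=> ht; have At : `[0, 1]%classic t by rewrite /= in_itv.
  move/subspace_continuousP: cf => /(_ t At) /cvg_ballP /(_ (1 / 2)).
  have r2 : (0 : R) < 1 / 2 by lra.
  move=> /(_ r2); rewrite near_withinE => /nbhs_ballP [d /= d0 hd]; exists d => // t' ht' tt'.
  have [l st l2] : string_ball (f t) (1 / 2) (f t') by apply: hd => //=; rewrite in_itv.
  have [c [x cx ec]] := chart_cover R X (f t').
  have c' : cell c (f t') by exists x.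
  have [b1 e1] := vertexP (nv_cell st l2 c'); have [b2 e2] := vertexP (nv_cell0 c').
  rewrite /conn e1 e2.
  split=> -[s [gs <-]]; first exact: cell_walk gs.
  exact: cell_walk gs.
have c0 : conn 0 by exists [::]; rewrite f0 nv_vertex.
suff : conn 1 by rewrite /conn f1 nv_vertex.
pose S := [set t : R | 0 <= t <= 1 /\ forall s, 0 <= s <= t -> conn s].
have S0 : S 0.
  split; first by rewrite lexx ler01.
  by move=> s /andP[s1 s2]; have -> : s = 0 by apply/eqP; rewrite eq_le s1 s2.
have supS : has_sup S by split; [exists 0|exists 1 => t [/andP[]]].
set t := sup S.
have t0 : 0 <= t by apply: (ub_le_sup supS.2).
have t1 : t <= 1 by apply: sup_le_ub; [exists 0|move=> s [/andP[]]].
have [d d0 hd] := loc t (introT andP (conj t0 t1)).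
have [s [s01 hs] st] := sup_adherent d0 supS; rewrite -/t in st.
have sle : s <= t by apply: (ub_le_sup supS.2); split.
have ct : conn t.
  apply/(hd s) => //; last by apply: hs; move: s01 => /andP[-> _]; rewrite lexx.
  by rewrite ger0_norm; lra.
have ct' r : 0 <= r <= 1 -> r < t + d -> conn r.
  move=> r01 rd; have [rs|sr] := leP r s.
    by apply: hs; move: r01 => /andP[-> _].
  by apply/(hd r) => //; rewrite ltr_norml; lra.
have [lt1|] := ltP t 1; last by move=> h; apply: ct'; [rewrite ler01 lexx|lra].
pose r := Num.min 1 (t + d / 2).
have r1 : r <= 1 by rewrite /r ge_min lexx.
have r2 : r <= t + d / 2 by rewrite /r ge_min lexx orbT.
have r3 : t < r by rewrite /r lt_min; apply/andP; split; lra.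
have Sr : S r.
  split; first by apply/andP; split; lra.
  by move=> x /andP[x0 xr]; apply: ct'; [apply/andP; split; lra|lra].
have : r <= t by apply: (ub_le_sup supS.2).
lra.
Qed.
End Loops.

(** * Coordinates of points *)

Section CAT0.
Context {R : realType} {X : cubeComplex R}.
Hypothesis hX : CAT0_cube_complex X.
Implicit Types (i j : cell_index X) (u v w : vert X) (p q : X) (B C : set (vert X)).

Lemma link_flag v : flag (link (vx v)).
Proof. by case: hX => _; apply; exact: (svalP v). Qed.

Lemma walk_exX u v : exists s, walk (@adjV R X) u v s.
Proof. by apply: walk_connected; case: hX => -[]. Qed.

Definition dX := gdist walk_exX.

Lemma walk_htpX u v s t : walk (@adjV R X) u v s -> walk (@adjV R X) u v t ->
  htp (@sqV R X) (v :: s) (v :: t).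
Proof. by apply: walks_htp; case: hX => -[]. Qed.

Lemma cubeX u a b c ab bc ac : @sqV R X u a ab b -> @sqV R X u b bc c -> @sqV R X u a ac c ->
  exists z, [/\ @sqV R X a ab z ac, @sqV R X b ab z bc & @sqV R X c ac z bc].
Proof. by apply: sqV_cube; exact: link_flag. Qed.

Lemma dX_xx u : dX u u = 0%N. Proof. exact: gdist_xx. Qed.

Lemma dX_eq0 u v : dX u v = 0%N -> u = v. Proof. exact: gdist_eq0. Qed.

Lemma dX_bip u v w : adjV v w -> dX u w = (dX u v).+1 \/ dX u v = (dX u w).+1.
Proof.
exact: (gdist_bip (@sqV_rot R X) (@sqV_flip R X) (@sqV_neq R X) (@sqV_inj R X) cubeX
  (@sqV_adj R X) walk_exX walk_htpX).
Qed.

Lemma dX_step u v n : dX u v = n.+1 -> exists2 w, adjV w v & dX u w = n.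
Proof.
exact: (gdist_step (@sqV_rot R X) (@sqV_flip R X) (@sqV_neq R X) (@sqV_inj R X) cubeX
  (@sqV_adj R X) walk_htpX).
Qed.

Lemma dX_quad u a b c : adjV a b -> adjV c b -> a <> c ->
  dX u b = (dX u a).+1 -> dX u b = (dX u c).+1 ->
  exists2 w, @sqV R X b a w c & dX u a = (dX u w).+1.
Proof.
exact: (gdist_quad (@sqV_rot R X) (@sqV_flip R X) (@sqV_neq R X) (@sqV_inj R X) cubeX
  (@sqV_adj R X) walk_htpX).
Qed.

Definition HS := hs (@adjV R X) dX.
Definition WX := W dX.

Lemma HS_compl B : HS B -> HS (~` B).
Proof. exact: (hs_compl (@adjV_sym R X) dX_bip). Qed.

Lemma WX_r u a : adjV u a -> WX u a a.
Proof. exact: (W_r (@adjV_sym R X) dX_xx dX_eq0 dX_step dX_bip). Qed.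

Lemma WX_l u a : ~ WX u a u. Proof. exact: (W_l dX_xx). Qed.

Lemma HS_ex B : HS B -> exists v, B v.
Proof. exact: (hs_ex (@adjV_sym R X) dX_xx dX_eq0 dX_step dX_bip). Qed.

Lemma WX_sq c c' e' e : @sqV R X c c' e' e -> WX c e = WX c' e'.
Proof.
exact: (W_sq (@adjV_sym R X) (@sqV_rot R X) (@sqV_flip R X) (@sqV_adj R X) (@sqV_neq R X) (@sqV_inj R X)
  dX_bip dX_quad).
Qed.

Lemma HS_edge B u a : HS B -> adjV u a -> ~ B u -> B a -> B = WX u a.
Proof.
exact: (hs_edge (@adjV_sym R X) (@sqV_rot R X) (@sqV_flip R X) (@sqV_adj R X) (@sqV_neq R X)
  (@sqV_inj R X) dX_xx dX_eq0 dX_step dX_bip dX_quad).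
Qed.

Lemma cross_parX u a c e : adjV u a -> adjV c e -> ~ WX u a c -> WX u a e ->
  par (@sqV R X) u a c e.
Proof.
exact: (cross_par (@adjV_sym R X) (@sqV_rot R X) (@sqV_flip R X) (@sqV_adj R X)
  dX_xx dX_eq0 dX_step dX_bip dX_quad).
Qed.

Lemma HS_geod B v v' w : HS B -> adjV v v' -> dX w v = (dX w v').+1 -> B v -> B w -> B v'.
Proof.
exact: (hs_geod (@adjV_sym R X) (@sqV_rot R X) (@sqV_flip R X) (@sqV_adj R X) (@sqV_neq R X)
  (@sqV_inj R X) dX_xx dX_eq0 dX_step dX_bip dX_quad).
Qed.

Lemma WX_inj u a b : adjV u a -> adjV u b -> WX u a = WX u b -> a = b.
Proof. exact: (W_inj (@adjV_sym R X) dX_xx dX_eq0 dX_step dX_bip). Qed.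

Lemma WX_corner u a b v : adjV u a -> adjV u b -> a <> b -> WX u a v -> WX u b v ->
  exists w, @sqV R X u a w b.
Proof. exact: (W_corner (@adjV_sym R X) dX_bip dX_quad). Qed.

Definition sepX := sep (@adjV_sym R X) (@sqV_rot R X) (@sqV_flip R X) (@sqV_adj R X)
  (@sqV_neq R X) (@sqV_inj R X) dX_xx dX_eq0 dX_step dX_bip dX_quad.

Lemma mem_sepX u v B : B \in sepX u v <-> [/\ HS B, ~ B u & B v].
Proof. exact: mem_sep. Qed.

Lemma size_sepX u v : size (sepX u v) = dX u v.
Proof. exact: size_sep. Qed.

Lemma sepX_uniq u v : uniq (sepX u v).
Proof. exact: sep_uniq. Qed.

Lemma realizeX v (s : seq (set (vert X))) : uniq s ->
  (forall B, B \in s -> HS B /\ ~ B v) ->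
  (forall B C, B \in s -> C \in s -> meets B C) ->
  (forall B C, B \in s -> HS C -> ~ C v -> B `<=` C -> C \in s) ->
  exists w, forall B, HS B -> ~ B v -> (B w <-> B \in s).
Proof.
exact: (realize (@adjV_sym R X) (@sqV_rot R X) (@sqV_flip R X) (@sqV_adj R X)
  (@sqV_neq R X) (@sqV_inj R X) dX_xx dX_eq0 dX_step dX_bip dX_quad).
Qed.

Lemma adjacent_of_minimalX v B : HS B -> ~ B v ->
  (forall C, HS C -> ~ C v -> B `<=` C -> C = B) -> exists2 w, adjV v w & B = WX v w.
Proof.
exact: (adjacent_of_minimal (@adjV_sym R X) (@sqV_rot R X) (@sqV_flip R X) (@sqV_adj R X)
  (@sqV_neq R X) (@sqV_inj R X) dX_xx dX_eq0 dX_step dX_bip dX_quad).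
Qed.

Lemma antichain_boundX N : (forall i : cell_index X, (dim i <= N)%N) ->
  forall v (L : seq (set (vert X))), uniq L ->
  (forall B, B \in L -> HS B /\ ~ B v) ->
  (forall B C, B \in L -> C \in L -> meets B C) ->
  (forall B C, B \in L -> C \in L -> B `<=` C -> B = C) ->
  (size L <= N)%N.
Proof.
move=> dN; apply: (antichain_bound (@adjV_sym R X) (@sqV_rot R X) (@sqV_flip R X)
  (@sqV_adj R X) (@sqV_neq R X) (@sqV_inj R X) dX_xx dX_eq0 dX_step dX_bip dX_quad).
by move=> v l ul h1 h2; apply: (@clique_dim R X N v l _ (WX v)) => //; exact: link_flag.
Qed.

Lemma dX_tri u v w : (dX u w <= dX u v + dX v w)%N.
Proof. exact: (d_tri dX_eq0 dX_step dX_bip). Qed.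

Lemma dX_sym u v : dX u v = dX v u.
Proof. exact: (d_sym (@adjV_sym R X) dX_xx dX_eq0 dX_step dX_bip). Qed.

Lemma HS_W u a : adjV u a -> HS (WX u a). Proof. by exists u, a. Qed.

Lemma WX_compl u a : adjV u a -> ~` WX u a = WX a u.
Proof. exact: (W_compl dX_bip). Qed.


Lemma W_cell i (b b' : 'I_(dim i) -> bool) k : b k = b' k ->
  WX (crnV b) (crnV (flip b k)) = WX (crnV b') (crnV (flip b' k)).
Proof.
move=> e; have [ks eks hks] := flips_ex2 b b'.
have : k \notin ks by apply/negP => /hks; rewrite e eqxx.
move: eks => <- {hks e}.
elim: ks b => //= l ks IH b; rewrite inE negb_or => /andP[kl nk].
rewrite -IH //; apply: WX_sq; exists i, b, l, k; split => //.
by apply/eqP; rewrite eq_sym.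
Qed.

Lemma crossing_cell B i b k : HS B -> ~ B (@crnV R X i b) -> B (crnV (flip b k)) ->
  forall b', B (crnV b') <-> b' k <> b k.
Proof.
move=> hB nb hb b'; have a1 : adjV (@crnV R X i b) (crnV (flip b k)) by exists i, b, k.
have e := HS_edge hB a1 nb hb.
have [e1|ne] := eqVneq (b' k) (b k).
  split=> // h; have := W_cell e1 => e2; rewrite e -e2 in h.
  by have := WX_l h.
split=> _; first exact/eqP.
have e1 : flip b' k k = b k by rewrite flip_self; move: ne; case: (b' k); case: (b k).
rewrite e -(W_cell e1) flipK; apply: WX_r.
by exists i, (flip b' k), k; rewrite flipK.
Qed.

(** A relation, because a point lies in several cells and the corner b of the last case is a choice;
    independence of both is [coordv_uniq]. *)
Definition coordv B i (x : 'rV[R]_(dim i)) (r : R) : Prop :=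
  [\/ (forall b, B (@crnV R X i b)) /\ r = 1,
      (forall b, ~ B (@crnV R X i b)) /\ r = 0 |
      exists b k, [/\ ~ B (@crnV R X i b), B (crnV (flip b k)) & r = cdist b k x]].

Lemma coordv_ex B i x : exists r, @coordv B i x r.
Proof.
have [all|/existsNP [b1 nb1]] := pselect (forall b, B (@crnV R X i b)).
  by exists 1; constructor 1.
have [none|/existsNP [b2 /contrapT hb2]] := pselect (forall b, ~ B (@crnV R X i b)).
  by exists 0; constructor 2.
have [ks e] := flips_ex b1 b2; rewrite -e in hb2.
elim: ks b1 nb1 hb2 {e} => [|k ks IH] b nb hb; first by case: nb.
have [h|h] := pselect (B (crnV (flip b k))); last exact: (IH _ h hb).
by exists (cdist b k x); constructor 3; exists b, k.
Qed.

(** The value is visible on the corners shared with j: if the common face fixes the direction k that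
    B crosses, B is constant on these corners, and otherwise k is a direction of the common face. *)
Lemma coordv_inter B i j x y r : HS B -> unit_cube x -> unit_cube y ->
  chart i x = chart j y -> @coordv B i x r ->
  [\/ (forall v, cell i (vx v) -> cell j (vx v) -> B v) /\ r = 1,
      (forall v, cell i (vx v) -> cell j (vx v) -> ~ B v) /\ r = 0 |
      exists b k, [/\ ~ B (@crnV R X i b), B (crnV (flip b k)), r = cdist b k x,
        cell j (crn b) & cell j (crn (flip b k))]].
Proof.
move=> hB cx cy exy.
case=> [[h ->]|[h ->]|[b [k [nb hb ->]]]].
- by constructor 1; split => // v /vertexP [b ->].
- by constructor 2; split => // v /vertexP [b ->].
have jp : cell j (chart i x) by rewrite exy; exact: cellI.
have hc := crossing_cell hB nb hb.
have [s hs] := inter_face (cellI cx) jp; have [_ sx] := proj1 (hs x cx) jp.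
case sk : (s k) => [c|].
  have vs v : cell i (vx v) -> cell j (vx v) -> exists2 b', v = crnV b' & b' k = c.
    move=> /vertexP [b' ->] h; exists b' => //.
    exact: (proj1 (face_ptv s b') (proj1 (hs _ (ptv_cube b')) h)).
  have [ec|nc] := eqVneq c (b k); [constructor 2|constructor 1]; split.
  - by move=> v h1 h2; have [b' -> e] := vs v h1 h2; move=> /hc; rewrite e ec.
  - by apply/cdist_eq0; rewrite (sx _ _ sk) ec.
  - by move=> v h1 h2; have [b' -> e] := vs v h1 h2; apply/hc; rewrite e; exact/eqP.
  - by rewrite /cdist (sx _ _ sk); move: nc; case: c {sk vs}; case: (b k) => //=; rewrite subr0.
pose b1 m := if s m is Some c then c else b m.
have b1k : b1 k = b k by rewrite /b1 sk.
have j1 : cell j (@crn R X i b1).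
  by apply/hs; [exact: ptv_cube|apply/face_ptv => m c sm; rewrite /b1 sm].
have j2 : cell j (crn (flip b1 k)).
  apply/hs; [exact: ptv_cube|apply/face_ptv => m c sm; rewrite flip_other /b1 ?sm //].
  by apply: contraPneq sm => ->; rewrite sk.
constructor 3; exists b1, k; split => //.
- by move=> /hc; rewrite b1k.
- by apply/hc; rewrite flip_self b1k; case: (b k).
- by rewrite /cdist b1k.
Qed.

Lemma coordv_uniq B i j x y r r' : HS B -> unit_cube x -> unit_cube y ->
  chart i x = chart j y -> @coordv B i x r -> @coordv B j y r' -> r = r'.
Proof.
move=> hB cx cy exy h1 h2.
have eyx := esym exy.
have h1' := coordv_inter hB cx cy exy h1; have h2' := coordv_inter hB cy cx eyx h2.
have [v vi vj] : exists2 v, cell i (vx v) & cell j (vx v).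
  have jp : cell j (chart i x) by rewrite exy; exact: cellI.
  have [s hs] := inter_face (cellI cx) jp.
  pose b m := if s m is Some c then c else true.
  exists (crnV b); first exact: crn_cell.
  by apply/hs; [exact: ptv_cube|apply/face_ptv => m c sm; rewrite /b sm].
case: h1' => [[a1 ->]|[a1 ->]|[b [k [nb hb -> jb jk]]]];
  case: h2' => [[a2 ->]|[a2 ->]|[b' [k' [nb' hb' -> ib' ik']]]] //.
- by case: (a2 v) => //; apply: a1.
- by case: nb'; apply: a1 => //; exact: crn_cell.
- by case: (a1 v) => //; apply: a2.
- by case: (a1 (crnV (flip b' k'))) => //; exact: crn_cell.
- by case: nb; apply: a2 => //; exact: crn_cell.
- by case: (a2 (crnV (flip b k))) => //; exact: crn_cell.
have [c' ec] := vertexP (v := crnV b) jb.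
have [m em] := transfer ec jk.
have -> : cdist b k x = cdist c' m y.
  rewrite !cdistE; congr ((_ - _ + _) / _); apply: ed_chart => //; try exact: ptv_cube.
    by move/(congr1 (@vx R X)): ec.
  by move/(congr1 (@vx R X)): em.
have hc := crossing_cell hB nb' hb'.
have e1 : c' k' = b' k' by apply: contrapT => ne; apply: nb; rewrite ec; apply/hc.
have := hb; rewrite em => /hc ne.
have -> : m = k'.
  by apply/eqP/negPn/negP => mk; apply: ne; rewrite flip_other // eq_sym.
by rewrite /cdist e1.
Qed.

(** For a half-space B the default 0 is never reached, by [coordv_ex]. *)
Definition tc B p : R :=
  xget 0 [set r | exists i x, [/\ unit_cube x, chart i x = p & @coordv B i x r]].

Lemma tcE B i x r : HS B -> unit_cube x -> @coordv B i x r -> tc B (chart i x) = r.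
Proof.
move=> hB cx h; rewrite /tc; case: xgetP => [r' _ [j [y [cy e h']]]|no].
  exact: (coordv_uniq hB cy cx e h' h).
by case: (no r); exists i, x.
Qed.

Lemma tc_all B i x : HS B -> unit_cube x -> (forall b, B (@crnV R X i b)) ->
  tc B (chart i x) = 1.
Proof. by move=> hB cx h; apply: tcE => //; constructor 1. Qed.

Lemma tc_none B i x : HS B -> unit_cube x -> (forall b, ~ B (@crnV R X i b)) ->
  tc B (chart i x) = 0.
Proof. by move=> hB cx h; apply: tcE => //; constructor 2. Qed.

Lemma tc_edge B i x b k : HS B -> unit_cube x -> ~ B (@crnV R X i b) ->
  B (crnV (flip b k)) -> tc B (chart i x) = cdist b k x.
Proof. by move=> hB cx h1 h2; apply: tcE => //; constructor 3; exists b, k. Qed.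

Lemma tc_cases B i x : HS B -> unit_cube x ->
  [\/ (forall b, B (@crnV R X i b)) /\ tc B (chart i x) = 1,
      (forall b, ~ B (@crnV R X i b)) /\ tc B (chart i x) = 0 |
      exists b k, [/\ ~ B (@crnV R X i b), B (crnV (flip b k)) & tc B (chart i x) = cdist b k x]].
Proof.
move=> hB cx; have [r hr] := coordv_ex B x.
by rewrite (tcE hB cx hr); case: hr => [[h ->]|[h ->]|h];
  [constructor 1|constructor 2|constructor 3].
Qed.

Lemma tc_itv B p : HS B -> 0 <= tc B p <= 1.
Proof.
move=> hB; have [i [x cx <-]] := chart_cover R X p.
case: (tc_cases hB cx) => [[_ ->]|[_ ->]|[b [k [_ _ ->]]]]; rewrite ?lexx ?ler01 //.
exact: cdist_ge0.
Qed.

Lemma tc_vertex B v : HS B -> tc B (vx v) = `[< B v >]%:R.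
Proof.
move=> hB; have [i _ iv] := svalP v; have [b eb] := vertexP iv.
have -> : vx v = chart i (ptv b) by rewrite eb.
case: (tc_cases (i := i) hB (ptv_cube b)) => [[h ->]|[h ->]|[b' [k [h1 h2 ->]]]].
- by rewrite asboolT // eb.
- by rewrite asboolF // eb.
have hc := crossing_cell hB h1 h2; rewrite /cdist ptvE.
have [Bv|nBv] := pselect (B v).
  rewrite asboolT //; move: Bv; rewrite eb => /hc.
  by case: (b k); case: (b' k) => //=; rewrite ?subr0.
rewrite asboolF //; have : b k = b' k by apply: contrapT => ne; apply: nBv; rewrite eb; apply/hc.
by move=> ->; case: (b' k) => /=; rewrite ?subrr.
Qed.

Lemma tc_compl B p : HS B -> tc (~` B) p = 1 - tc B p.
Proof.
move=> hB; have hC := HS_compl hB; have [i [x cx <-]] := chart_cover R X p.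
case: (tc_cases (i := i) hB cx) => [[h ->]|[h ->]|[b [k [h1 h2 ->]]]].
- by rewrite subrr; apply: tc_none => // b /(_ (h b)).
- by rewrite subr0; apply: tc_all.
- by rewrite -cdist_flip; apply: tc_edge; rewrite ?flipK //; apply.
Qed.

Lemma tc_step B p q l : HS B -> step p q l -> `|tc B p - tc B q| <= l.
Proof.
move=> hB [i [x [y [cx cy <- <- ->]]]].
case: (tc_cases (i := i) hB cx) => [[h ->]|[h ->]|[b [k [h1 h2 ->]]]].
- by rewrite tc_all // subrr normr0 ed_ge0.
- by rewrite tc_none // subrr normr0 ed_ge0.
- by rewrite (tc_edge hB cy h1 h2) cdist_sub ed_coord.
Qed.

Lemma tc_string B p q l : HS B -> string p q l -> `|tc B p - tc B q| <= l.
Proof.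
move=> hB; elim=> {p q l} [p|p q q' l m st _ IH]; first by rewrite subrr normr0.
rewrite -[tc B p](subrK (tc B q)) -addrA; apply: le_trans (ler_normD _ _) _.
by apply: lerD => //; exact: tc_step.
Qed.
End CAT0.

(** * Hyperplanes *)

Section Hyperplanes.
Context {R : realType} {X : cubeComplex R}.
Hypothesis hX : CAT0_cube_complex X.
Implicit Types (i j e : cell_index X) (u v w : vert X) (p q : X) (B C : set (vert X)).
Notation HS := (HS hX).
Notation WX := (WX hX).
Notation dX := (dX hX).
Notation tc := (tc (X := X)).

Lemma edge_adj e u a : u <> a -> edge_on e u a -> adjV u a.
Proof.
move=> ua h; have [ee eu ea] := h; have [a' ua' [_ _ ea']] := edge_nbr ee eu.
by have [e1|<-//] := edge_other ua h ea'; case: (adjV_neq ua').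
Qed.

Definition crosses B e := exists u a, [/\ edge_on e u a, ~ B u & B a].

Lemma crosses_opposite B e e' : HS B -> opposite_in_square e e' -> crosses B e -> crosses B e'.
Proof.
move=> hB o [u [a [h nu ha]]].
have ua : u <> a by move=> e1; rewrite -e1 in ha.
have [u' [a' [h' s]]] := opposite_sq o h ua.
have eB := HS_edge hB (edge_adj ua h) nu ha.
have eB' : B = WX u' a' by rewrite eB; exact: WX_sq.
have aa : adjV u' a' := sqV_adj (sqV_rot s).
by exists u', a'; split => //; rewrite eB'; [exact: WX_l|exact: WX_r].
Qed.

Lemma opposite_sym e e' : opposite_in_square e e' -> opposite_in_square e' e.
Proof. by move=> [h1 h2 [c [dc c1 c2 c3]]]; split=> //; exists c; rewrite setIC. Qed.

Lemma crosses_parallel B e e' : HS B -> parallel e e' -> crosses B e <-> crosses B e'.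
Proof.
move=> hB; elim => // {e e'} [e e' o|e e' _ [h1 h2]|x y z _ [h1 h2] _ [h3 h4]]; split; auto.
- exact: crosses_opposite.
- by apply: crosses_opposite => //; exact: opposite_sym.
Qed.

Lemma half_cube n : @unit_cube R n (const_mx 2^-1).
Proof. by move=> k; rewrite mxE; apply/andP; split; lra. Qed.

Lemma cdist_half n (b : 'I_n -> bool) k (x : 'rV[R]_n) : x 0 k = 2^-1 <-> cdist b k x = 2^-1.
Proof. by rewrite /cdist; case: (b k); split; lra. Qed.

Lemma crosses_edge B e u a : u <> a -> edge_on e u a -> exists b k,
  u = @crnV R X e b /\ a = crnV (flip b k).
Proof.
move=> ua [ee eu ea]; have [b [k [eb h]]] := edge_cornerP ee eu; exists b, k; split => //.
by case: (h _ ea) => // h1; case: ua.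
Qed.

Lemma crosses_midpoint B e : HS B -> crosses B e -> tc B (midpoint e) = 2^-1.
Proof.
move=> hB [u [a [h nu ha]]].
have ua : u <> a by move=> e1; rewrite -e1 in ha.
have [b [k [eu ea]]] := crosses_edge B ua h; rewrite eu in nu; rewrite ea in ha.
rewrite /midpoint (tc_edge hB (@half_cube _) nu ha).
by apply/cdist_half; rewrite mxE.
Qed.

Lemma midpoint_cell e i : is_edge e -> cell i (midpoint e) -> cell e `<=` cell i.
Proof.
move=> ee h; have [s hs] := inter_face (cellI (half_cube (n := dim e))) h.
have [_ hx] := proj1 (hs _ (half_cube (n := dim e))) h.
move=> p [x cx <-]; apply/hs => //; split => // k b /hx; rewrite mxE.
by case: b => /=; lra.
Qed.

Lemma crosses_midcube B e i k : HS B -> crosses B e -> @midcube R X i k (midpoint e) ->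
  exists b, ~ B (@crnV R X i b) /\ B (crnV (flip b k)).
Proof.
move=> hB [u [a [h nu ha]]] [x [cx xk] ex].
have ua : u <> a by move=> e1; rewrite -e1 in ha.
have [ee eu ea] := h.
have [b' [k' [ub' ab']]] := crosses_edge B ua h.
have ei : cell e `<=` cell i by apply: midpoint_cell => //; rewrite -ex; exact: cellI.
have [d ed] := vertexP (ei _ eu).
have [h0|[k1 [ek e1]]] := cdist_transfer k cx (@half_cube _) ex (etrans (esym ed) ub').
  by move: (proj1 (cdist_half d k x) xk); rewrite h0 => {ex} h1; exfalso; lra.
exists d; rewrite -ed ek; split => //; suff -> : k1 = k' by rewrite -ab'.
exact: ord_eq1 ee.
Qed.

Lemma par_parallel u a c f : par (@sqV R X) u a c f -> u <> a -> forall e e', edge_on e u a ->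
  edge_on e' c f -> parallel e e'.
Proof.
move=> hp ua; elim: hp => [|c1 f1 c' f' _ IH s] e e' h h'.
  by rewrite (edge_uniq ua h h'); exact: rst_refl.
have a1 : adjV c1 f1 := sqV_adj (sqV_flip s).
have [e1 he1] := adj_edge a1.
apply: rst_trans (IH _ _ h he1) _; apply: rst_step.
exact: sq_opposite s he1 h'.
Qed.

(** A point at level 1/2 lies in a cell that B crosses in some direction k, at the middle of it; an
    edge of the cell in this direction crosses B and is therefore parallel to e, by [cross_parX]. *)
Lemma dual_hyperplaneE B e : HS B -> crosses B e ->
  dual_hyperplane e = [set p | tc B p = 2^-1].
Proof.
move=> hB sB; apply/seteqP; split => p.
  move=> [i [k [e' [pe me' [x [cx xk] <-]]]]] /=.
  have [b [h1 h2]] := crosses_midcube hB (proj1 (crosses_parallel hB pe) sB) me'.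
  by rewrite (tc_edge hB cx h1 h2); apply/cdist_half.
have [i [x cx <-]] := chart_cover R X p => /= tp.
have [u [a [h nu ha]]] := sB.
have ua : u <> a by move=> e1; rewrite -e1 in ha.
have eB := HS_edge hB (edge_adj ua h) nu ha.
have [[_]|[_]|[b [k [h1 h2 e1]]]] := tc_cases hB cx; try (rewrite tp; lra).
have [e' [he' ce']] := edge_ex (X := X) b k.
have pe : parallel e e'.
  apply: (par_parallel _ ua h he'); apply: (cross_parX (hX := hX)); first exact: edge_adj h.
  - by exists i, b, k.
  - by rewrite -eB.
  - by rewrite -eB.
exists i, k, e'; split => //.
- have : cell e' (midpoint e') by apply: cellI; exact: half_cube.
  rewrite ce' => -[y [cy fy] ey]; exists y => //; split => //.
  apply/(cdist_half b); rewrite -(tc_edge hB cy h1 h2) ey.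
  by apply: crosses_midpoint => //; exists (crnV b), (crnV (flip b k)).
- by exists x => //; split => //; apply/(cdist_half b); rewrite -e1.
Qed.

Lemma edge_crosses e : is_edge e -> exists2 B, HS B & crosses B e.
Proof.
move=> ee; have h : cell e (@crn R X e (fun=> false)) by exact: crn_cell.
have [a ua ha] := edge_nbr (u := crnV _) ee h.
exists (WX (crnV (i := e) (fun=> false)) a); first exact: HS_W.
by exists (crnV (i := e) (fun=> false)), a; split => //; [exact: WX_l|exact: WX_r].
Qed.

Lemma crosses_ex B : HS B -> exists2 e, is_edge e & crosses B e.
Proof.
move=> [u [a [ua eB]]]; have [e he] := adj_edge ua; exists e; first by case: he.
by exists u, a; split => //; rewrite eB; [exact: WX_l|exact: WX_r].
Qed.

Lemma is_hyperplaneP H : is_hyperplane H <-> exists2 B, HS B & H = [set p | tc B p = 2^-1].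
Proof.
split=> [[e ee ->]|[B hB ->]].
  by have [B hB sB] := edge_crosses ee; exists B => //; exact: dual_hyperplaneE.
by have [e ee sB] := crosses_ex hB; exists e => //; rewrite (dual_hyperplaneE hB sB).
Qed.

Lemma tc_continuous B : HS B -> continuous (tc B).
Proof.
move=> hB p; have FF : Filter (nbhs p) := nbhs_filter p.
apply/(@cvg_ballP _ _ _ (nbhs p) FF) => e e0; apply/nbhs_ballP; exists e => //= q [l pq le].
by rewrite /ball /=; apply: le_lt_trans (tc_string hB pq) le.
Qed.

Definition seg n (x y : 'rV[R]_n) (s : R) : 'rV[R]_n := \row_k ((1 - s) * x 0 k + s * y 0 k).

Lemma seg0 n (x y : 'rV[R]_n) : seg x y 0 = x.
Proof. by apply/rowP => k; rewrite mxE; lra. Qed.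

Lemma seg1 n (x y : 'rV[R]_n) : seg x y 1 = y.
Proof. by apply/rowP => k; rewrite mxE; lra. Qed.

Lemma seg_cube n (x y : 'rV[R]_n) s : unit_cube x -> unit_cube y -> 0 <= s <= 1 ->
  unit_cube (seg x y s).
Proof.
move=> cx cy /andP[s0 s1] k; rewrite mxE; have /andP[h1 h2] := cx k; have /andP[h3 h4] := cy k.
by apply/andP; split; nra.
Qed.

Lemma seg_ed n (x y : 'rV[R]_n) s t : s <= t ->
  euclid_dist (seg x y s) (seg x y t) = (t - s) * euclid_dist x y.
Proof.
move=> st; have ts : 0 <= t - s by rewrite subr_ge0.
rewrite /euclid_dist -[in RHS](ger0_norm ts) -sqrtr_sqr -sqrtrM ?sqr_ge0 //.
congr Num.sqrt; rewrite mulr_sumr; apply: eq_bigr => k _; rewrite !mxE; lra.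
Qed.

Lemma seg_cdist n (b : 'I_n -> bool) k (x y : 'rV[R]_n) s :
  cdist b k (seg x y s) = (1 - s) * cdist b k x + s * cdist b k y.
Proof. by rewrite /cdist mxE; case: (b k); lra. Qed.

Lemma step_string p q l : step p q l -> string p q l.
Proof. by move=> h; rewrite -[l]addr0; apply: string_cons h _; exact: string_nil. Qed.

Lemma seg_string i (x y : 'rV[R]_(dim i)) s t : unit_cube x -> unit_cube y ->
  0 <= s -> s <= t -> t <= 1 ->
  string (X := X) (chart i (seg x y s)) (chart i (seg x y t)) ((t - s) * euclid_dist x y).
Proof.
move=> cx cy s0 st t1; apply: step_string; exists i, (seg x y s), (seg x y t).
by split=> //; [apply: seg_cube..|rewrite seg_ed] => //; apply/andP; split; lra.
Qed.

(** Connected subsets instead of paths, since transitivity is then a union. *)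
Definition linked (S : set X) p q := exists C : set X, [/\ connected C, C `<=` S, C p & C q].

Lemma linked_trans S q p r : linked S p q -> linked S q r -> linked S p r.
Proof.
move=> [C [c1 c2 c3 c4]] [D [d1 d2 d3 d4]]; exists (C `|` D); split; [|by move=> z [/c2|/d2]|by left|by right].
by apply: connectedU => //; exists q.
Qed.

Lemma linked_sym S p q : linked S p q -> linked S q p.
Proof. by move=> [C [c1 c2 c3 c4]]; exists C. Qed.

Lemma linked_connected S : (forall p q, S p -> S q -> linked S p q) -> connected S.
Proof.
move=> h; have [[p Sp]|no] := pselect (exists p, S p); last first.
  suff -> : S = set0 by exact: connected0.
  by apply/seteqP; split => // p Sp; apply: no; exists p.
suff -> : S = \bigcup_(C in [set C : set X | [/\ connected C, C `<=` S & C p]]) C.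
  by apply: bigcup_connected => [|C [//]]; exists p => C [].
apply/seteqP; split => q; last by move=> [C [_ h2 _]] /h2.
by move=> Sq; have [C [c1 c2 c3 c4]] := h p q Sp Sq; exists C.
Qed.

Lemma linked_seg S i (x y : 'rV[R]_(dim i)) : unit_cube x -> unit_cube y ->
  (forall s, 0 <= s <= 1 -> S (chart i (seg x y s))) -> linked S (chart i x) (chart i y).
Proof.
move=> cx cy h; exists ((fun s => chart i (seg x y s) : X) @` `[0, 1]); split.
- apply: connected_continuous_connected; first exact: segment_connected.
  have K0 : 0 < euclid_dist x y + 1 by have := ed_ge0 x y; lra.
  apply: (string_lipschitz_continuous K0) => s t.
  rewrite /= !in_itv /= => /andP[s0 s1] /andP[t0 t1] st.
  exists ((t - s) * euclid_dist x y); first exact: seg_string.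
  rewrite mulrC ler_wpM2r ?subr_ge0 //; lra.
- by move=> _ [s hs <-]; apply: h; move: hs; rewrite /= in_itv.
- by exists 0; [rewrite /= in_itv /= lexx ler01|rewrite seg0].
- by exists 1; [rewrite /= in_itv /= lexx ler01|rewrite seg1].
Qed.

Definition side B : set X := [set p | 2^-1 < tc B p].

(** The coordinate is affine along the segment between the two points, so it stays above 1/2. *)
Lemma linked_side_cell B i (x y : 'rV[R]_(dim i)) : HS B -> unit_cube x -> unit_cube y ->
  side B (chart i x) -> side B (chart i y) -> linked (side B) (chart i x) (chart i y).
Proof.
move=> hB cx cy hx hy; apply: linked_seg => // s hs; have cs := seg_cube cx cy hs.
move: hx hy; rewrite /side /=.
have [[h _]|[h ->]|[b [k [h1 h2 ->]]]] := tc_cases hB cx.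
- by rewrite !tc_all.
- by move=> h1; exfalso; lra.
- rewrite !(tc_edge hB _ h1 h2) // seg_cdist => h3 h4; case/andP: hs => s0 s1; have [ab|/ltW ab] := leP (cdist b k x) (cdist b k y); nra.
Qed.

Lemma side_vertex B p : HS B -> side B p -> exists2 v, B v & linked (side B) p (vx v).
Proof.
move=> hB; have [i [x cx <-]] := chart_cover R X p => hp.
suff [b hb] : exists b, B (@crnV R X i b).
  exists (crnV b) => //; rewrite /=; apply: (linked_side_cell hB cx (ptv_cube b) hp).
  by have := tc_vertex (crnV b) hB; rewrite /= asboolT // /side /= /crn => ->; rewrite /=; lra.
move: hp; rewrite /side /=.
have [[h _]|[h ->]|[b [k [h1 h2 _]]]] := tc_cases hB cx.
- by exists (fun=> true).
- by move=> h1; exfalso; lra.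
- by exists (flip b k).
Qed.

(** Shortest edge paths between vertices of B stay in B by convexity, and consecutive vertices share
    a cell. *)
Lemma side_vertices B v w : HS B -> B v -> B w -> linked (side B) (vx v) (vx w).
Proof.
move=> hB Bv; have sV z : B z -> side B (vx z).
  by move=> Bz; rewrite /side /= tc_vertex // asboolT //=; lra.
move e : (dX v w) => n; elim: n w e => [|n IH] w e Bw.
  rewrite -(dX_eq0 e); exists [set vx v]; split => //; first exact: connected1.
  by move=> _ ->; exact: sV.
have [w' ww' e'] := dX_step e.
have Bw' : B w' by apply: (HS_geod hB (adjV_sym ww') _ Bw Bv); rewrite e e'.
apply: linked_trans (IH _ e' Bw') _.
case: ww' Bw Bw' => i [b [k [-> ->]]] Bw Bw'.
by apply: linked_side_cell => //; try exact: ptv_cube; exact: (sV (crnV _)).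
Qed.

Lemma side_connected B : HS B -> connected (side B).
Proof.
move=> hB; apply: linked_connected => p q hp hq.
have [v Bv pv] := side_vertex hB hp; have [w Bw qw] := side_vertex hB hq.
by apply: linked_trans pv (linked_trans (side_vertices hB Bv Bw) (linked_sym qw)).
Qed.

(** One inclusion is connectedness of the side; for the other, a connected set leaving the side
    takes the value 1/2. *)
Lemma component_side B p : HS B -> side B p ->
  connected_component (~` [set p | tc B p = 2^-1]) p = side B.
Proof.
move=> hB hp; apply/seteqP; split => q; last first.
  move=> hq; exists (side B) => //; split => //; last exact: side_connected.
  by move=> z; rewrite /side /= => h1 h2; lra.
move=> [C [Cp CH cC] Cq].
have cI : connected (tc B @` C).
  apply: connected_continuous_connected => //.
  by apply: continuous_subspaceT; exact: tc_continuous.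
move/connected_intervalP : cI => I.
rewrite /side /=; case: ltP => // le; exfalso.
have [z Cz ez] : (tc B @` C) 2^-1.
  by apply: (I (tc B q) (tc B p)); [exists q|exists p|rewrite le /=; exact: ltW].
by case: (CH _ Cz).
Qed.

Definition Hsp B : set X := [set p | 2^-1 <= tc B p].

(** A point at level 1/2 is approached from inside by moving it towards a corner of its cell in
    B. *)
Lemma closure_side B : HS B -> closure (side B) = Hsp B.
Proof.
move=> hB; apply/seteqP; split => p.
  have cl : closed (Hsp B).
    have -> : Hsp B = tc B @^-1` [set x | 2^-1 <= x] by [].
    by apply: closed_comp; [move=> x _; exact: tc_continuous|exact: closed_ge].
  move=> h; apply: cl; move: p h; apply: closure_subset.
  by move=> z; exact: ltW.
rewrite /Hsp /= le_eqVlt => /orP[/eqP e|]; last by move=> h; apply: subset_closure.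
move=> U /nbhs_ballP [r /= r0 hr].
have [i [x cx xp]] := chart_cover R X p.
have [[_]|[_]|[b [k [h1 h2 e1]]]] := tc_cases hB cx; rewrite ?xp -?e; try lra.
pose y : 'rV[R]_(dim i) := ptv (flip b k); have cy : unit_cube y := ptv_cube _.
pose D := euclid_dist x y + 1; have D0 : 0 < D by have := ed_ge0 x y; rewrite /D; lra.
(* D exceeds the length of the segment by 1 so as to be positive, and the factor 2 makes the
   displacement strictly less than r. *)
pose s := Num.min 1 (r / (2 * D)).
have s0 : 0 < s by rewrite lt_min ltr01 /= divr_gt0 // mulr_gt0.
have s1 : s <= 1 by rewrite ge_min lexx.
have s2 : s * D < r.
  have : s <= r / (2 * D) by rewrite ge_min lexx orbT.
  rewrite ler_pdivlMr; last by rewrite mulr_gt0.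
  by nra.
exists (chart i (seg x y s)); split.
  rewrite /side /= (tc_edge hB (seg_cube cx cy _) h1 h2) ?seg_cdist; last by apply/andP; split; lra.
  have -> : cdist b k y = 1.
    by rewrite /cdist /y ptvE flip_self; case: (b k) => /=; lra.
  by move: e1; rewrite xp -e => <-; nra.
apply: hr; rewrite -xp /ball /=; exists ((s - 0) * euclid_dist x y).
  by rewrite -{1}(seg0 x y); apply: seg_string => //; exact: ltW.
by move: s2; rewrite /D; nra.
Qed.

Lemma half_space_ofP H h : half_space_of H h <->
  exists B, [/\ HS B, H = [set p | tc B p = 2^-1] & h = Hsp B].
Proof.
split=> [[/is_hyperplaneP [B hB ->] [p np ->]]|[B [hB -> ->]]].
  have [lt|ge] := ltP 2^-1 (tc B p).
    by exists B; split => //; rewrite component_side // closure_side.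
  have hC := HS_compl hB.
  have eH : [set p | tc B p = 2^-1] = [set p | tc (~` B) p = 2^-1].
    by apply/seteqP; split => z /=; rewrite tc_compl //; lra.
  exists (~` B); split => //; rewrite eH component_side ?closure_side //.
  rewrite /side /= tc_compl //; move: ge; rewrite le_eqVlt => /orP[/eqP /np //|]; lra.
split; first by apply/is_hyperplaneP; exists B.
have [v Bv] := HS_ex hB.
have sv : side B (vx v) by rewrite /side /= tc_vertex // asboolT //=; lra.
exists (vx v); first by move: sv; rewrite /side /=; lra.
by rewrite component_side // closure_side.
Qed.
End Hyperplanes.

(** * Automorphisms *)

Section Automorphisms.
Context {R : realType} {X : cubeComplex R}.
Hypothesis hX : CAT0_cube_complex X.
Implicit Types (i j : cell_index X) (u v w : vert X) (p q : X) (B C : set (vert X)).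
Notation HS := (HS hX).
Notation WX := (WX hX).
Notation dX := (dX hX).
Notation tc := (tc (X := X)).

Lemma cellular_vertex f p : cellular (X := X) f -> is_vertex p -> is_vertex (f p).
Proof.
move=> cf [i di [x cx <-]]; have [j [h [hb hh] hf]] := cf i.
have [hm _ hs] := hb; rewrite hf //; exists j; last by apply: cellI; exact: hm.
apply/eqP/negPn/negP => nz; have dj : (0 < dim j)%N by rewrite lt0n.
have [x1 cx1 e1] := hs _ (@ptv_cube R _ (fun=> true)).
have [x2 cx2 e2] := hs _ (@ptv_cube R _ (fun=> false)).
have e12 : x1 = x2 by apply/rowP => k; have := ltn_ord k; rewrite [X in (_ < X)%N]di.
have /(congr1 (fun f => f (Ordinal dj))) // : (fun=> true) = (fun=> false) :> ('I_(dim j) -> bool).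
by apply: (@ptv_inj R); rewrite -e1 -e2 e12.
Qed.

Lemma cellular_step f p q l : cellular (X := X) f -> step p q l -> step (f p) (f q) l.
Proof.
move=> cf [i [x [y [cx cy <- <- ->]]]]; have [j [h [[hm _ _] hh] hf]] := cf i.
by exists j, (h x), (h y); rewrite !hf // hh //; split => //; exact: hm.
Qed.

Lemma cellular_string f p q l : cellular (X := X) f -> string p q l -> string (f p) (f q) l.
Proof.
move=> cf; elim=> {p q l} [p|p q q' l m st _ IH]; first exact: string_nil.
by apply: string_cons IH; exact: cellular_step.
Qed.

Lemma Aut_dist f p q : @Aut R X f -> dist (f p) (f q) = dist p q.
Proof.
move=> [g [fK gK cf cg]]; congr inf; apply/seteqP; split => l /=.
  by move/(cellular_string cg); rewrite !fK.
exact: cellular_string.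
Qed.

(** For cellular f the default v is never reached, see [vx_gV]. *)
Definition gV (f : X -> X) v : vert X :=
  match pselect (is_vertex (f (vx v))) with left h => exist _ _ h | right _ => v end.

Lemma vx_gV f v : cellular (X := X) f -> vx (gV f v) = f (vx v).
Proof. by move=> cf; rewrite /gV; case: pselect => // -[]; apply: cellular_vertex (svalP v). Qed.

Lemma gVK f g : cellular (X := X) f -> cellular (X := X) g -> cancel f g -> cancel (gV f) (gV g).
Proof. by move=> cf cg fK v; apply: vx_inj; rewrite !vx_gV // fK. Qed.

Lemma gV_id : gV id = id.
Proof.
apply/funext => v; apply: vx_inj; rewrite vx_gV // => i; exists i, id => //.
split => //; split => // y cy; by exists y.
Qed.

Lemma cellular_comp f g : cellular (X := X) f -> cellular (X := X) g -> cellular (X := X) (f \o g).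
Proof.
move=> cf cg i; have [j [h [hb hh] hf]] := cg i; have [l [h' [hb' hh'] hf']] := cf j.
have hm : forall x, unit_cube x -> unit_cube (h x) by case: hb.
exists l, (h' \o h); last by move=> x cx; rewrite /= hf // hf' //; exact: hm.
split; first exact: set_bij_comp hb hb'.
by move=> x y cx cy /=; rewrite hh' ?hh //; exact: hm.
Qed.

Lemma gV_comp f g : cellular (X := X) f -> cellular (X := X) g -> gV (f \o g) = gV f \o gV g.
Proof.
by move=> cf cg; apply/funext => v; apply: vx_inj; rewrite /= !vx_gV //; exact: cellular_comp.
Qed.

Section Automorphism.
Variables (f g : X -> X).
Hypotheses (fK : cancel f g) (gK : cancel g f) (cf : cellular (X := X) f) (cg : cellular (X := X) g).

Lemma gV_corner i : exists j (h : 'rV[R]_(dim i) -> 'rV[R]_(dim j)),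
  [/\ isometry_onto (@unit_cube R (dim i)) (@unit_cube R (dim j)) h,
   forall x, unit_cube x -> f (chart i x) = chart j (h x),
   forall b, exists b', gV f (@crnV R X i b) = @crnV R X j b' /\ h (ptv b) = ptv b' &
   forall b', exists b, gV f (@crnV R X i b) = @crnV R X j b'].
Proof.
have [j [h hi hf]] := cf i; have [hb hh] := hi; have [hm _ hs] := hb.
exists j, h; split => // b.
  have [|b' eb] := @vertexP R X j (gV f (@crnV R X i b)).
    by rewrite vx_gV // /= /crn hf; last exact: ptv_cube; apply: cellI; exact/hm/ptv_cube.
  exists b'; split => //; apply: (@chart_inj R X j); rewrite ?inE; try exact: ptv_cube.
    exact/hm/ptv_cube.
  by rewrite -hf; last exact: ptv_cube; move/(congr1 (@vx R X)): eb; rewrite vx_gV.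
have [y cy ey] := hs _ (@ptv_cube R _ b).
have [|b' eb] := @vertexP R X i (gV g (@crnV R X j b)).
  by rewrite vx_gV // /= /crn -ey -hf // fK; exact: cellI.
by exists b'; rewrite -eb (gVK cg cf gK).
Qed.

Lemma gV_flip i j (h : 'rV[R]_(dim i) -> 'rV[R]_(dim j)) b b' k :
  isometry_onto (@unit_cube R (dim i)) (@unit_cube R (dim j)) h ->
  (forall b, exists b', gV f (@crnV R X i b) = @crnV R X j b' /\ h (ptv b) = ptv b') ->
  gV f (@crnV R X i b) = crnV b' -> h (ptv b) = ptv b' ->
  exists k', [/\ gV f (crnV (flip b k)) = crnV (flip b' k'), h (ptv (flip b k)) = ptv (flip b' k') &
    forall x, unit_cube x -> cdist b' k' (h x) = cdist b k x].
Proof.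
move=> [_ hh] hc e1 e2; have [b1 [e3 e4]] := hc (flip b k).
have [|k' ek] := @ed2_1 R _ b' b1.
  by rewrite -e2 -e4 -(ed2_flip b k); apply/ed_eq; apply: hh; exact: ptv_cube.
exists k'; rewrite -ek; split => // x cx.
rewrite !cdistE -ek -e2 -e4; congr ((_ - _ + _) / _); apply/ed_eq; apply: hh => //; exact: ptv_cube.
Qed.

Lemma gV_adj u v : adjV u v -> adjV (gV f u) (gV f v).
Proof.
move=> [i [b [k [-> ->]]]]; have [j [h [hi hf hc _]]] := gV_corner i.
have [b' [e1 e2]] := hc b; have [k' [e3 _ _]] := gV_flip k hi hc e1 e2.
by exists j, b', k'.
Qed.

Lemma dX_adj u v : adjV u v -> dX u v = 1%N.
Proof. by move=> /(dX_bip hX u) []; rewrite dX_xx // => ->. Qed.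

Lemma gV_dX_le u v : (dX (gV f u) (gV f v) <= dX u v)%N.
Proof.
move e : (dX u v) => n; elim: n v e => [|n IH] v e; first by rewrite (dX_eq0 e) dX_xx.
have [w wv e'] := dX_step e; have := IH _ e'; have := dX_tri hX (gV f u) (gV f w) (gV f v).
by rewrite (dX_adj (gV_adj wv)); lia.
Qed.
End Automorphism.

Section AutomorphismImages.
Variables (f g : X -> X).
Hypotheses (fK : cancel f g) (gK : cancel g f) (cf : cellular (X := X) f) (cg : cellular (X := X) g).

Lemma gV_dX u v : dX (gV f u) (gV f v) = dX u v.
Proof.
apply/eqP; rewrite eqn_leq (gV_dX_le fK gK) //=.
have := gV_dX_le gK fK cg cf (gV f u) (gV f v).
by rewrite !(gVK cf cg fK).
Qed.

Lemma gV_WX u a : gV f @` WX u a = WX (gV f u) (gV f a).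
Proof.
apply/seteqP; split => [_ [v h <-]|v h]; first by rewrite /WX /W /= !gV_dX.
exists (gV g v); last exact: (gVK cg cf gK).
by move: h; rewrite /WX /W /= -{1 2}[v](gVK cg cf gK) !gV_dX.
Qed.

Lemma gV_HS B : HS B -> HS (gV f @` B).
Proof.
move=> [u [a [ua eB]]]; exists (gV f u), (gV f a); split; first exact: (gV_adj fK gK).
by rewrite eB; exact: gV_WX.
Qed.

Lemma gV_tc B p : HS B -> tc (gV f @` B) (f p) = tc B p.
Proof.
move=> hB; have hg := gV_HS hB; have imB v : (gV f @` B) (gV f v) <-> B v.
  by rewrite (imE _ _ (gVK cf cg fK) (gVK cg cf gK)) (gVK cf cg fK).
have [i [x cx <-]] := chart_cover R X p; have [j [h [hi hf hc hs]]] := gV_corner fK gK cf cg i.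
have ch : unit_cube (h x) by case: hi => -[hm _ _] _; exact: hm.
rewrite hf //; have [[a ->]|[a ->]|[b [k [h1 h2 ->]]]] := tc_cases hB cx.
- by apply: tc_all => // b'; have [b <-] := hs b'; apply/imB.
- by apply: tc_none => // b'; have [b <-] := hs b'; move/imB; exact: a.
have [b' [e1 e2]] := hc b; have [k' [e3 _ <-]] := gV_flip k hi hc e1 e2 => //.
by apply: tc_edge => //; rewrite -?e1 -?e3; [move/imB|apply/imB].
Qed.

Lemma Hsp_image B : HS B -> f @` Hsp B = Hsp (gV f @` B).
Proof.
move=> hB; apply/seteqP; split => [_ [p h <-]|p]; first by rewrite /Hsp /= gV_tc.
by rewrite /Hsp /= -[p](gK) gV_tc // => h; exists (g p).
Qed.
End AutomorphismImages.

(** An edge determines the half-space it crosses, so no edge enters B and C at once when B is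
    properly contained in C. Hence every cell that B meets has all its corners in C. In a chain of
    half-spaces, therefore, at most one coordinate of a point is fractional. *)
Lemma tc_sub B C p : HS B -> HS C -> B `<=` C -> B <> C -> 0 < tc B p -> tc C p = 1.
Proof.
move=> hB hC BC neBC; have [i [x cx <-]] := chart_cover R X p.
have [[h _]|[h ->]|[b [k [h1 h2 ->]]]] := tc_cases hB cx.
- by move=> _; apply: tc_all => // b; exact: BC.
- by rewrite ltxx.
have hb : C (crnV b).
  apply: contrapT => nb; have a1 : adjV (crnV b) (@crnV R X i (flip b k)) by exists i, b, k.
  by apply: neBC; rewrite (HS_edge hB a1 h1 h2) (HS_edge hC a1 nb (BC _ h2)).
move=> _; apply: tc_all => // b'; apply: contrapT => nb'.
have bk := crossing_cell hB h1 h2.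
have bk' : b' k = b k by apply: contrapT => e; apply: nb'; apply: BC; apply/bk.
have a1 := @W_cell _ _ hX i b b' k (esym bk').
have h2' : B (crnV (flip b' k)) by apply/bk; rewrite flip_self bk'; case: (b k).
have aa : adjV (crnV b') (@crnV R X i (flip b' k)) by exists i, b', k.
have ab : adjV (crnV b) (@crnV R X i (flip b k)) by exists i, b, k.
have eC := HS_edge hC aa nb' (BC _ h2').
by apply: (@WX_l _ _ hX (crnV b) (crnV (flip b k))); rewrite a1 -eC.
Qed.

Lemma Hsp_sub B C : HS B -> HS C -> B `<=` C -> Hsp B `<=` Hsp C.
Proof.
move=> hB hC BC p; rewrite /Hsp /=.
have [<-//|ne] := pselect (B = C); move=> h; rewrite (tc_sub hB hC BC ne); lra.
Qed.

Lemma Hsp_inj B C : HS B -> HS C -> Hsp B `<=` Hsp C -> B `<=` C.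
Proof.
move=> hB hC h v Bv; have := h (vx v); rewrite /Hsp /= !tc_vertex // (asboolT Bv) /=.
move=> /(_ _); case: asboolP => //= _ H; exfalso; have := H ltac:(lra); lra.
Qed.

Section Group.
Variable Gamma : set (X -> X).
Hypothesis gG : subgroup_of_Aut Gamma.

Definition GamV : set (vert X -> vert X) := gV @` Gamma.

Lemma Gamma_inv f : Gamma f -> exists g, [/\ Gamma g, cancel f g, cancel g f, cellular f & cellular g].
Proof.
case: gG => sA _ _ hi Gf; have [g [Gg fK gK]] := hi f Gf; exists g; split => //.
  by have [? []] := sA _ Gf.
by have [? []] := sA _ Gg.
Qed.

Lemma GamV_id : GamV id.
Proof. by case: gG => _ h _ _; exists id => //; exact: gV_id. Qed.

Lemma GamV_comp a b : GamV a -> GamV b -> GamV (a \o b).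
Proof.
move=> [f Gf <-] [g Gg <-]; have [_ [_ _ _ cf _]] := Gamma_inv Gf.
have [_ [_ _ _ cg _]] := Gamma_inv Gg.
by exists (f \o g); [case: gG => _ _ h _; exact: h|exact: gV_comp].
Qed.

Lemma GamV_inv a : GamV a -> exists b, [/\ GamV b, cancel a b & cancel b a].
Proof.
move=> [f Gf <-]; have [g [Gg fK gK cf cg]] := Gamma_inv Gf.
by exists (gV g); split; [exists g|exact: gVK|exact: gVK].
Qed.

Lemma GamV_HS a B : GamV a -> HS B -> HS (a @` B).
Proof. by move=> [f Gf <-]; have [g [Gg fK gK cf cg]] := Gamma_inv Gf; exact: (gV_HS fK gK). Qed.
End Group.
End Automorphisms.

(** * The length metric *)

Section Metric.
Context {R : realType} {X : cubeComplex R}.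
Hypothesis hX : CAT0_cube_complex X.
Implicit Types (i j : cell_index X) (u v w : vert X) (p q : X) (B C : set (vert X)).
Notation HS := (HS hX).
Notation WX := (WX hX).
Notation dX := (dX hX).
Notation tc := (tc (X := X)).

Lemma adj_string u v : adjV u v -> string (vx u) (vx v) 1.
Proof.
move=> [i [b [k [-> ->]]]]; apply: step_string; exists i, (ptv b), (ptv (flip b k)).
split; [exact: ptv_cube|exact: ptv_cube|by []|by []|].
by rewrite /euclid_dist -/(ed2 _ _) ed2_flip sqrtr1.
Qed.

Lemma vertex_string u v : string (vx u) (vx v) (dX u v)%:R.
Proof.
move e : (dX u v) => n; elim: n v e => [|n IH] v e; first by rewrite (dX_eq0 e); exact: string_nil.
have [w wv e'] := dX_step e; rewrite -natr1.
by apply: string_cat (IH _ e') _; exact: adj_string.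
Qed.

Lemma corner_string i (x : 'rV[R]_(dim i)) b : unit_cube x ->
  exists2 l, string (chart i x) (vx (@crnV R X i b)) l & l <= (dim i)%:R.
Proof.
move=> cx; exists (euclid_dist x (ptv b)).
  by apply: step_string; exists i, x, (ptv b); split => //; exact: ptv_cube.
have e : ed2 x (ptv b) <= (dim i)%:R.
  have -> : (dim i)%:R = \sum_(k < dim i) 1 :> R by rewrite sumr_const card_ord.
  apply: ler_sum => k _; rewrite ptvE; have /andP[h1 h2] := cx k.
  by case: (b k) => /=; nra.
have n2 : (dim i)%:R <= (dim i)%:R ^+ 2 :> R.
  by rewrite -natrX ler_nat; case: (dim i) => // n; rewrite expnS expn1 leq_pmulr.
apply: le_trans (ler_wsqrtr (le_trans e n2)) _.
by rewrite sqrtr_sqr ger0_norm.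
Qed.

Lemma string_ex p q : exists l, string p q l.
Proof.
have [i [x cx <-]] := chart_cover R X p; have [j [y cy <-]] := chart_cover R X q.
have [l1 h1 _] := corner_string (fun=> true) cx; have [l2 h2 _] := corner_string (fun=> true) cy.
exists (l1 + ((dX (@crnV R X i xpredT) (@crnV R X j xpredT))%:R + l2)).
by apply: string_cat h1 (string_cat (vertex_string _ _) (string_sym h2)).
Qed.

Lemma lengths_inf p q : has_inf [set l | string p q l].
Proof.
split; first exact: string_ex.
by exists 0 => l /string_ge0.
Qed.

Lemma dist_le p q l : string p q l -> dist p q <= l.
Proof. by move=> h; apply: ge_inf => //; exact: (lengths_inf p q).2. Qed.

Lemma dist_lb p q c : (forall l, string p q l -> c <= l) -> c <= dist p q.
Proof. by move=> h; apply: lb_le_inf; [exact: string_ex|move=> l; exact: h]. Qed.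

Lemma dist_ge0 p q : 0 <= dist p q.
Proof. by apply: dist_lb => l; exact: string_ge0. Qed.

Lemma dist_near p q e : 0 < e -> exists2 l, string p q l & l < dist p q + e.
Proof. by move=> e0; exact: inf_adherent e0 (lengths_inf p q). Qed.

Lemma dist_sym p q : dist p q = dist q p.
Proof. by congr inf; apply/seteqP; split => l /string_sym. Qed.

Lemma dist_tri p q r : dist p r <= dist p q + dist q r.
Proof.
apply/ler_addgt0Pr => e e0; have e2 : 0 < e / 2 by lra.
have [l pq lq] := dist_near p q e2; have [m qr mr] := dist_near q r e2.
by apply: le_trans (dist_le (string_cat pq qr)) _; lra.
Qed.

Lemma dist_xx p : dist p p = 0.
Proof. by apply/eqP; rewrite eq_le dist_ge0 andbT; apply: dist_le; exact: string_nil. Qed.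

Lemma dist_vertex u v : dist (vx u) (vx v) <= (dX u v)%:R.
Proof. by apply: dist_le; exact: vertex_string. Qed.

Lemma dist_corner i (x : 'rV[R]_(dim i)) b : unit_cube x ->
  dist (chart i x) (vx (@crnV R X i b)) <= (dim i)%:R.
Proof. by move=> cx; have [l h le] := corner_string b cx; apply: le_trans le; exact: dist_le. Qed.

(** The corner obtained by rounding all fractional coordinates towards x0. *)
Lemma lower_corner x0 i (x : 'rV[R]_(dim i)) : unit_cube x -> exists b,
  forall B, HS B -> ~ B x0 -> (B (@crnV R X i b) <-> tc B (chart i x) = 1).
Proof.
move=> cx; pose c : 'I_(dim i) -> bool := fun=> false.
pose D k := WX (crnV c) (@crnV R X i (flip c k)).
(* [D k] is the side of direction k where the coordinate is 1, so a fractional coordinate is rounded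
   up exactly when x0 lies there. *)
exists (fun k => if x 0 k == 0 then false else if x 0 k == 1 then true else `[< D k x0 >]).
move=> B hB nB; set b := (fun k => _).
have [[h ->]|[h ->]|[b' [k [h1 h2 ->]]]] := tc_cases hB cx.
- by split.
- by split=> [/h|]//; lra.
have bk := crossing_cell hB h1 h2 b; rewrite bk /b /cdist.
have [x00|x0n] := eqVneq (x 0 k) 0; first by rewrite x00; case: (b' k); split => //; lra.
have [x01|x1n] := eqVneq (x 0 k) 1; first by rewrite x01; case: (b' k); split => //; lra.
have a1 : adjV (crnV b') (@crnV R X i (flip b' k)) by exists i, b', k.
have eB := HS_edge hB a1 h1 h2.
case eb' : (b' k).
  split; last by move=> h; case/eqP: x0n; lra.
  have e1 : flip b' k k = c k by rewrite flip_self eb'.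
  have := @W_cell _ _ hX i _ _ k e1; rewrite flipK -(WX_compl hX a1) -eB => e2.
  by rewrite asboolT // /D -e2.
split; last by move=> h; case/eqP: x1n.
have e1 : b' k = c k by rewrite eb'.
have := @W_cell _ _ hX i _ _ k e1; rewrite -eB => e2.
by rewrite asboolF // /D -e2.
Qed.

(** The coordinates equal to 1 determine the lower corner, so p and q have the same one. A direction
    at this corner in which p has moved has nonzero coordinate at q as well, hence is a direction of
    j. *)
Lemma same_cell j p q : (forall B, HS B -> tc B p = 1 <-> tc B q = 1) ->
  (forall B, HS B -> tc B p = 0 <-> tc B q = 0) -> cell j q -> cell j p.
Proof.
have [i [x cx <-]] := chart_cover R X p => h h0 [y cy ey]; subst q.
have [b hb] := lower_corner (@crnV R X i (fun=> true)) cx.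
have [b' hb'] := lower_corner (@crnV R X i (fun=> true)) cy.
have ebb : @crnV R X i b = @crnV R X j b'.
  have same B : HS B -> B (@crnV R X i b) <-> B (@crnV R X j b').
    move=> hB; have [bB|bB] := pselect (B (@crnV R X i (fun=> true))); last first.
      by rewrite hb // hb' // h.
    have hC := HS_compl hB; have nn : ~ (~` B) (@crnV R X i (fun=> true)) by apply.
    have := hb _ hC nn; have := hb' _ hC nn; rewrite -h // => <- e.
    by split=> h1; apply: contrapT => h2; [apply: (proj2 e h2)|apply: (proj1 e h2)].
  apply: (@dX_eq0 _ _ hX); rewrite -size_sepX; apply/eqP; rewrite size_eq0.
  case es : (sepX _ _ _) => [//|B s].
  have : B \in sepX hX (crnV b) (crnV b') by rewrite es mem_head.
  by move=> /mem_sepX [hB n1]; rewrite -same.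
have jb : cell j (@crn R X i b) by move/(congr1 (@vx R X)): ebb => /= ->; exact: crn_cell.
have [s hs] := inter_face (crn_cell b) jb; apply/hs => //; split => // k c sk.
have sb := proj1 (face_ptv s b) (proj1 (hs _ (ptv_cube b)) jb) k c sk.
rewrite -sb; apply/cdist_eq0; apply: contrapT => nz.
have a1 : adjV (crnV b) (@crnV R X i (flip b k)) by exists i, b, k.
set B := WX (crnV b) (@crnV R X i (flip b k)).
have hB : HS B by exact: HS_W.
have nB : ~ B (crnV b) by exact: (@WX_l _ _ hX).
have pB : B (crnV (flip b k)) by exact: (@WX_r _ _ hX).
have := h0 _ hB; rewrite (tc_edge hB cx nB pB).
have [[h1 _]|[_ ->]|[d [m [h1 h2 _]]]] := tc_cases hB cy.
- by case: nB; rewrite ebb.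
- by move=> [_ /(_ erefl)].
move=> _; have hm := crossing_cell hB h1 h2.
have dm : b' m = d m by apply: contrapT => ne; apply: nB; rewrite ebb; apply/hm.
have h3 : B (crnV (flip b' m)) by apply/hm; rewrite flip_self dm; case: (d m).
have a2 : adjV (crnV b) (@crnV R X j (flip b' m)) by rewrite ebb; exists j, b', m.
have e2 : @crnV R X i (flip b k) = @crnV R X j (flip b' m).
  by apply: (WX_inj a1 a2); apply: (HS_edge hB a2 nB h3).
have jk : cell j (@crn R X i (flip b k)).
  by move/(congr1 (@vx R X)): e2 => /= ->; exact: crn_cell.
have := proj1 (face_ptv s (flip b k)) (proj1 (hs _ (ptv_cube _)) jk) k c sk.
by rewrite flip_self sb; case: (c).
Qed.

Lemma tc_separates p q : (forall B, HS B -> tc B p = tc B q) -> p = q.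
Proof.
have [j [z cz <-]] := chart_cover R X q => h.
have [|||y cy ey] := @same_cell j p (chart j z); first by move=> B hB; rewrite h.
- by move=> B hB; rewrite h.
- exact: cellI.
pose b : 'I_(dim j) -> bool := fun=> true; rewrite -ey; congr chart; apply: (@cdist_inj R _ b) => k.
have a1 : adjV (crnV b) (@crnV R X j (flip b k)) by exists j, b, k.
have hB := HS_W hX a1.
have nB : ~ WX (crnV b) (@crnV R X j (flip b k)) (crnV b) by exact: (@WX_l _ _ hX).
have pB : WX (crnV b) (@crnV R X j (flip b k)) (crnV (flip b k)) by exact: (@WX_r _ _ hX).
by rewrite -(tc_edge hB cy nB pB) -(tc_edge hB cz nB pB) ey h.
Qed.

(** * Essential actions and the two alternatives *)

Section Reduction.
Variable Gamma : set (X -> X).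
Hypothesis gG : subgroup_of_Aut Gamma.
Hypothesis fd : finite_dimensional X.
Hypothesis es : acts_essentially Gamma.

Lemma half_space_Hsp B : HS B -> half_space (Hsp B).
Proof. by move=> hB; exists [set p | tc B p = 2^-1]; apply/half_space_ofP; exists B. Qed.

Lemma Hsp_complementary B : HS B -> complementary (Hsp B) (Hsp (~` B)).
Proof.
move=> hB; have hC := HS_compl hB; split.
  move=> e; have [v Bv] := HS_ex hB.
  have : Hsp B `<=` Hsp (~` B) by rewrite e.
  by move=> /(Hsp_inj hB hC) /(_ v Bv).
exists [set p | tc B p = 2^-1]; split; apply/(half_space_ofP hX); first by exists B.
exists (~` B); split => //; apply/seteqP; split => z /=; rewrite tc_compl //; lra.
Qed.

(** If only finitely many translates missed y, all of them would come within some n of y. Moving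
    back by f, every f y would be within n of A, against essentiality. *)
Lemma translates_infinite A y : HS A ->
  infinite_set [set B | (exists2 g, GamV Gamma g & B = g @` A) /\ ~ B y].
Proof.
move=> hA; set F := [set B | _] => /finite_seqP [s eF].
apply: (es (x := vx y) (half_space_Hsp hA)).
have [n hn] : exists n : nat, forall B, B \in s -> forall v, B v -> exists2 w, B w & (dX y w <= n)%N.
  elim: (s) => [|B s' [n IH]]; first by exists 0%N.
  have [[v Bv]|no] := pselect (exists v, B v); last first.
    by exists n => C; rewrite inE => /orP[/eqP -> v Bv|/IH //]; case: no; exists v.
  exists (maxn n (dX y v)) => C; rewrite inE => /orP[/eqP -> _ _|Cs w Cw].
    by exists v => //; rewrite leq_maxr.
  by have [z Cz hz] := IH _ Cs _ Cw; exists z => //; rewrite leq_max hz.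
exists n%:R => _ [f Gf <-].
have [g [Gg fK gK cf cg]] := Gamma_inv gG Gf.
have ev : f (vx y) = vx (gV f y) by rewrite vx_gV.
have HA v : A v -> Hsp A (vx v) by move=> Av; rewrite /Hsp /= tc_vertex // asboolT //=; lra.
have [Ay|nAy] := pselect (A (gV f y)).
  by exists (f (vx y)); [rewrite ev; exact: HA|rewrite dist_xx].
have [v Av] := HS_ex hA.
have FB : F (gV g @` A).
  split; first by exists (gV g) => //; exists g.
  by move/(imE _ _ (gVK cg cf gK) (gVK cf cg fK)).
move: FB; rewrite eF /= => /hn /(_ (gV g v)) [|w [z Az <-] hz]; first by exists v.
exists (vx z); first exact: HA.
have -> : vx z = f (vx (gV g z)) by rewrite -vx_gV // (gVK cg cf gK).
rewrite Aut_dist; last by exists g.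
by apply: le_trans (dist_vertex _ _) _; rewrite ler_nat.
Qed.

Lemma flip_or_spread h : half_space h ->
  (exists2 hstar : set X, complementary h hstar &
    exists2 gamma, Gamma gamma & (hstar `<` gamma @` h)%classic) \/
  exists K U x r f, spread HS (GamV Gamma) K U x r f.
Proof.
move=> [H /(half_space_ofP hX) [D [hD _ ->]]].
have hA := HS_compl hD; have [N dN] := fd; have [y _] := HS_ex hD.
have [[f Gf [nm ne]]|no] := pselect (exists2 f, Gamma f &
    ~ meets (~` D) (gV f @` (~` D)) /\ gV f @` (~` D) <> D).
  left; exists (Hsp (~` D)); first exact: Hsp_complementary.
  have [g [Gg fK gK cf cg]] := Gamma_inv gG Gf.
  have hfD := gV_HS fK gK cf cg hD.
  have vK := gVK cf cg fK; have vK' := gVK cg cf gK.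
  exists f => //; rewrite (Hsp_image (hX := hX) fK gK cf cg hD).
  have sub : ~` D `<=` gV f @` D.
    move=> v nv; apply: contrapT => n2; apply: nm; exists v => //.
    by rewrite (im_compl _ vK vK').
  split; first exact: Hsp_sub sub.
  (* Equality would make f carry the complement of D onto D. *)
  move=> /(Hsp_inj hfD hA) sub2; apply: ne.
  rewrite (im_compl _ vK vK') -[RHS]setCK; congr (~` _); exact/seteqP.
have Hc := @spread_ex (vert X) HS (sepX hX) N (HS_compl (hX := hX)) (HS_ex (hX := hX)) (mem_sepX hX)
  (realizeX (hX := hX)) (antichain_boundX (hX := hX) dN) (GamV Gamma) (GamV_id gG) (GamV_comp gG) (GamV_inv gG)
  (GamV_HS gG (hX := hX)) (~` D) y hA.
right; apply: Hc; last exact: translates_infinite.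
move=> _ [f Gf <-]; have [mt|mt] := pselect (meets (~` D) (gV f @` (~` D))); first by left.
right; rewrite setCK; apply: contrapT => ne; apply: no; exists f => //.
Qed.
End Reduction.
End Metric.

(** * The diagonal subcomplex *)

Lemma In_mapP (T : eqType) (V : Type) (h : T -> V) (s : seq T) a :
  List.In a [seq h t | t <- s] <-> exists2 t, t \in s & a = h t.
Proof.
elim: s => [|t s IH] /=; first by split => // -[].
split=> [[<-|al]|[t' + ea]].
- by exists t; rewrite ?mem_head.
- by have [t' ts ->] := proj1 IH al; exists t' => //; rewrite inE ts orbT.
rewrite inE => /orP[/eqP ett|ts]; first by left; rewrite ea ett.
by right; apply/IH; exists t'.
Qed.

Section Diagonal.
Context {R : realType} {X : cubeComplex R}.
Hypothesis hX : CAT0_cube_complex X.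
Implicit Types (i j e : cell_index X) (u v w : vert X) (p q : X) (B C : set (vert X)).
Notation HS := (HS hX).
Notation WX := (WX hX).
Notation dX := (dX hX).
Notation tc := (tc (X := X)).
Variable Gamma : set (X -> X).
Hypothesis gG : subgroup_of_Aut Gamma.
Variables (K U : set (set (vert X))) (x : vert X) (r : nat) (f : nat -> vert X -> vert X).
Hypothesis S : spread HS (GamV Gamma) K U x r f.

Definition G (m : nat) b := f m @` b.

Lemma f_inv m : (m < r)%N -> exists g, [/\ GamV Gamma g, cancel (f m) g & cancel g (f m)].
Proof. by move=> mr; apply: (GamV_inv gG); exact: (sp_Gam S). Qed.

Lemma G_HS m b : (m < r)%N -> U b -> HS (G m b).
Proof.
by move=> mr Ub; apply: (GamV_HS gG); [exact: (sp_Gam S)|exact/(sp_hs S)/(sp_UK S)].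
Qed.

Lemma G_x m b : (m < r)%N -> U b -> ~ G m b x.
Proof. by move=> mr Ub; apply/(sp_U S mr (sp_UK S Ub)). Qed.

Lemma G_inj m (b c : set (vert X)) : (m < r)%N -> G m b = G m c -> b = c.
Proof. by move=> mr; have [g [_ gK _]] := f_inv mr; exact: im_inj gK. Qed.

Lemma G_disj m n (b c : set (vert X)) : (m < r)%N -> (n < r)%N -> U b -> U c -> G m b = G n c -> m = n /\ b = c.
Proof.
move=> mr nr Ub Uc e; have [mn|mn] := pselect (m = n).
  by split => //; move: e; rewrite mn; exact: G_inj.
by case: (sp_disj S mr nr mn Ub); rewrite -/(G m b) e; exists c => //; exact: (sp_UK S).
Qed.

Lemma G_up m b C : (m < r)%N -> U b -> HS C -> ~ C x -> G m b `<=` C ->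
  exists c, [/\ U c, C = G m c & b `<=` c].
Proof.
move=> mr Ub hC nC bC; have [g [Gg fK gK]] := f_inv mr.
have e : C = G m (g @` C) by rewrite /G im_can.
have bc : b `<=` g @` C by move=> z bz; exists (f m z); [apply: bC; exists z|rewrite fK].
exists (g @` C); split => //; apply/(sp_U S mr); last by rewrite -/(G _ _) -e.
exact: (sp_up S (sp_UK S Ub) (GamV_HS gG Gg hC)).
Qed.

Lemma G_meets m n (b c : set (vert X)) : (m < r)%N -> (n < r)%N -> U b -> U c -> meets (G m b) (G n c).
Proof.
by move=> mr nr Ub Uc; apply: (sp_meets S); try exact: (sp_UK S); exact: (sp_Gam S).
Qed.

(** Seen from x, the vertex has crossed the same members of U in each of the r factors, and nothing
    else. *)
Definition diagonal_vertex (u : seq (set (vert X))) v := forall B, HS B -> ~ B x ->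
  (B v <-> exists m b, [/\ (m < r)%N, b \in u & B = G m b]).

Lemma diagonal_vertex_ex (u : seq (set (vert X))) : ideal U u ->
  exists v, diagonal_vertex u v.
Proof.
move=> [uu uU uup]; pose s := undup [seq G m b | m <- iota 0 r, b <- u].
have ms B : B \in s <-> exists m b, [/\ (m < r)%N, b \in u & B = G m b].
  rewrite mem_undup; split.
    by move=> /allpairsP [[m b] /= []]; rewrite mem_iota add0n => mr bu ->; exists m, b.
  move=> [m [b [mr bu ->]]]; apply/allpairsP; exists (m, b) => /=.
  by rewrite mem_iota add0n.
have [||||v hv] := @realizeX _ _ hX x s.
- exact: undup_uniq.
- by move=> B /ms [m [b [mr /uU Ub ->]]]; split; [exact: G_HS|exact: G_x].
- by move=> B C /ms [m [b [mr /uU Ub ->]]] /ms [n [c [nr /uU Uc ->]]]; exact: G_meets.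
- move=> B C /ms [m [b [mr bu ->]]] hC nC sC; have Ub := uU _ bu.
  have [c [Uc -> bc]] := G_up mr Ub hC nC sC.
  by apply/ms; exists m, c; split => //; exact: uup bc.
by exists v => B hB nB; rewrite hv.
Qed.

(** The half-space crossed by the direction k of c, oriented away from x. *)
Definition dirHS (c : cell_index X) (k : 'I_(dim c)) : set (vert X) :=
  let B := WX (@crnV R X c (fun=> false)) (crnV (flip (fun=> false) k)) in
  if `[< B x >] then ~` B else B.

Lemma dirHS_edge (c : cell_index X) k : [/\ HS (@dirHS c k), ~ dirHS k x & exists b,
  ~ dirHS k (@crnV R X c b) /\ dirHS k (crnV (flip b k))].
Proof.
set b0 : 'I_(dim c) -> bool := fun=> false.
have a0 : adjV (@crnV R X c b0) (crnV (flip b0 k)) by exists c, b0, k.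
rewrite /dirHS -/b0; case: asboolP => h; split.
- exact/HS_compl/HS_W.
- by apply.
- exists (flip b0 k); rewrite flipK; split; first by apply; exact: (@WX_r _ _ hX).
  exact: (@WX_l _ _ hX).
- exact: HS_W.
- exact: h.
- by exists b0; split; [exact: (@WX_l _ _ hX)|exact: (@WX_r _ _ hX)].
Qed.

Lemma dirHS_uniq (c : cell_index X) k B (b : 'I_(dim c) -> bool) : HS B -> ~ B x -> ~ B (crnV b) -> B (crnV (flip b k)) ->
  B = dirHS k.
Proof.
move=> hB nx nb hb; have [hD nD [d [nd hd]]] := dirHS_edge k.
have ad : adjV (crnV d) (@crnV R X c (flip d k)) by exists c, d, k.
have ab : adjV (crnV b) (@crnV R X c (flip b k)) by exists c, b, k.
have eB := HS_edge hB ab nb hb; have eD := HS_edge hD ad nd hd.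
have [e|ne] := eqVneq (b k) (d k); first by rewrite eB eD; exact: W_cell.
have e1 : flip b k k = d k by rewrite flip_self; move: ne; case: (b k); case: (d k).
have := @W_cell _ _ hX c _ _ k e1; rewrite flipK -eD -(WX_compl hX ab) -eB => e2.
by case: nD; rewrite -e2.
Qed.

Lemma dirHS_inj (c : cell_index X) : injective (@dirHS c).
Proof.
move=> k m e; apply/eqP/negPn/negP => km; have [hD _ [b [nb hb]]] := dirHS_edge k.
have [hD' _ [d [nd hd]]] := dirHS_edge m; rewrite -e in hD' nd hd.
have h := crossing_cell hD' nd hd.
by apply: nb; apply/h; move/h: hb; rewrite flip_other // eq_sym.
Qed.

Lemma tc_dir B (c : cell_index X) (z : 'rV[R]_(dim c)) : HS B -> ~ B x -> unit_cube z ->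
  [\/ (forall b, B (@crnV R X c b)) /\ tc B (chart c z) = 1,
      (forall b, ~ B (@crnV R X c b)) /\ tc B (chart c z) = 0 |
      exists k : 'I_(dim c), B = dirHS k].
Proof.
move=> hB nx cz; have [h|h|[b [k [nb hb _]]]] := tc_cases hB cz.
- by constructor 1.
- by constructor 2.
- by constructor 3; exists k; exact: dirHS_uniq nb hb.
Qed.

Lemma dirHS_sub (c : cell_index X) k (z z' : 'rV[R]_(dim c)) : unit_cube z -> unit_cube z' ->
  (tc (dirHS k) (chart c z) - tc (dirHS k) (chart c z')) ^+ 2 = (z 0 k - z' 0 k) ^+ 2.
Proof.
move=> cz cz'; have [hD _ [b [nb hb]]] := dirHS_edge k.
rewrite (tc_edge hD cz nb hb) (tc_edge hD cz' nb hb).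
by rewrite -real_normK ?num_real // cdist_sub real_normK ?num_real.
Qed.

Definition own (c : cell_index X) (m : nat) (k : 'I_(dim c)) : bool := `[< exists2 b, U b & dirHS k = G m b >].

(** These members of U have been crossed before entering c; they locate the corner v of the target
    cell in [diagonal_cell]. *)
Lemma full_ideal (c : cell_index X) m : (m < r)%N -> exists u : seq (set (vert X)), ideal U u /\
  forall b, b \in u <-> U b /\ forall d, G m b (@crnV R X c d).
Proof.
move=> mr; have [g [Gg fK gK]] := f_inv mr.
pose b0 : 'I_(dim c) -> bool := fun=> false.
pose s := [seq B <- sepX hX x (@crnV R X c b0) |
  `[< (exists2 b, U b & B = G m b) /\ forall d, B (@crnV R X c d) >]].
have mu b : b \in undup [seq g @` B | B <- s] <-> U b /\ forall d, G m b (@crnV R X c d).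
  rewrite mem_undup; split.
    move=> /mapP [B]; rewrite mem_filter => /andP[/asboolP [[b' Ub ->] h] _ ->].
    by rewrite /G (im_can _ fK).
  move=> [Ub h]; apply/mapP; exists (G m b); last by rewrite /G (im_can _ fK).
  rewrite mem_filter; apply/andP; split; first by apply/asboolP; split => //; exists b.
  by apply/mem_sepX; split; [exact: G_HS|exact: G_x|exact: h].
exists (undup [seq g @` B | B <- s]); split => //; split; first exact: undup_uniq.
- by move=> b /mu [].
- move=> b b' /mu [Ub h] Ub' bb'; apply/mu; split => // d.
  by have := h d; apply: image_subset.
Qed.

Lemma diagonal_cell (c : cell_index X) m : (m < r)%N -> exists e (phi : 'rV[R]_(dim c) -> 'rV[R]_(dim e)),
  [/\ forall z, unit_cube z -> unit_cube (phi z),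
    forall z n b, unit_cube z -> (n < r)%N -> U b ->
      tc (G n b) (chart e (phi z)) = tc (G m b) (chart c z),
    forall z B, unit_cube z -> HS B -> ~ B x ->
      (forall n b, (n < r)%N -> U b -> B <> G n b) -> tc B (chart e (phi z)) = 0 &
    forall z z', unit_cube z -> unit_cube z' ->
      ed2 (phi z) (phi z') <= r%:R * \sum_(k < dim c | own m k) (z 0 k - z' 0 k) ^+ 2].
Proof.
move=> mr; have [u [iu mu]] := full_ideal c mr.
have [uu uU uup] := iu; have [v hv] := diagonal_vertex_ex iu.
pose P (t : 'I_r * 'I_(dim c)) := own m t.2.
have nbr (t : 'I_r * 'I_(dim c)) : exists w, P t -> adjV v w /\
    exists b, [/\ U b, dirHS t.2 = G m b & WX v w = G t.1 b].
  have [/asboolP [b Ub eb]|nP] := boolP (P t); last by exists v => Pt; case/negP: nP.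
  have [hD nD [d [nd hd]]] := dirHS_edge t.2; rewrite eb in hD nD nd hd.
  have tr := ltn_ord t.1.
  have hT := G_HS tr Ub; have nT := G_x tr Ub.
  have nv : ~ G t.1 b v.
    move=> /(hv _ hT nT) [n [b' [nr bu e]]]; have [_ e2] := G_disj tr nr Ub (uU _ bu) e.
    by rewrite -e2 in bu; move/mu: bu => [_ /(_ d)].
  (* To see that [G t.1 b] is crossed by an edge at v, let C contain it and miss v. C misses x as
     well, for its complement would otherwise be crossed by v and fail to meet [G t.1 b]. So C is
     some [G t.1 b'], where [G m b'] does not contain all of c and thus crosses c; it does so in the
     direction of [G m b], since otherwise a corner of c would lie in [G m b] only. *)
  have [C hC nC bC|w vw ew] := adjacent_of_minimalX hT nv.
    have [Cx|Cx] := pselect (C x).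
      have hC' := HS_compl hC; have [n [b' [nr bu e]]] : exists n b', [/\ (n < r)%N, b' \in u & ~` C = G n b'].
        by apply/(hv _ hC' (fun h : ~ C x => h Cx)); exact: nC.
      have [z z1 z2] := G_meets tr nr Ub (uU _ bu).
      by rewrite -e in z2; case: z2; apply: bC.
    have [b' [Ub' eC bb']] := G_up tr Ub hC Cx bC.
    have sub : G m b `<=` G m b' by exact: image_subset.
    have nx' := G_x mr Ub'; have hC' := G_HS mr Ub'.
    have nall : ~ forall d, G m b' (@crnV R X c d).
      by move=> h; apply: nC; apply/hv => //; exists t.1, b'; split => //; apply/mu.
    suff e : G m b' = G m b by rewrite eC (G_inj mr e).
    rewrite -eb.
    have [[h _]|[h _]|[k ek]] := tc_dir hC' nx' (@ptv_cube R _ d); first by case: nall.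
      by case: (h _ (sub _ hd)).
    rewrite ek; have [_ _ [d2 [nd2 hd2]]] := dirHS_edge k; rewrite -ek in nd2 hd2.
    have h2 := crossing_cell hC' nd2 hd2; have h1 := crossing_cell hD nd hd.
    have [->//|kt] := eqVneq k t.2; exfalso.
    pose d3 l := if l == k then d2 k else ~~ d l.
    have : G m b (crnV d3) by apply/h1; rewrite /d3 eq_sym (negPf kt); case: (d _).
    by move=> /sub /h2; rewrite /d3 eqxx.
  by exists w => _; split => //; exists b.
have [nb hnb] := choice nbr.
pose l := [seq nb t | t <- enum P].
have inl a : List.In a l <-> exists2 t, P t & a = nb t.
  rewrite /l In_mapP; split=> -[t Pt ->]; exists t => //; first by rewrite mem_enum in Pt.
  by rewrite mem_enum.
have [||e [d [ed dl ld]]] := @flag_cube R X v l (@link_flag R X hX v).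
- by move=> a /inl [t Pt ->]; case: (hnb t Pt).
- move=> a a' /inl [t Pt ->] /inl [t' Pt' ->] ne.
  have [a1 [b [Ub _ e1]]] := hnb _ Pt; have [a2 [b' [Ub' _ e2]]] := hnb _ Pt'.
  have [z z1 z2] := G_meets (ltn_ord t.1) (ltn_ord t'.1) Ub Ub'.
  by apply: (WX_corner a1 a2 ne (v := z)); rewrite ?e1 ?e2.
have tau_ex k : exists t, P t /\ crnV (flip d k) = nb t.
  by have /inl [t Pt e1] := ld k; exists t.
have [tau htau] := choice tau_ex.
have tinj : injective tau.
  move=> k k' ek; have [_ e1] := htau k; have [_ e2] := htau k'.
  by apply: (@flip_inj _ d); apply: (@crnV_inj R X); rewrite e1 e2 ek.
(* The case on [d k] makes the copied coordinate the distance to the face through v, so that it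
   vanishes at v. *)
pose phi (z : 'rV[R]_(dim c)) : 'rV[R]_(dim e) :=
  \row_k let t := tc (dirHS (tau k).2) (chart c z) in if d k then 1 - t else t.
have cphi z k : cdist d k (phi z) = tc (dirHS (tau k).2) (chart c z).
  by rewrite /cdist mxE; case: (d k) => //; rewrite opprB addrC subrK.
have edge_dir k B : HS B -> ~ B v -> B (crnV (flip d k)) -> exists b,
    [/\ U b, dirHS (tau k).2 = G m b & B = G (tau k).1 b].
  move=> hB nB; have [Pt e1] := htau k; rewrite e1 => Bn.
  have [a1 [b [Ub e2 e3]]] := hnb _ Pt; exists b; split => //.
  by rewrite -e3; exact: HS_edge.
have cubephi z : unit_cube z -> unit_cube (phi z).
  move=> cz k; have [hD _ _] := dirHS_edge (tau k).2; have := tc_itv (chart c z) hD.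
  by rewrite mxE; case: (d k) => /= /andP[h1 h2]; apply/andP; split; lra.
have full B z : unit_cube z -> HS B -> ~ B x -> B v -> tc B (chart e (phi z)) = 1.
  move=> cz hB nB Bv; have [[_ ->]|[h _]|[b [k [h1 h2 _]]]] := tc_cases hB (cubephi z cz) => //.
    by case: (h d); rewrite -ed.
  have hc := crossing_cell hB h1 h2; have dk : d k <> b k by apply/hc; rewrite -ed.
  have nB' : ~ B (crnV (flip d k)).
    by move/hc; rewrite flip_self; move: dk; case: (d k); case: (b k).
  have [||b' [Ub' _ e1]] := edge_dir k (~` B) (HS_compl hB); first by apply.
    exact: nB'.
  by have := G_x (ltn_ord (tau k).1) Ub'; rewrite -e1 => /(_ nB).
have part B z : unit_cube z -> HS B -> ~ B x -> ~ B v ->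
    ((forall b, ~ B (@crnV R X e b)) /\ tc B (chart e (phi z)) = 0) \/
    exists n b, [/\ (n < r)%N, U b, B = G n b & tc B (chart e (phi z)) = tc (G m b) (chart c z)].
  move=> cz hB nB nBv; have [[h _]|h|[b [k [h1 h2 _]]]] := tc_cases hB (cubephi z cz).
  - by case: nBv; rewrite ed.
  - by left.
  right; have hc := crossing_cell hB h1 h2.
  have dk : d k = b k by apply: contrapT => ne; apply: nBv; rewrite ed; apply/hc.
  have hB' : B (crnV (flip d k)) by apply/hc; rewrite flip_self dk; case: (b k).
  have [b' [Ub' e1 e2]] := edge_dir k B hB nBv hB'.
  exists (tau k).1, b'; split => //; rewrite ed in nBv.
  by rewrite (tc_edge hB (cubephi z cz) nBv hB') cphi e1.
exists e, phi; split => //.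
- move=> z n b cz nr Ub; have hB := G_HS nr Ub; have nB := G_x nr Ub.
  have hC := G_HS mr Ub; have nC := G_x mr Ub.
  have [Bv|nBv] := pselect (G n b v).
    rewrite full // tc_all // => d'.
    have [n' [b' [nr' bu e1]]] := proj1 (hv _ hB nB) Bv.
    have [_ e2] := G_disj nr nr' Ub (uU _ bu) e1.
    by rewrite -e2 in bu; case/mu: bu.
  have [[h ->]|[n' [b' [nr' Ub' e1 ->]]]] := part _ z cz hB nB nBv; last first.
    by have [_ ->] := G_disj nr nr' Ub Ub' e1.
  have [[h1 _]|[_ ->//]|[k ek]] := tc_dir hC nC cz.
    by case: nBv; apply/hv => //; exists n, b; split => //; apply/mu.
  have Pt : P (Ordinal nr, k) by apply/asboolP; exists b.
  have [a1 [b' [Ub' e2 e3]]] := hnb _ Pt; rewrite /= -ek in e2 e3.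
  have ebb := G_inj mr e2; rewrite -ebb in e3.
  have [k' ek'] : exists k', nb (Ordinal nr, k) = crnV (flip d k').
    by apply: dl; apply/inl; exists (Ordinal nr, k).
  by case: (h (flip d k')); rewrite -ek' -e3; exact: (@WX_r _ _ hX).
- move=> z B cz hB nB no; have [Bv|nBv] := pselect (B v).
    by have [n [b [nr bu e1]]] := proj1 (hv _ hB nB) Bv; case: (no n b nr (uU _ bu)).
  have [[_ ->//]|[n [b [nr Ub e1 _]]]] := part _ z cz hB nB nBv.
  by case: (no n b nr Ub).
(* tau embeds the directions of e into the pairs of a factor and a direction of c owned by m. *)
- move=> z z' cz cz'; pose F (t : 'I_r * 'I_(dim c)) := (z 0 t.2 - z' 0 t.2) ^+ 2.
  have -> : ed2 (phi z) (phi z') = \sum_k F (tau k).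
    apply: eq_bigr => k _; rewrite /F -(dirHS_sub (tau k).2 cz cz') -!cphi.
    by rewrite -[LHS]real_normK ?num_real // -(cdist_sub d) real_normK ?num_real.
  have -> : r%:R * \sum_(k < dim c | own m k) (z 0 k - z' 0 k) ^+ 2 = \sum_(t | P t) F t.
    rewrite /P /F -(pair_big predT (own m) (fun (_ : 'I_r) k => (z 0 k - z' 0 k) ^+ 2)) /=.
    by rewrite sumr_const card_ord mulr_natl.
  have -> : \sum_k F (tau k) = \sum_(t in [set tau k | k in predT]%SET) F t.
    by rewrite big_imset //= => k k' _ _; exact: tinj.
  rewrite [X in _ <= X](bigID (mem [set tau k | k in predT]%SET)) /=.
  rewrite [X in _ <= X + _](eq_bigl (mem [set tau k | k in predT]%SET)) ?lerDl.
    by apply: sumr_ge0 => t _; exact: sqr_ge0.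
  move=> t /=; case: (boolP (t \in _)); rewrite ?andbF // => /imsetP [k _ ->].
  by case: (htau k) => ->.
Qed.
End Diagonal.

Section DiagonalStrings.
Context {R : realType} {X : cubeComplex R}.
Hypothesis hX : CAT0_cube_complex X.
Implicit Types (i j e : cell_index X) (u v w : vert X) (p q : X) (B C : set (vert X)).
Notation HS := (HS hX).
Notation WX := (WX hX).
Notation dX := (dX hX).
Notation tc := (tc (X := X)).
Variable Gamma : set (X -> X).
Hypothesis gG : subgroup_of_Aut Gamma.
Variables (K U : set (set (vert X))) (x : vert X) (r : nat) (f : nat -> vert X -> vert X).
Hypothesis S : spread HS (GamV Gamma) K U x r f.
Notation G := (G f).

(** The point p' repeats the factor m of p in all factors and is 0 elsewhere. Half-spaces containing
    x are left to their complements. *)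
Definition projects (m : nat) p p' :=
  (forall n b, (n < r)%N -> U b -> tc (G n b) p' = tc (G m b) p) /\
  (forall B, HS B -> ~ B x -> (forall n b, (n < r)%N -> U b -> B <> G n b) -> tc B p' = 0).

Definition diagonal p := projects 0 p p.

Lemma projects_self m p : (m < r)%N -> diagonal p -> projects m p p.
Proof.
by move=> mr [h1 h2]; split => // n b nr Ub; rewrite h1 // [RHS]h1.
Qed.

Lemma projects_diagonal m p p' : projects m p p' -> diagonal p'.
Proof. by move=> [h1 h2]; split => // n b nr Ub; rewrite !h1 //; exact: sp_r S. Qed.

Lemma projects_uniq m p p1 p2 : projects m p p1 -> projects m p p2 -> p1 = p2.
Proof.
move=> [h1 h2] [h1' h2']; apply: (tc_separates (hX := hX)).
suff key B : HS B -> ~ B x -> tc B p1 = tc B p2.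
  move=> B hB; have [Bx|/key] := pselect (B x); last exact.
  have := key _ (HS_compl hB); rewrite !tc_compl // => h.
  have := h (fun n => n Bx); lra.
move=> hB nB; have [[n [b [nr Ub ->]]]|no] := pselect (exists n b, [/\ (n < r)%N, U b & B = G n b]).
  by rewrite h1 // h1'.
have no' n b : (n < r)%N -> U b -> B <> G n b by move=> nr Ub e; apply: no; exists n, b.
by rewrite h2 // h2'.
Qed.

Lemma projects_ex m p : (m < r)%N -> exists p', projects m p p'.
Proof.
move=> mr; have [c [z cz <-]] := chart_cover R X p.
have [e [phi [cphi h1 h2 _]]] := diagonal_cell gG S c mr.
exists (chart e (phi z)); split => [n b nr Ub|B hB nB no]; first exact: h1.
exact: h2.
Qed.

(** A direction of c belongs to at most one factor, by [G_disj]. *)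
Lemma own_sum (c : cell_index X) (s : 'I_(dim c) -> R) : (forall k, 0 <= s k) ->
  \sum_(m < r) \sum_(k < dim c | own hX U x f m k) s k <= \sum_k s k.
Proof.
move=> s0; rewrite (exchange_big_dep predT) //=; apply: ler_sum => k _.
have [[m0 h0]|no] := pselect (exists m : 'I_r, own hX U x f m k); last first.
  by rewrite big_pred0 // => m; apply/negP => h; apply: no; exists m.
rewrite (big_pred1 m0) // => m; apply/idP/eqP => [h|-> //].
move: h0 h => /asboolP [b Ub eb] /asboolP [b' Ub' eb'].
have := G_disj gG S (ltn_ord m) (ltn_ord m0) Ub' Ub.
by rewrite -eb -eb' => -[] // /val_inj.
Qed.

Lemma projects_step p q l : step p q l -> exists lam : nat -> R,
  \sum_(m < r) lam m <= r%:R * l /\ forall m, (m < r)%N ->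
    exists p' q', [/\ projects m p p', projects m q q' & step p' q' (lam m)].
Proof.
move=> [c [z [z' [cz cz' <- <- el]]]].
pose s (k : 'I_(dim c)) := (z 0 k - z' 0 k) ^+ 2.
have lam_ex (m : nat) : exists lm : R, (m < r)%N -> [/\ 0 <= lm,
    lm ^+ 2 <= r%:R * \sum_(k < dim c | own hX U x f m k) s k &
    exists p' q', [/\ projects m (chart c z) p', projects m (chart c z') q' & step p' q' lm]].
  have [mr|] := boolP (m < r)%N; last by exists 0.
  have [e [phi [cphi h1 h2 h3]]] := diagonal_cell gG S c mr.
  exists (euclid_dist (phi z) (phi z')) => _; split.
  - exact: ed_ge0.
  - by rewrite ed_ed2; exact: h3.
  exists (chart e (phi z)), (chart e (phi z')); split.
  - by split=> [n b nr Ub|B hB nB no]; [exact: h1|exact: h2].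
  - by split=> [n b nr Ub|B hB nB no]; [exact: h1|exact: h2].
  - by exists e, (phi z), (phi z'); split => //; exact: cphi.
have [lam hlam] := choice lam_ex; exists lam; split; last by move=> m /hlam [].
have l0 : 0 <= l by rewrite el ed_ge0.
have tot : \sum_(m < r) lam m ^+ 2 <= r%:R * l ^+ 2.
  rewrite el ed_ed2.
  have : \sum_(m < r) lam m ^+ 2 <= r%:R * (\sum_(m < r) \sum_(k < dim c | own hX U x f m k) s k).
    rewrite mulr_sumr; apply: ler_sum => m _.
    by have [] := hlam m (ltn_ord m).
  move=> h; apply: le_trans h _; apply: ler_wpM2l => //.
  by apply: own_sum => k; exact: sqr_ge0.
have [lz|lp] := eqVneq l 0.
  rewrite big1 ?lz ?mulr0 // => m _.
  move: tot; rewrite lz expr0n /= mulr0 => tot.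
  have : lam m ^+ 2 <= \sum_(m < r) lam m ^+ 2.
    by rewrite [leRHS](bigD1 m) //= lerDl; apply: sumr_ge0 => n _; exact: sqr_ge0.
  have := sqr_ge0 (lam m) => h1 h2; apply/eqP; rewrite -sqrf_eq0; lra.
have lgt : 0 < l by rewrite lt_neqAle eq_sym lp.
(* Cauchy-Schwarz by comparing each term with l: the right-hand sides sum to at most [r * l], as the
   squares sum to at most [r * l ^+ 2]. *)
have h m : lam m <= (lam m ^+ 2 / l + l) / 2.
  rewrite ler_pdivlMr // -(ler_pM2r lgt) mulrDl divfK //.
  by have := sqr_ge0 (lam m - l); rewrite sqrrB; lra.
have : \sum_(m < r) lam m <= \sum_(m < r) (lam m ^+ 2 / l + l) / 2.
  by apply: ler_sum => m _; exact: h.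
rewrite -mulr_suml big_split /= -mulr_suml sumr_const card_ord -[l *+ r]mulr_natl => h1.
apply: le_trans h1 _; rewrite ler_pdivrMr //.
have : (\sum_(i < r) lam i ^+ 2) / l <= r%:R * l by rewrite ler_pdivrMr // -mulrA -expr2.
lra.
Qed.

(** Only the break points are required to be diagonal; [diagonal_seg] extends this to the
    segments. *)
Inductive diagonal_string : X -> X -> R -> Prop :=
| diagonal_string_nil p : diagonal p -> diagonal_string p p 0
| diagonal_string_cons p q q' l l' : diagonal p -> step p q l -> diagonal_string q q' l' ->
    diagonal_string p q' (l + l').

Lemma projects_string p q l : string p q l -> exists lam : nat -> R,
  \sum_(m < r) lam m <= r%:R * l /\ forall m, (m < r)%N ->
    exists p' q', [/\ projects m p p', projects m q q' & diagonal_string p' q' (lam m)].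
Proof.
elim=> {p q l} [p|p q q' l l' st _ [lam' [s' h']]].
  exists (fun=> 0); split; first by rewrite big1 // mulr0.
  move=> m mr; have [p' hp'] := projects_ex p mr; exists p', p'; split => //.
  by apply: diagonal_string_nil; exact: projects_diagonal hp'.
have [lam [s h]] := projects_step st; exists (fun m => lam m + lam' m); split.
  by rewrite big_split /= mulrDr lerD.
move=> m mr; have [p1 [q1 [hp hq st1]]] := h m mr; have [q2 [q3 [hq2 hq3 st2]]] := h' m mr.
have e := projects_uniq hq hq2; subst q2; exists p1, q3; split => //.
by apply: diagonal_string_cons st1 st2; exact: projects_diagonal hp.
Qed.

Lemma diagonal_string_ex p q l : diagonal p -> diagonal q -> string p q l ->
  exists2 l', diagonal_string p q l' & l' <= l.
Proof.
move=> dp dq st; have [lam [s h]] := projects_string st.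
have [[m mr ml]|no] := pselect (exists2 m, (m < r)%N & lam m <= l).
  have [p' [q' [hp hq ds]]] := h m mr; exists (lam m) => //.
  by rewrite (projects_uniq (projects_self mr dp) hp) (projects_uniq (projects_self mr dq) hq).
have r0 := sp_r S; exfalso.
have : \sum_(m < r) l < \sum_(m < r) lam m.
  apply: ltr_sum; first by apply/hasP; exists (Ordinal r0) => //; rewrite mem_index_enum.
  by move=> m _; rewrite ltNge; apply/negP => h1; apply: no; exists m.
by rewrite sumr_const card_ord -[l *+ r]mulr_natl; lra.
Qed.

Lemma tc_seg B (c : cell_index X) (y z : 'rV[R]_(dim c)) s : HS B -> unit_cube y -> unit_cube z ->
  0 <= s <= 1 ->
  tc B (chart c (seg y z s)) = (1 - s) * tc B (chart c y) + s * tc B (chart c z).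
Proof.
move=> hB cy cz hs; have cs := seg_cube cy cz hs.
have [[h ->]|[h ->]|[b [k [h1 h2 ->]]]] := tc_cases hB cy.
- by rewrite !tc_all //; lra.
- by rewrite !tc_none //; lra.
- by rewrite (tc_edge hB cz h1 h2) (tc_edge hB cs h1 h2) seg_cdist.
Qed.

Lemma diagonal_seg (c : cell_index X) (y z : 'rV[R]_(dim c)) s : unit_cube y -> unit_cube z ->
  0 <= s <= 1 -> diagonal (chart c y) -> diagonal (chart c z) -> diagonal (chart c (seg y z s)).
Proof.
move=> cy cz hs [h1 h2] [h1' h2']; split=> [n b nr Ub|B hB nB no].
  have h0 := G_HS gG S nr Ub; have h0' := G_HS gG S (sp_r S) Ub.
  by rewrite !tc_seg // h1 // h1'.
by rewrite tc_seg // h2 // h2' // !mulr0 addr0.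
Qed.

Lemma diagonal_string_l p q l : diagonal_string p q l -> diagonal p.
Proof. by case. Qed.

Lemma ed_eq0 n (y z : 'rV[R]_n) : euclid_dist y z = 0 -> y = z.
Proof.
move=> h; apply/rowP => k; have := ed_coord y z k; rewrite h normr_le0 subr_eq0.
by move/eqP.
Qed.

Lemma diagonal_path p q l : diagonal_string p q l -> exists c : R -> X,
  [/\ c 0 = p, c l = q, 0 <= l,
    forall s t : R, 0 <= s -> s <= t -> t <= l -> string (c s) (c t) (t - s) &
    forall s : R, 0 <= s -> s <= l -> diagonal (c s)].
Proof.
elim=> {p q l} [p dp|p q q' l l' dp st dq [c [c0 cl l0' cs cd]]].
  exists (fun=> p); split => // s t s0 st t0.
  have -> : t - s = 0 by lra.
  exact: string_nil.
have {dq} := diagonal_string_l dq => dq.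
have [i [y [z [cy cz ep eq el]]]] := st; have l0 : 0 <= l by rewrite el ed_ge0.
(* When l is 0, the quotient [s / l] is 0 and h is constant, which is right since y and z
   coincide. *)
pose h s : X := chart i (seg y z (s / l)).
have h0 : h 0 = p by rewrite /h mul0r seg0.
have hl : h l = q.
  rewrite /h; have [lz|ln] := eqVneq l 0; last by rewrite divff // seg1.
  by rewrite lz mul0r seg0 -eq; congr chart; apply: ed_eq0; rewrite -el.
have dv s : 0 <= s -> s <= l -> 0 <= s / l <= 1.
  move=> s0 sl; rewrite divr_ge0 //=; have [->|ln] := eqVneq l 0; first by rewrite invr0 mulr0.
  by rewrite ler_pdivrMr ?mul1r // lt_neqAle eq_sym ln.
have hs s t : 0 <= s -> s <= t -> t <= l -> string (h s) (h t) (t - s).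
  move=> s0 s_t tl; have [lz|ln] := eqVneq l 0.
    have -> : t = s by lra.
    by rewrite subrr; exact: string_nil.
  have /andP[a1 a2] := dv s s0 (le_trans s_t tl); have /andP[b1 b2] := dv t (le_trans s0 s_t) tl.
  have lp : 0 < l by rewrite lt_neqAle eq_sym ln.
  have := seg_string cy cz a1 (t := t / l); rewrite ler_pM2r ?invr_gt0 // => /(_ s_t b2).
  by rewrite -el -mulrBl divfK.
exists (fun s => if s <= l then h s else c (s - l)); split.
- by rewrite l0.
- case: ifP => [ll|_]; last by rewrite addrC addKr.
  have -> : l' = 0 by lra.
  by rewrite addr0 hl -c0 -cl; congr c; lra.
- exact: addr_ge0.
- move=> s t s0 s_t tl; case: (leP t l) => tl'.
    by rewrite (le_trans s_t tl'); exact: hs.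
  case: (leP s l) => sl.
    have -> : t - s = (l - s) + (t - l) by lra.
    apply: string_cat (hs _ _ s0 sl (lexx _)) _; rewrite hl -c0.
    by have := cs 0 (t - l); rewrite subr0; apply; lra.
  have -> : t - s = (t - l) - (s - l) by lra.
  by apply: cs; lra.
- move=> s s0 sl; case: (leP s l) => sl'; last by apply: cd; lra.
  by apply: diagonal_seg; rewrite ?ep ?eq //; exact: dv.
Qed.
End DiagonalStrings.

(** * Displacement of the diagonal *)

Lemma size_diff (T : eqType) (s t : seq T) : uniq s -> uniq t ->
  (size s + size [seq b <- t | b \notin s] = size t + size [seq b <- s | b \notin t])%N.
Proof.
move=> us ut.
have e : size [seq b <- s | b \in t] = size [seq b <- t | b \in s].
  apply: perm_size; apply: uniq_perm; rewrite ?filter_uniq // => z.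
  by rewrite !mem_filter andbC.
rewrite -(count_predC (mem t) s) -(count_predC (mem s) t) -!size_filter /= e.
by rewrite /predC /= addnAC.
Qed.

Lemma size_pairs_le (T V : Type) (F : nat -> T -> V) (t : nat -> seq T) (s : seq nat) M :
  (forall n, (size (t n) <= M)%N) -> (size [seq F n c | n <- s, c <- t n] <= size s * M)%N.
Proof.
move=> h; elim: s => //= n s IH; rewrite size_cat size_map mulSn.
exact: leq_add.
Qed.

Lemma sum_subset (R : realType) (T : eqType) (s t : seq T) (F : T -> R) : uniq s -> uniq t ->
  {subset s <= t} -> (forall b, 0 <= F b) -> \sum_(b <- s) F b <= \sum_(b <- t) F b.
Proof.
move=> us ut st F0; rewrite [leRHS](bigID (mem s)) /= -[X in _ <= X + _]big_filter.
have -> : \sum_(b <- [seq b <- t | b \in s]) F b = \sum_(b <- s) F b.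
  apply: perm_big; apply: uniq_perm; rewrite ?filter_uniq // => z; rewrite mem_filter /=.
  by case zs : (z \in s) => //=; exact: st.
by rewrite lerDl; exact: sumr_ge0.
Qed.

Section Counting.
Context {R : realType} {X : cubeComplex R}.
Hypothesis hX : CAT0_cube_complex X.
Implicit Types (u v w : vert X) (p q : X) (B C : set (vert X)).
Notation HS := (HS hX).
Notation WX := (WX hX).
Notation dX := (dX hX).
Notation tc := (tc (X := X)).
Variable N : nat.
Hypothesis dN : forall i : cell_index X, (dim i <= N)%N.

(** Only half-spaces crossing the cell of the step contribute; the cell has at most N directions,
    and each coordinate changes by at most l. *)
Lemma sum_tc_step x (s : seq (set (vert X))) p q l : uniq s ->
  (forall B, B \in s -> HS B /\ ~ B x) -> step p q l ->
  \sum_(B <- s) `|tc B p - tc B q| <= N%:R * l.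
Proof.
move=> us hs st; have [c [z [z' [cz cz' ep eq el]]]] := st; subst p q.
have l0 : 0 <= l by rewrite el ed_ge0.
pose D := [seq @dirHS R X hX x c k | k <- enum 'I_(dim c)].
have uD : uniq D by rewrite map_inj_uniq ?enum_uniq //; exact: dirHS_inj.
pose F B := `|tc B (chart c z) - tc B (chart c z')|.
have -> : \sum_(B <- s) `|tc B (chart c z) - tc B (chart c z')| = \sum_(B <- [seq B <- s | B \in D]) F B.
  rewrite big_filter [LHS](bigID (mem D)) /= [X in _ + X]big_seq_cond [X in _ + X]big1 ?addr0 // => B.
  move=> /andP[Bs nD]; have [hB nB] := hs _ Bs.
  have [[h _]|[h _]|[k ek]] := tc_dir hB nB cz.
  - by rewrite !tc_all // subrr normr0.
  - by rewrite !tc_none // subrr normr0.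
  - by case/negP: nD; apply/mapP; exists k; rewrite ?mem_enum.
apply: le_trans (sum_subset (filter_uniq _ us) uD _ _) _.
- by move=> B; rewrite mem_filter => /andP[].
- by move=> B; exact: normr_ge0.
rewrite big_map big_enum /=.
apply: (@le_trans _ _ (\sum_(k < dim c) l)).
  apply: ler_sum => k _; apply: tc_step st.
  by have [] := dirHS_edge hX x k.
rewrite sumr_const card_ord -[l *+ _]mulr_natl; apply: ler_wpM2r => //.
by rewrite ler_nat.
Qed.
Lemma sum_tc_string x (s : seq (set (vert X))) p q l : uniq s ->
  (forall B, B \in s -> HS B /\ ~ B x) -> string p q l ->
  \sum_(B <- s) `|tc B p - tc B q| <= N%:R * l.
Proof.
move=> us hs; elim=> {p q l} [p|p q q' l m st _ IH].
  by rewrite mulr0 big1 // => B _; rewrite subrr normr0.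
have h1 := sum_tc_step us hs st; rewrite mulrDr; apply: le_trans (lerD h1 IH).
rewrite -big_split /=; apply: ler_sum => B _.
rewrite -[X in `|X - _|](subrK (tc B q)) -addrA; exact: ler_normD.
Qed.

Lemma dX_le_dist u v : (dX u v)%:R <= N%:R * dist (vx u) (vx v).
Proof.
have h l : string (vx u) (vx v) l -> (dX u v)%:R <= N%:R * l.
  move=> st; have us := sepX_uniq hX u v.
  have hs B : B \in sepX hX u v -> HS B /\ ~ B u by move=> /mem_sepX [].
  apply: le_trans (sum_tc_string us hs st).
  rewrite -size_sepX -sum1_size natr_sum le_eqVlt; apply/orP; left; apply/eqP.
  apply: eq_big_seq => B /mem_sepX [hB nB hv].
  by rewrite !tc_vertex // (asboolT hv) (asboolF nB) /= sub0r normrN normr1.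
have [N0|N1] := eqVneq N 0%N.
  by have [l st] := string_ex hX (vx u) (vx v); have := h l st; rewrite N0 !mul0r.
have Np : 0 < N%:R :> R by rewrite ltr0n lt0n.
rewrite -ler_pdivrMl //; apply: (dist_lb hX) => l st.
by rewrite ler_pdivrMl //; exact: h.
Qed.

Section Spread.
Variable Gamma : set (X -> X).
Hypothesis gG : subgroup_of_Aut Gamma.
Variables (K U : set (set (vert X))) (x : vert X) (r : nat) (f : nat -> vert X -> vert X).
Hypothesis S : spread HS (GamV Gamma) K U x r f.
Notation G := (G f).
Notation diagonal := (diagonal hX U x r f).
Notation diagonal_vertex := (diagonal_vertex hX x r f).

Lemma vertex_ideal w m : (m < r)%N -> exists u : seq (set (vert X)), ideal U u /\
  forall b, b \in u <-> U b /\ G m b w.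
Proof.
move=> mr; have [g [Gg fK gK]] := f_inv gG S mr.
pose s := [seq B <- sepX hX x w | `[< exists2 b, U b & B = G m b >]].
have mu b : b \in undup [seq g @` B | B <- s] <-> U b /\ G m b w.
  rewrite mem_undup; split.
    move=> /mapP [B]; rewrite mem_filter => /andP[/asboolP [b' Ub ->] /mem_sepX [_ _ h] ->].
    by rewrite {1}/G (im_can _ fK).
  move=> [Ub h]; apply/mapP; exists (G m b); last by rewrite /G (im_can _ fK).
  rewrite mem_filter; apply/andP; split; first by apply/asboolP; exists b.
  by apply/mem_sepX; split; [exact: (G_HS gG S)|exact: (G_x S)|exact: h].
exists (undup [seq g @` B | B <- s]); split => //; split; first exact: undup_uniq.
- by move=> b /mu [].
- by move=> b b' /mu [Ub h] Ub' bb'; apply/mu; split => //; move: h; apply: image_subset.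
Qed.

Lemma diagonal_vertex_mem (u : seq (set (vert X))) v m b : ideal U u -> diagonal_vertex u v -> (m < r)%N -> U b ->
  (G m b v <-> b \in u).
Proof.
move=> [_ uU _] hv mr Ub; rewrite hv; [|exact: (G_HS gG S)|exact: (G_x S)].
split=> [[n [c [nr cu e]]]|bu]; last by exists m, b.
by have [_ ->] := G_disj gG S mr nr Ub (uU _ cu) e.
Qed.

Lemma diagonal_vertex_diagonal (u : seq (set (vert X))) v : ideal U u -> diagonal_vertex u v -> diagonal (vx v).
Proof.
move=> iu hv; have [_ uU _] := iu; have r0 := sp_r S; split=> [n b nr Ub|B hB nB no].
  rewrite !tc_vertex; [|exact: (G_HS gG S)|exact: (G_HS gG S)].
  congr (nat_of_bool _)%:R; apply/asboolP/asboolP => h.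
    by apply/(diagonal_vertex_mem iu hv r0 Ub)/(diagonal_vertex_mem iu hv nr Ub).
  by apply/(diagonal_vertex_mem iu hv nr Ub)/(diagonal_vertex_mem iu hv r0 Ub).
rewrite tc_vertex // asboolF // => /(hv _ hB nB) [n [b [nr bu]]].
by apply: no => //; exact: uU.
Qed.

Lemma diagonal_vertex_dX (u : seq (set (vert X))) v : ideal U u -> diagonal_vertex u v -> dX x v = (r * size u)%N.
Proof.
move=> iu hv; have [uu uU _] := iu.
rewrite -size_sepX -{1}(size_iota 0 r) -(size_allpairs (fun m b => G m b)).
apply: perm_size; apply: uniq_perm; first exact: sepX_uniq.
  apply: allpairs_uniq => //; first exact: iota_uniq.
  move=> _ _ /allpairsP [[m b] [/= mr bu ->]] /allpairsP [[n c] [/= nr cu ->]] /= e.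
  rewrite !mem_iota !add0n in mr nr.
  by have [-> ->] := G_disj gG S mr nr (uU _ bu) (uU _ cu) e.
move=> B; apply/idP/idP.
  move=> /mem_sepX [hB nB] /(hv _ hB nB) [n [b [nr bu ->]]].
  by apply/allpairsP; exists (n, b); rewrite /= mem_iota add0n.
move=> /allpairsP [[n b] [/=]]; rewrite mem_iota add0n => nr bu ->.
have hB := G_HS gG S nr (uU _ bu); have nB := G_x S nr (uU _ bu).
by apply/mem_sepX; split => //; apply/hv => //; exists n, b.
Qed.

Lemma diagonal_unbounded (M : R) : exists2 p, diagonal p & M <= dist (vx x) p.
Proof.
(* The factor N makes up for the loss in [dX_le_dist]. *)
have [u iu su] := sp_inf S (N * (Num.bound M)).+1.
have [v hv] := diagonal_vertex_ex gG S iu; exists (vx v); first exact: diagonal_vertex_diagonal hv.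
have := dX_le_dist x v; rewrite (diagonal_vertex_dX iu hv) => h.
have r0 := sp_r S; have le : ((N * (Num.bound M)).+1 <= r * size u)%N.
  by apply: leq_trans su _; rewrite leq_pmull.
have h1 : (N * (Num.bound M)).+1%:R <= N%:R * dist (vx x) (vx v).
  by apply: le_trans h; rewrite ler_nat.
rewrite -natr1 natrM in h1.
have d0 := dist_ge0 hX (vx x) (vx v).
have N0 : 0 <= N%:R :> R by [].
have [M0|M0] := leP M 0; first exact: le_trans d0.
have hM : M < (Num.bound M)%:R by have := archi_boundP (ltW M0).
apply: contrapT => /negP; rewrite -ltNge => lt; nra.
Qed.

(** Rounding towards x treats the factors alike because the coordinates of p do, so the lower corner
    is diagonal too. *)
Lemma diagonal_lower p : diagonal p -> exists (u : seq (set (vert X))) v, [/\ ideal U u, diagonal_vertex u v,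
  (forall B, HS B -> ~ B x -> (B v <-> tc B p = 1)) & dist p (vx v) <= N%:R].
Proof.
have [c [z cz <-]] := chart_cover R X p => -[h1 h2]; have r0 := sp_r S.
have [d hd] := lower_corner hX x cz.
have [u [iu mu]] := vertex_ideal (@crnV R X c d) r0.
exists u, (crnV d); split => //; last first.
  by apply: le_trans (dist_corner hX d cz) _; rewrite ler_nat.
move=> B hB nB; rewrite hd //; split.
  move=> t1; have [[n [b [nr Ub eB]]]|no] := pselect (exists n b, [/\ (n < r)%N, U b & B = G n b]).
    exists n, b; split => //; apply/mu; split => //; apply/hd; [exact: (G_HS gG S)|exact: (G_x S)|].
    by rewrite -(h1 n b nr Ub) -eB.
  move: t1; rewrite h2 //; first by move=> e; exfalso; lra.
  by move=> n b nr Ub e; apply: no; exists n, b.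
move=> [n [b [nr /mu [Ub hb] ->]]]; rewrite h1 //; apply/hd => //; [exact: (G_HS gG S)|exact: (G_x S)].
Qed.

Section Displacement.
Variables (a ai : vert X -> vert X).
Hypotheses (Ga : GamV Gamma a) (Gai : GamV Gamma ai) (aK : cancel a ai) (aiK : cancel ai a).
Variables (u : seq (set (vert X))) (v : vert X).
Hypotheses (iu : ideal U u) (hv : diagonal_vertex u v).

Lemma pull_back B : HS B -> B (a v) -> ~ B (a x) ->
  exists n b, [/\ (n < r)%N, b \in u & B = a @` G n b].
Proof.
move=> hB Bv nB; have hC : HS (ai @` B) by exact: (GamV_HS gG).
have nC : ~ (ai @` B) x by move/(imE _ _ aiK aK).
have Cv : (ai @` B) v by apply/(imE _ _ aiK aK).
have [n [b [nr bu e]]] := proj1 (hv hC nC) Cv; exists n, b; split => //.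
by rewrite -e (im_can _ aiK).
Qed.

Lemma size_sep_sub y z (T : eqType) (s : seq T) (h : T -> set (vert X)) : uniq s ->
  {in s &, injective h} -> (forall c, c \in s -> h c \in sepX hX y z) -> (size s <= dX y z)%N.
Proof.
move=> us hi hs; rewrite -size_sepX -(size_map h); apply: uniq_leq_size.
  by rewrite map_inj_in_uniq.
by move=> _ /mapP [c cs ->]; exact: hs.
Qed.

(** Let a carry the factor i to the factor j. Members of the factor j crossed between x and a v then
    correspond to members of the factor i crossed between x and v, apart from half-spaces that
    separate x from a x. *)
Lemma ideal_size_close j (u' : seq (set (vert X))) : (j < r)%N -> ideal U u' ->
  (forall b, b \in u' <-> U b /\ G j b (a v)) ->
  (size u' <= size u + dX x (a x))%N /\ (size u <= size u' + dX x (a x))%N.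
Proof.
move=> jr [uu' uU' _] mu'; have [uu uU _] := iu.
have [i ir eij] := sp_preim S Ga jr.
have [fj [Gfj fjK fjK']] := f_inv gG S jr; have [fi [Gfi fiK fiK']] := f_inv gG S ir.
have aG n b : a @` G n b = (a \o f n) @` b by rewrite /G image_comp.
split.
- rewrite -(count_predC (fun c => `[< G j c (a x) >]) u') -!size_filter addnC.
  apply: leq_add; last first.
    apply: (@size_sep_sub x (a x) _ _ (G j)); first exact: filter_uniq.
      by move=> c c' _ _; exact: (G_inj gG S jr).
    move=> c; rewrite mem_filter => /andP[/asboolP h /uU' Uc].
    by apply/mem_sepX; split => //; [exact: (G_HS gG S)|exact: (G_x S)].
  rewrite -(size_map (fun b => fj @` (a @` G i b)) u); apply: uniq_leq_size; first exact: filter_uniq.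
  move=> c; rewrite mem_filter /= => /andP[/asboolPn nc cu']; have [Uc cv] := proj1 (mu' c) cu'.
  have [n [b [nr bu e]]] := pull_back (G_HS gG S jr Uc) cv nc.
  have [c' Kc' e'] : translates K (a \o f i) (G j c) by rewrite eij; exists c => //; exact: (sp_UK S).
  have e2 : G n b = G i c' by apply: (im_inj aK); rewrite -e e' aG.
  have ni : n = i.
    apply: contrapT => ni; apply: (sp_disj S nr ir ni (uU _ bu)).
    by exists c'.
  by apply/mapP; exists b => //; rewrite -ni -e /G (im_can _ fjK).
- rewrite -(count_predC (fun c => `[< (a @` G i c) x >]) u) -!size_filter addnC.
  apply: leq_add; last first.
    rewrite dX_sym; apply: (@size_sep_sub (a x) x _ _ (fun c => a @` G i c)); first exact: filter_uniq.
      by move=> c c' _ _ /(im_inj aK); exact: (G_inj gG S ir).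
    move=> c; rewrite mem_filter => /andP[/asboolP h /uU Uc].
    apply/mem_sepX; split => //; first by apply: (GamV_HS gG Ga); exact: (G_HS gG S).
    by move/(imE _ _ aK aiK); rewrite aK; exact: (G_x S).
  rewrite -(size_map (fun c => fi @` (ai @` G j c)) u'); apply: uniq_leq_size; first exact: filter_uniq.
  move=> b; rewrite mem_filter /= => /andP[/asboolPn nb bu]; have Ub := uU _ bu.
  have [c Kc e] : translates K (f j) (a @` G i b).
    by rewrite -eij; exists b; [exact: (sp_UK S)|rewrite aG].
  rewrite -/(G j c) in e.
  have Uc : U c by apply/(sp_U S jr Kc); rewrite -/(G j c) -e.
  apply/mapP; exists c; last by rewrite -e (im_can _ aK) /G (im_can _ fiK).
  apply/mu'; split => //; rewrite -e; exists v => //.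
  by apply/(diagonal_vertex_mem iu hv).
Qed.

(** In each factor the ideals of v and a v have sizes differing by at most D, and one of their two
    differences has at most K0 elements, so the other has at most K0 + D. A half-space separating v
    from a v separates x from a x or shows up in one of these 2 r differences. *)
Lemma displacement K0 : (forall s1 s2 : seq (set (vert X)), ideal U s1 -> ideal U s2 ->
    (size [seq b <- s1 | b \notin s2] <= K0)%N \/ (size [seq b <- s2 | b \notin s1] <= K0)%N) ->
  (dX v (a v) <= dX x (a x) + (r * (K0 + dX x (a x)) + r * (K0 + dX x (a x))))%N.
Proof.
move=> hK; set D := dX x (a x); have [uu uU _] := iu.
have ex j : exists u' : seq (set (vert X)), (j < r)%N -> ideal U u' /\
    forall b, b \in u' <-> U b /\ G j b (a v).
  have [jr|] := boolP (j < r)%N; last by exists [::].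
  by have [u' h] := vertex_ideal (a v) jr; exists u'.
have [u' hu'] := choice ex.
have close j : (j < r)%N -> (size [seq b <- u' j | b \notin u] <= K0 + D)%N /\
    (size [seq b <- u | b \notin u' j] <= K0 + D)%N.
  move=> jr; have [iu' mu'] := hu' j jr; have [uu' _ _] := iu'.
  have [s1 s2] := ideal_size_close jr iu' mu'; rewrite -/D in s1 s2.
  have := size_diff uu uu'; have := hK _ _ iu iu'; move: s1 s2.
  set m1 := size [seq b <- u' j | b \notin u]; set m2 := size [seq b <- u | b \notin u' j].
  set m3 := size u; set m4 := size (u' j).
  clearbody D m1 m2 m3 m4; clear; lia.
pose s1 j := if (j < r)%N then [seq b <- u' j | b \notin u] else [::].
pose s2 j := if (j < r)%N then [seq b <- u | b \notin u' j] else [::].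
have sub : {subset sepX hX v (a v) <= sepX hX x (a x) ++
    ([seq G j c | j <- iota 0 r, c <- s1 j] ++ [seq ~` G j c | j <- iota 0 r, c <- s2 j])}.
  move=> B /mem_sepX [hB nBv Bav]; rewrite !mem_cat.
  have [Bx|nBx] := pselect (B x).
    have hC := HS_compl hB; have nC : ~ (~` B) x by apply.
    have [n [b [nr bu e]]] := proj1 (hv hC nC) nBv.
    apply/orP; right; apply/orP; right; apply/allpairsPdep; exists n, b.
    rewrite mem_iota add0n nr -e setCK; split => //; rewrite /s2 nr mem_filter bu andbT.
    apply/negP => bu'; have [_ mu'] := hu' n nr; move/mu': bu' => [_].
    by rewrite -e; apply.
  have [Bax|nBax] := pselect (B (a x)).
    by apply/orP; left; apply/mem_sepX.
  have [n [b [nr bu e]]] := pull_back hB Bav nBax.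
  have [j jr ej] := sp_img S Ga nr.
  have [c Kc ec] : translates K (f j) B.
    by rewrite -ej; exists b; [exact/(sp_UK S)/uU|rewrite e /G image_comp].
  rewrite -/(G j c) in ec; have Uc : U c by apply/(sp_U S jr Kc); rewrite -/(G j c) -ec.
  apply/orP; right; apply/orP; left; apply/allpairsPdep; exists j, c.
  rewrite mem_iota add0n jr -ec; split => //; rewrite /s1 jr mem_filter; apply/andP; split.
    by apply/negP => /(diagonal_vertex_mem iu hv jr Uc); rewrite -ec.
  by have [_ mu'] := hu' j jr; apply/mu'; rewrite -ec.
rewrite -size_sepX; apply: leq_trans (uniq_leq_size (sepX_uniq hX _ _) sub) _.
rewrite !size_cat size_sepX leq_add2l -{3 4}(size_iota 0 r); apply: leq_add.
  by apply: size_pairs_le => n; rewrite /s1; case: ifP => // /close [].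
by apply: size_pairs_le => n; rewrite /s2; case: ifP => // /close [].
Qed.
End Displacement.

Lemma diagonal_displacement g : Gamma g -> exists M : R,
  forall p, diagonal p -> dist (g p) p <= M.
Proof.
move=> Gg; have [h [Gh gK hK cg ch]] := Gamma_inv gG Gg.
have [K0 hK0] := sp_qc S.
exists (N%:R + (dX x (gV g x) + (r * (K0 + dX x (gV g x)) + r * (K0 + dX x (gV g x))))%:R + N%:R).
move=> p /diagonal_lower [u [v [iu hv _ dp]]].
have GVg : GamV Gamma (gV g) by exists g.
have GVh : GamV Gamma (gV h) by exists h.
have := displacement GVg GVh (gVK cg ch gK) (gVK ch cg hK) iu hv hK0 => le.
have t1 := dist_tri hX (g p) (g (vx v)) p; have t2 := dist_tri hX (g (vx v)) (vx v) p.
have e1 : dist (g p) (g (vx v)) = dist p (vx v) by apply: Aut_dist; exists h.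
have e2 : dist (g (vx v)) (vx v) <= (dX v (gV g v))%:R.
  by rewrite -vx_gV // dist_sym; exact: dist_vertex.
have e3 : dist (vx v) p <= N%:R by rewrite dist_sym.
have e4 : (dX v (gV g v))%:R <= (dX x (gV g x) + (r * (K0 + dX x (gV g x)) + r * (K0 + dX x (gV g x))))%:R :> R.
  by rewrite ler_nat.
by rewrite e1 in t1; lra.
Qed.
End Spread.
End Counting.

(** * The fixed point at infinity *)

Section UltraLimits.
Context {R : realType} (F : set_system nat) {UF : UltraFilter F}.

Lemma ultra_finite (A : finType) (g : nat -> A) : exists a, F [set n | g n = a].
Proof.
apply: contrapT => no; have h a : F [set n | g n <> a].
  by have [h|//] := in_ultra_setVsetC [set n | g n = a] UF; case: no; exists a.
have hs (s : seq A) : F [set n | g n \notin s].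
  elim: s => [|a s IH]; first exact: filterS filterT.
  apply: filterS2 (h a) IH => n ne ns.
  by rewrite /= inE negb_or ns andbT; apply/eqP.
by have [n /=] := filter_ex (hs (enum A)); rewrite mem_enum.
Qed.

Lemma ultra_real (a : nat -> R) : F [set n | 0 <= a n <= 1] -> exists l, 0 <= l <= 1 /\
  forall e, 0 < e -> F [set n | `|a n - l| < e].
Proof.
move=> Fa; pose S := [set t | F [set n | t <= a n]].
have S0 : S 0 by apply: filterS Fa => n /andP[].
have S1 : ubound S 1.
  move=> t St; have [n [h1 /andP[_ h2]]] := filter_ex (filterI St Fa).
  exact: le_trans h1 h2.
have hS : has_sup S by split; [exists 0|exists 1].
exists (sup S); split.
  by rewrite (ub_le_sup (proj2 hS) S0) /=; apply: ge_sup => //; exists 0.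
move=> e e0; have [t St lt] := sup_adherent e0 hS.
have F2 : F [set n | ~ (sup S + e / 2 <= a n)].
  have [h|//] := in_ultra_setVsetC [set n | sup S + e / 2 <= a n] UF.
  by have := ub_le_sup (proj2 hS) h; lra.
apply: filterS2 St F2 => n /= h1 /negP; rewrite -ltNge => h2.
by rewrite ltr_norml; apply/andP; split; lra.
Qed.
End UltraLimits.

Section Ray.
Context {R : realType} {X : cubeComplex R}.
Hypothesis hX : CAT0_cube_complex X.
Implicit Types (u v w : vert X) (p q : X) (B C : set (vert X)).
Notation HS := (HS hX).
Notation WX := (WX hX).
Notation dX := (dX hX).
Notation tc := (tc (X := X)).
Variable N : nat.
Hypothesis dN : forall i : cell_index X, (dim i <= N)%N.
Variable Gamma : set (X -> X).
Hypothesis gG : subgroup_of_Aut Gamma.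
Variables (K U : set (set (vert X))) (x : vert X) (r : nat) (f : nat -> vert X -> vert X).
Hypothesis S : spread HS (GamV Gamma) K U x r f.
Notation G := (G f).
Notation diagonal := (diagonal hX U x r f).
Notation diagonal_vertex := (diagonal_vertex hX x r f).

(** The ideal of the lower vertex of p has bounded size, so [sp_fin] leaves finitely many choices
    for its members. *)
Lemma diagonal_support (M : R) : exists T : seq (set (vert X)), forall p, diagonal p ->
  dist (vx x) p <= M -> forall B, HS B -> ~ B x -> tc B p <> 0 -> B \in T.
Proof.
pose L := Num.bound (N%:R * (`|M| + N%:R)).
have [s hs] := sp_fin S L.+1.
exists [seq G n b | n <- iota 0 r, b <- s] => p dp dM B hB nB t0.
have [u [v [iu hv lv dv]]] := diagonal_lower dN gG S dp; have [uu uU uup] := iu.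
have sL : (size u <= L)%N.
  have h := dX_le_dist hX dN x v; rewrite (diagonal_vertex_dX gG S iu hv) in h.
  have t1 := dist_tri hX (vx x) p (vx v).
  have h2 : N%:R * dist (vx x) (vx v) <= N%:R * (`|M| + N%:R).
    by apply: ler_wpM2l => //; have := ler_norm M; lra.
  have h3 : N%:R * (`|M| + N%:R) < L%:R.
    by apply: archi_boundP; rewrite mulr_ge0 // addr_ge0.
  have : (r * size u)%:R < L%:R :> R by apply: le_lt_trans h (le_lt_trans h2 h3).
  rewrite ltr_nat => /ltnW; apply: leq_trans; rewrite leq_pmull //; exact: sp_r S.
have [[n [b [nr Ub eB]]]|no] := pselect (exists n b, [/\ (n < r)%N, U b & B = G n b]); last first.
  by case: t0; case: dp => _; apply => // n b nr Ub e; apply: no; exists n, b.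
apply/allpairsP; exists (n, b) => /=; rewrite mem_iota add0n; split => //.
have [bu|nbu] := boolP (b \in u); first exact: (hs u iu (leqW sL)).
(* A half-space with fractional coordinate at p is not in u, but adding it gives an ideal: whatever
   is strictly larger has coordinate 1 by [tc_sub]. Hence the bound L + 1 in the choice of s. *)
apply: (hs (b :: u)); rewrite ?mem_head //; split => /=; first by rewrite nbu.
  by move=> c; rewrite inE => /orP[/eqP ->|/uU].
move=> c d; rewrite !inE => /orP[/eqP -> Ud bd|cu Ud cd]; last by rewrite (uup c d) ?orbT.
have [->|ne] := eqVneq d b; first by [].
have hC := G_HS gG S nr Ud; have nC := G_x S nr Ud.
apply/(diagonal_vertex_mem gG S iu hv nr Ud)/lv => //.
apply: (tc_sub hB hC); first by rewrite eB; exact: image_subset.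
  by rewrite eB => /(G_inj gG S nr) e; case/eqP: ne.
by rewrite lt_neqAle eq_sym; apply/andP; split; [exact/eqP|case/andP: (tc_itv p hB)].
Qed.

(** The ultrafilter selects one pattern of coordinates 0 and 1 on the finite support. Points with
    this pattern share a cell by [same_cell], and there the chart coordinates have ultralimits. *)
Lemma diagonal_limit (F : set_system nat) {UF : UltraFilter F} (q : nat -> X) (M : R) :
  F [set n | diagonal (q n) /\ dist (vx x) (q n) <= M] ->
  exists P, forall e : R, 0 < e -> F [set n | dist (q n) P < e].
Proof.
move=> Fq; have [T hT] := diagonal_support M.
pose key p := [ffun k : 'I_(size T) => (tc (nth setT T k) p == 1, tc (nth setT T k) p == 0)].
have [kap hk] := ultra_finite (fun n => key (q n)).
have [n0 [k0 [d0 m0]]] := filter_ex (filterI hk Fq).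
have [c [y0 cy0 ey0]] := chart_cover R X (q n0).
have cq n : key (q n) = kap -> diagonal (q n) -> dist (vx x) (q n) <= M -> cell c (q n).
  move=> kn dn mn.
  have main B : HS B -> ~ B x -> (tc B (q n) == 1) = (tc B (q n0) == 1) /\
      (tc B (q n) == 0) = (tc B (q n0) == 0).
    move=> hB nB; have [BT|nT] := boolP (B \in T).
      have kT : (index B T < size T)%N by rewrite index_mem.
      have := congr1 (fun g : {ffun _ -> _} => g (Ordinal kT)) (etrans kn (esym k0)).
      by rewrite !ffunE /= nth_index // => -[-> ->].
    have z1 : tc B (q n) = 0 by apply: contrapT => h; case/negP: nT; exact: (hT (q n)).
    have z2 : tc B (q n0) = 0 by apply: contrapT => h; case/negP: nT; exact: (hT (q n0)).
    by rewrite z1 z2.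
  have eqE (a b d : R) : (a == d) = (b == d) -> (a = d <-> b = d).
    by move=> e; split => /eqP; [rewrite e|rewrite -e] => /eqP.
  have both B : HS B -> (tc B (q n) = 1 <-> tc B (q n0) = 1) /\ (tc B (q n) = 0 <-> tc B (q n0) = 0).
    move=> hB; have [Bx|nB] := pselect (B x); last first.
      by have [/eqE e1 /eqE e2] := main B hB nB.
    have [/eqE e1 /eqE e2] := main _ (HS_compl hB) (fun h => h Bx).
    rewrite !tc_compl // in e1 e2.
    have t1 (a : R) : (1 - a = 1) <-> (a = 0) by split => h; lra.
    have t0 (a : R) : (1 - a = 0) <-> (a = 1) by split => h; lra.
    by rewrite !t1 in e1; rewrite !t0 in e2.
  apply: (same_cell (hX := hX) (q := q n0)) => [B hB|B hB|]; [exact: (both B hB).1|exact: (both B hB).2|].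
  by exists y0.
have Fc : F [set n | cell c (q n)].
  by apply: filterS2 hk Fq => n kn [dn mn]; exact: cq.
have ex n : exists y : 'rV[R]_(dim c), cell c (q n) -> unit_cube y /\ chart c y = q n.
  have [[y cy ey]|nc] := pselect (cell c (q n)); first by exists y.
  by exists 0 => /nc.
have [y hy] := choice ex.
have lex (k : 'I_(dim c)) : exists l : R, 0 <= l <= 1 /\ forall e, 0 < e -> F [set n | `|y n 0 k - l| < e].
  apply: (ultra_real (F := F)); apply: filterS Fc => n /hy [cy _]; exact: cy.
have [l hl] := choice lex.
pose z : 'rV[R]_(dim c) := \row_k l k.
have cz : unit_cube z by move=> k; rewrite mxE; case: (hl k).
(* With n the dimension of c, the squared distance is at most n d^2, which is less than e^2 = (n +
   1)^2 d^2. *)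
exists (chart c z) => e e0; pose d := e / (dim c).+1%:R.
have d0' : 0 < d by rewrite divr_gt0.
have Fd : F [set n | forall k, `|y n 0 k - l k| < d].
  by apply: filter_forall => k; case: (hl k) => _ /(_ d d0').
apply: filterS2 Fc Fd => n /hy [cy ey] yd /=.
apply: le_lt_trans (dist_le hX (l := euclid_dist (y n) z) _) _.
  by apply: step_string; exists c, (y n), z; rewrite ey.
rewrite -(ltr_pXn2r (n := 2)) ?nnegrE ?ed_ge0 ?(ltW e0) // ed_ed2.
have ee : e = d * (dim c).+1%:R by rewrite /d divfK.
clearbody d.
apply: (@le_lt_trans _ _ (\sum_(k < dim c) d ^+ 2)).
  apply: ler_sum => k _; rewrite mxE -real_normK ?num_real //.
  by rewrite ler_pXn2r ?nnegrE ?(ltW d0') //; exact: ltW.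
rewrite sumr_const card_ord -[_ *+ _]mulr_natl ee exprMn mulrC.
rewrite ltr_pM2l ?exprn_gt0 // -natrX ltr_nat.
by rewrite expnS expn1 mulSn; lia.
Qed.

Lemma diagonal_base : diagonal (vx x).
Proof.
have r0 := sp_r S; split=> [n b nr Ub|B hB nB _].
  rewrite !tc_vertex; [|exact: (G_HS gG S)|exact: (G_HS gG S)].
  by rewrite !asboolF //; exact: (G_x S).
by rewrite tc_vertex // asboolF.
Qed.

(** A diagonal string to a point at distance at least n exceeds that distance by less than 1 / (n +
    1). By the triangle inequality none of its pieces can lose more. *)
Lemma near_geodesic n : exists c : R -> X,
  [/\ forall s : R, 0 <= s -> s <= n%:R -> diagonal (c s),
    forall s : R, 0 <= s -> s <= n%:R -> dist (vx x) (c s) <= s &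
    forall s t : R, 0 <= s -> s <= t -> t <= n%:R ->
      t - s - n.+1%:R^-1 <= dist (c s) (c t) <= t - s].
Proof.
have [p dp pn] := diagonal_unbounded dN gG S n%:R.
have e0 : 0 < n.+1%:R^-1 :> R by rewrite invr_gt0.
have [l st ll] := dist_near hX (vx x) p e0.
have [l' ds l'l] := diagonal_string_ex gG S diagonal_base dp st.
have [c [c0 cl l0 cs cd]] := diagonal_path gG S ds.
have nl : n%:R <= l'.
  apply: le_trans pn _; rewrite -c0 -cl; apply: (dist_le hX).
  by have := cs 0 l'; rewrite subr0; apply.
exists c; split=> [s s0 sn|s s0 sn|s t s0 st' tn].
- by apply: cd => //; exact: le_trans nl.
- rewrite -c0; apply: (dist_le hX).
  by have := cs 0 s; rewrite subr0; apply => //; exact: le_trans nl.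
have tl : t <= l' by exact: le_trans nl.
have h1 : dist (c s) (c t) <= t - s by apply: (dist_le hX); exact: cs.
rewrite h1 andbT.
have h2 : dist (c 0) (c s) <= s - 0 by apply: (dist_le hX); apply: cs => //; exact: le_trans tl.
have h3 : dist (c t) (c l') <= l' - t by apply: (dist_le hX); apply: cs => //; exact: le_trans st'.
have h4 := dist_tri hX (c 0) (c s) (c l'); have h5 := dist_tri hX (c s) (c t) (c l').
have h6 : l' < dist (c 0) (c l') + n.+1%:R^-1 by rewrite c0 cl; exact: le_lt_trans ll.
by move: h1 h2 h3 h4 h5 h6; set E : R := n.+1%:R^-1; clearbody E; lra.
Qed.

(** Diagonal points arbitrarily close to the ray are enough for the bounded displacement of the
    ray. *)
Lemma diagonal_ray : exists P : R -> X, geodesic_ray P /\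
  forall t e : R, 0 <= t -> 0 < e -> exists2 p, diagonal p & dist p (P t) < e.
Proof.
have [c hc] := choice near_geodesic.
have [F [UF FF]] := ultraFilterLemma eventually_filter.
have Fn m : F [set n | (m <= n)%N] by apply: FF; exists m.
have Fr (t : R) : F [set n | t <= n%:R].
  apply: filterS (Fn (Num.bound t)) => n /= bn.
  have [t0|t0] := leP t 0; first exact: le_trans t0 _.
  by apply: ltW; apply: lt_le_trans (archi_boundP (ltW t0)) _; rewrite ler_nat.
have lim (t : R) : exists P, 0 <= t -> forall e : R, 0 < e -> F [set n | dist (c n t) P < e].
  have [t0|nt] := pselect (0 <= t); last by exists (vx x).
  have Ft : F [set n | diagonal (c n t) /\ dist (vx x) (c n t) <= t].
    by apply: filterS (Fr t) => n tn; have [h1 h2 _] := hc n; split; [exact: h1|exact: h2].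
  by have [P hP] := diagonal_limit Ft; exists P.
have [P hP] := choice lim; exists P; split; last first.
  move=> t e t0 e0; have [n [h1 h2]] := filter_ex (filterI (hP t t0 e e0) (Fr t)).
  by exists (c n t) => //; have [h _ _] := hc n; exact: h.
have key s t e : 0 <= s -> s <= t -> 0 < e -> `|dist (P s) (P t) - (t - s)| <= e.
  move=> s0 st e0; have t0 := le_trans s0 st; have e3 : 0 < e / 3 by lra.
  have Fe : F [set n | n.+1%:R^-1 <= e / 3].
    apply: filterS (Fr (e / 3)^-1) => n /= h.
    rewrite -[leRHS]invrK lef_pV2 ?posrE ?invr_gt0 //; apply: le_trans h _.
    by rewrite ler_nat.
  have [n [[h1 h2] [h3 h4]]] := filter_ex (filterI (filterI (hP s s0 _ e3) (hP t t0 _ e3))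
    (filterI (Fr t) Fe)).
  rewrite /= in h1 h2 h3 h4.
  have [_ _ /(_ s t s0 st h3) /andP[a1 a2]] := hc n.
  have b1 := dist_tri hX (P s) (c n s) (P t); have b2 := dist_tri hX (c n s) (c n t) (P t).
  have b3 := dist_tri hX (c n s) (P s) (c n t); have b4 := dist_tri hX (P s) (P t) (c n t).
  rewrite (dist_sym (P s) (c n s)) in b1; rewrite (dist_sym (P t) (c n t)) in b4.
  move: a1 h4; set E : R := n.+1%:R^-1; clearbody E => a1 h4.
  by rewrite ler_norml; apply/andP; split; lra.
have eq s t : 0 <= s -> s <= t -> dist (P s) (P t) = t - s.
  move=> s0 st; apply/eqP; rewrite -subr_eq0 -normr_le0; apply/ler_addgt0Pr => e e0.
  by rewrite add0r; exact: key.
move=> s t s0 t0; have [st|/ltW ts] := leP s t.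
  by rewrite eq // distrC ger0_norm // subr_ge0.
by rewrite dist_sym eq // ger0_norm // subr_ge0.
Qed.

Lemma ray_image g P : @Aut R X g -> geodesic_ray P -> geodesic_ray (g \o P).
Proof. by move=> Ag rP s t s0 t0; rewrite /= Aut_dist //; exact: rP. Qed.

Lemma spread_fixed_point : has_fixed_point_at_infinity Gamma.
Proof.
have [P [rP hP]] := diagonal_ray.
exists [set c | geodesic_ray c /\ asymptotic P c]; first by exists P.
have fixes g c : Gamma g -> geodesic_ray c -> asymptotic P c ->
    geodesic_ray (g \o c) /\ asymptotic P (g \o c).
  move=> Gg rc [M hM]; have [h [Gh gK hK cg ch]] := Gamma_inv gG Gg.
  have Ag : @Aut R X g by exists h.
  split; first exact: ray_image.
  have [D hD] := diagonal_displacement dN gG S Gg.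
  (* The 2 accounts for passing from P t to the diagonal point p and, after applying g, back. *)
  exists (D + 2 + M) => t t0; have [p dp lp] := hP t 1 t0 ltr01.
  have b1 := dist_tri hX (P t) p (g (c t)); have b2 := dist_tri hX p (g p) (g (c t)).
  have b3 := dist_tri hX (g p) (g (P t)) (g (c t)).
  rewrite !(Aut_dist _ _ Ag) in b2 b3; have := hM t t0 => b4; have b5 := hD p dp.
  rewrite (dist_sym (P t) p) in b1; rewrite (dist_sym p (g p)) in b2.
  by rewrite /=; lra.
move=> g Gg; apply/seteqP; split => [_ [c [rc ac] <-]|c [rc ac]]; first exact: fixes.
have [h [Gh gK hK cg ch]] := Gamma_inv gG Gg.
exists (h \o c); first exact: fixes.
by apply/funext => t /=; rewrite hK.
Qed.
End Ray.

Theorem mainTheorem10 (R : realType) (X : cubeComplex R)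
    (Gamma : set (X -> X)) :
  CAT0_cube_complex X ->
  finite_dimensional X ->
  subgroup_of_Aut Gamma ->
  acts_essentially Gamma ->
  ~ has_fixed_point_at_infinity Gamma ->
  forall h : set X, half_space h ->
  exists2 hstar : set X, complementary h hstar &
    exists2 gamma, Gamma gamma & (hstar `<` gamma @` h)%classic.
Proof.
move=> hX fd gG es nofix h hh; have [//|[K [U [x [r [f S]]]]]] := flip_or_spread hX gG fd es hh.
have [N dN] := fd; case: nofix; exact: (@spread_fixed_point R X hX N dN Gamma gG K U x r f S).
Qed.
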